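(* Let $D\subset\mathbb{R}^3$ be a bounded domain such that either $D=\Omega_2$ or $D$ has smooth boundary. Assume that the parameters satisfy $$\zeta\ge\sqrt{(\lambda+2\mu)/\mu},\qquad \frac{\rho\gamma^2}{\eta^2}\ge 1,\qquad \zeta^2-1\ge 2\gamma\zeta,\qquad \zeta\ge\sqrt3,\qquad \alpha_0<\frac{\lambda+\mu}{2\gamma(\lambda+2\mu)} .$$ Then, for all frequencies $\omega\in\mathbb{C}$ except possibly those in a discrete set, there exists a constant $C>0$ such that $$\sup_{\Psi\in H_0^1(D)^4\setminus\{0\}}\frac{|\mathcal{B}_D(\Phi,\Psi)|}{\|\Psi\|_{H^1_0(D)^4}}\ \ge\ C\,\|\Phi\|_{H_0^1(D)^4}\qquad\text{for all }\Phi\in H_0^1(D)^4 .$$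
   Context: Material constants: density $\rho>0$; Lamé constants $\lambda,\mu$ with $\mu>0$, $3\lambda+2\mu>0$; $\gamma=(3\lambda+2\mu)\alpha_T$ and $\eta=T_0\gamma/\lambda_0$ with constants $\alpha_T,T_0,\lambda_0>0$; $\kappa>0$; frequency $\omega$; $q=\mathbf{i}\omega/\kappa$, where $\mathbf{i}$ is the imaginary unit. Geometry: $\Omega\subset\mathbb{R}^3$ is a bounded domain with smooth boundary, $\overline\Omega\subset B_1$, where $B_1=\{x\in\mathbb{R}^3:|x_j|<l_j,\ j=1,2,3\}$ with $l_j>0$; $B_2=\{x\in\mathbb{R}^3:|x_j|<l_j+d_j,\ j=1,2,3\}$ with $d_j>0$; $\Omega_2=B_2\setminus\overline\Omega$. PML: $\alpha_0>0$ is a constant and $l_j<\bar l_j\le l_j+d_j$. With $h(s)=e^{-1/s}$ for $s>0$ and $h(s)=0$ for $s\le0$, the function $\alpha_j$ on $\mathbb{R}$ is $\alpha_j(t)=0$ for $|t|\le l_j$, $\alpha_j(t)=\alpha_0\,h(\tau)/(h(\tau)+h(1-\tau))$ with $\tau=(|t|-l_j)/(\bar l_j-l_j)$ for $l_j\le|t|\le\bar l_j$, and $\alpha_j(t)=\alpha_0$ for $|t|\ge\bar l_j$. Let $z=\zeta+\mathbf{i}$ with a fixed real $\zeta>0$, $s_j=s_j(x_j)=1+z\alpha_j(x_j)$, $J=s_1s_2s_3$, $A=\mathrm{diag}(s_2s_3,\,s_1s_3,\,s_1s_2)$, $B=\mathrm{diag}(s_1^{-1},s_2^{-1},s_3^{-1})$,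 $K=\mathrm{diag}(s_2s_3/s_1,\ s_1s_3/s_2,\ s_1s_2/s_3)$. For a vector field $\boldsymbol{u}$, $(\nabla\boldsymbol{u})_{ij}=\partial_{x_j}u_i$, $\tilde\epsilon(\boldsymbol{u})=\frac12(\nabla\boldsymbol{u}\,B^\top+B(\nabla\boldsymbol{u})^\top)$, $\tilde\sigma(\boldsymbol{u})=2\mu\,\tilde\epsilon(\boldsymbol{u})+\lambda\,\mathrm{tr}(\tilde\epsilon(\boldsymbol{u}))\,I$. Sesquilinear form: for $\Phi=(\boldsymbol{u}^\top,p)^\top$, $\Psi=(\boldsymbol{u}'^\top,p')^\top$ with values in $\mathbb{C}^3\times\mathbb{C}$, $$\mathcal{B}_D(\Phi,\Psi)=\int_D\Big[\tilde\sigma(\boldsymbol{u})A:\nabla\overline{\boldsymbol{u}}'-\rho\omega^2J\boldsymbol{u}\cdot\overline{\boldsymbol{u}}'-\gamma p\,\nabla\cdot(A\overline{\boldsymbol{u}}')+\nabla\overline{p}'\cdot(K\nabla p)-qJp\,\overline{p}'-\mathbf{i}\omega\eta\,\overline{p}'\,\nabla\cdot(A\boldsymbol{u})\Big]dx ,$$ where $M:N=\sum_{i,j}M_{ij}N_{ij}$. The space $H_0^1(D)^4$ carries the usual $H^1$-norm. *)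

(* Defs.v *)
From HB Require Import structures.
From mathcomp Require Import all_boot all_order all_algebra.
From mathcomp Require Import all_classical all_reals all_analysis.
From mathcomp Require Import complex.
Import Normc.

Set Implicit Arguments.
Unset Strict Implicit.
Unset Printing Implicit Defensive.

Import Order.TTheory GRing.Theory Num.Theory.
Import numFieldNormedType.Exports.

Local Open Scope classical_set_scope.
Local Open Scope ring_scope.
Local Open Scope complex_scope.

(* Points of R^3 are triples ((x_1, x_2), x_3), because the product
   sigma-algebra and the product measure are available on pairs; indices
   j = 1, 2, 3 become 0, 1, 2 : 'I_3. *)
Notation space3 R := (R * R * R)%type.

Definition xcoord {R : realType} (x : space3 R) (j : 'I_3) : R :=
  tnth [tuple x.1.1; x.1.2; x.2] j.

Definition basis_vec {R : realType} (j : 'I_3) : space3 R :=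
  ((j == 0 :> nat)%:R, (j == 1 :> nat)%:R, (j == 2 :> nat)%:R).

(* The same type, carrying the structure the Lebesgue measure is defined on. *)
Notation mspace3 R :=
  (measurableTypeR R * measurableTypeR R * measurableTypeR R)%type.

Definition volume {R : realType} : {measure set (mspace3 R) -> \bar R} :=
  ((@lebesgue_measure R \x @lebesgue_measure R) \x @lebesgue_measure R)%E.

Section Smoothness.
Context {R : realType}.
Implicit Types (f : space3 R -> R) (D : set (space3 R)).

Definition pderiv (j : 'I_3) f : space3 R -> R :=
  fun x => 'D_(basis_vec j) f x.

Definition iter_pderiv (s : seq 'I_3) f : space3 R -> R := foldr pderiv f s.

Definition smooth f : Prop :=
  forall s : seq 'I_3, continuous (iter_pderiv s f) /\
    forall j x, derivable (iter_pderiv s f) x (basis_vec j).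

Definition test_function D f : Prop :=
  smooth f /\
  exists K : set (space3 R),
    [/\ compact K, K `<=` D & forall x, ~ K x -> f x = 0].

Definition domain D : Prop := [/\ D !=set0, open D & connected D].

(* Near each boundary point, the open set D is the sublevel set {phi < 0} of
   a smooth function phi with nonzero gradient at that point. *)
Definition smooth_boundary D : Prop :=
  forall x0, (closure D `\` interior D) x0 ->
    exists phi : space3 R -> R,
      [/\ smooth phi,
          exists j, pderiv j phi x0 != 0 &
          \forall x \near x0, D x <-> phi x < 0].

End Smoothness.

Section Sobolev.
Context {R : realType}.
Local Notation C := R[i].
Implicit Types (D : set (space3 R)) (f g : space3 R -> C).

Definition memL2 D f : Prop :=
  [/\ measurable_fun (D : set (mspace3 R)) (fun x => complex.Re (f x)),
      measurable_fun (D : set (mspace3 R)) (fun x => complex.Im (f x)) &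
      (@volume R).-integrable D (fun x => (normc (f x) ^+ 2)%:E)].

Definition cintegral D f : C :=
  (\int[@volume R]_(x in D) complex.Re (f x)) +i* (\int[@volume R]_(x in D) complex.Im (f x)).

Definition is_wderiv D (j : 'I_3) f g : Prop :=
  memL2 D g /\
  forall phi : space3 R -> R, test_function D phi ->
    cintegral D (fun x => f x * (pderiv j phi x)%:C) =
    - cintegral D (fun x => g x * (phi x)%:C).

(* A representative on D of the weak derivative of f in direction j (unique
   almost everywhere in D); it is only meaningful when f has a
   square-integrable weak derivative, and only on D. *)
Definition wderiv D (j : 'I_3) f : space3 R -> C :=
  xget (fun=> 0) [set g | is_wderiv D j f g].

Definition memH1 D f : Prop :=
  memL2 D f /\ forall j, exists g, is_wderiv D j f g.

Definition sqnormL2 D f : R := \int[@volume R]_(x in D) (normc (f x) ^+ 2).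

Definition sqnormH1 D f : R :=
  sqnormL2 D f + \sum_(j < 3) sqnormL2 D (wderiv D j f).

(* The closure in H^1(D) of the complex-valued test functions. *)
Definition memH10 D f : Prop :=
  memH1 D f /\
  forall e : R, 0 < e ->
    exists phi1 phi2 : space3 R -> R,
      [/\ test_function D phi1, test_function D phi2 &
          Num.sqrt (sqnormH1 D (fun x => f x - (phi1 x +i* phi2 x))) < e].

(* C^4 = C^3 x C, so that a field is split as Phi = (u, p). *)
Implicit Types Phi : space3 R -> 'cV[C]_(3 + 1).

Definition memH10_4 D Phi : Prop := forall k, memH10 D (fun x => Phi x k 0).

Definition normH1_4 D Phi : R :=
  Num.sqrt (\sum_k sqnormH1 D (fun x => Phi x k 0)).

(* Equality to 0 as an element of H^1_0(D)^4. *)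
Definition ae_zero D Phi : Prop :=
  {ae @volume R, forall x : mspace3 R, D x -> Phi x = 0}.

Definition disp Phi : space3 R -> 'cV[C]_3 := fun x => usubmx (Phi x).
Definition temp Phi : space3 R -> C := fun x => dsubmx (Phi x) 0 0.

Definition wjacobian D (u : space3 R -> 'cV[C]_3) : space3 R -> 'M[C]_3 :=
  fun x => \matrix_(i, j) wderiv D j (fun y => u y i 0) x.

Definition wgrad D (p : space3 R -> C) : space3 R -> 'cV[C]_3 :=
  fun x => \col_j wderiv D j p x.

Definition wdiv D (u : space3 R -> 'cV[C]_3) : space3 R -> C :=
  fun x => \sum_j wderiv D j (fun y => u y j 0) x.

End Sobolev.

Definition dotv {R : realType} (v w : 'cV[R[i]]_3) : R[i] :=
  \sum_i v i 0 * w i 0.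

Definition mxdot {R : realType} (M N : 'M[R[i]]_3) : R[i] :=
  \sum_i \sum_j M i j * N i j.

Record material (R : realType) := Material {
  rho : R; lam : R; mu : R; alphaT : R; T0 : R; lam0 : R; kappa : R }.

Record pml (R : realType) := PML {
  ell : 'I_3 -> R; ellbar : 'I_3 -> R; alpha0 : R; zeta : R }.

Definition material_ok {R : realType} (m : material R) : Prop :=
  [/\ 0 < rho m, 0 < mu m & 0 < 3 * lam m + 2 * mu m] /\
  [/\ 0 < alphaT m, 0 < T0 m, 0 < lam0 m & 0 < kappa m].

Definition pml_ok {R : realType} (P : pml R) (d : 'I_3 -> R) : Prop :=
  [/\ forall j, 0 < ell P j, forall j, 0 < d j,
      forall j, ell P j < ellbar P j <= ell P j + d j,
      0 < alpha0 P & 0 < zeta P].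

Definition therm_gamma {R : realType} (m : material R) : R :=
  (3 * lam m + 2 * mu m) * alphaT m.

Definition therm_eta {R : realType} (m : material R) : R :=
  T0 m * therm_gamma m / lam0 m.

Definition box {R : realType} (a : 'I_3 -> R) : set (space3 R) :=
  [set x | forall j, `|xcoord x j| < a j].

Section PMLCoefficients.
Context {R : realType} (P : pml R).
Local Notation C := R[i].
Implicit Types x : space3 R.

Definition hfun (s : R) : R := if 0 < s then expR (- s^-1) else 0.

Definition alphaf (j : 'I_3) (t : R) : R :=
  let tau := (`|t| - ell P j) / (ellbar P j - ell P j) in
  if `|t| <= ell P j then 0
  else if `|t| <= ellbar P j
       then alpha0 P * (hfun tau / (hfun tau + hfun (1 - tau)))
       else alpha0 P.

Definition stretch (j : 'I_3) x : C :=
  1 + (zeta P +i* 1) * (alphaf j (xcoord x j))%:C.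

Definition Jdet x : C := \prod_j stretch j x.

Definition Amx x : 'M[C]_3 :=
  diag_mx (\row_j \prod_(k | k != j) stretch k x).

Definition Bmx x : 'M[C]_3 := diag_mx (\row_j (stretch j x)^-1).

Definition Kmx x : 'M[C]_3 :=
  diag_mx (\row_j ((\prod_(k | k != j) stretch k x) / stretch j x)).

Context (m : material R) (D : set (space3 R)).

Definition strain (u : space3 R -> 'cV[C]_3) x : 'M[C]_3 :=
  2^-1 *: (wjacobian D u x *m (Bmx x)^T + Bmx x *m (wjacobian D u x)^T).

Definition stress (u : space3 R -> 'cV[C]_3) x : 'M[C]_3 :=
  (2 * mu m)%:C *: strain u x + ((lam m)%:C * \tr (strain u x))%:M.

Definition sesqform (omega : C) (Phi Psi : space3 R -> 'cV[C]_(3 + 1)) : C :=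
  let u := disp Phi in
  let p := temp Phi in
  let ubar' := fun x => map_mx conjc (disp Psi x) in
  let pbar' := fun x => conjc (temp Psi x) in
  let q := (0 +i* 1) * omega / (kappa m)%:C in
  cintegral D (fun x =>
      mxdot (stress u x *m Amx x) (wjacobian D ubar' x)
    - (rho m)%:C * omega ^+ 2 * Jdet x * dotv (u x) (ubar' x)
    - (therm_gamma m)%:C * p x * wdiv D (fun y => Amx y *m ubar' y) x
    + dotv (wgrad D pbar' x) (Kmx x *m wgrad D p x)
    - q * Jdet x * p x * pbar' x
    - (0 +i* 1) * omega * (therm_eta m)%:C * pbar' x
        * wdiv D (fun y => Amx y *m u y) x).

End PMLCoefficients.

(* No accumulation point in the complex plane, the points of the set being in
   particular isolated. *)
Definition discrete_subset {R : realType} (E : set R[i]) : Prop :=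
  @limit_point (R[i]^o) E = set0.

(* Main.v *)
(* On test fields the sesquilinear form is a quadratic pencil
   b0 + omega b1 + omega^2 b2.  In b0 the temperature equation does not see the
   displacement.  For i <> j, A_j / s_i is the third stretch factor, which does
   not depend on x_i and x_j, so that two integrations by parts exchange the
   derivatives in the mixed elastic terms; as Im s_k <= t Re s_k with
   t = alpha0 / (1 + zeta alpha0) < 1 / zeta, the resulting density has a real
   part bounded below by |grad u|^2.  Testing (u, p) against (u, M p) with M
   large, and Poincare's inequality, give the inf-sup condition for b0.
   b1 and b2 are bounded by the L^2 norm of their first argument (after an
   integration by parts for b1), and this norm is, up to a small multiple of the
   H^1 norm, controlled by finitely many functionals, the averages over a fine
   grid of cubes (Rellich).  If the inf-sup condition fails at omega, there are
   unit fields almost annihilated by the pencil.  Riesz's argument for the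
   companion linearisation, made quantitative with Gram-Schmidt and Bessel in
   order to avoid a completion, shows that this happens for only finitely many
   omega in each disc.  The remaining inf-sup bounds pass to H^1_0 by density,
   weak derivatives being unique by the du Bois-Reymond lemma. *)
From HB Require Import structures.
Require Import Defs.
From mathcomp Require Import all_boot all_order all_algebra.
From mathcomp Require Import all_classical all_reals all_analysis.
From mathcomp Require Import measurable_realfun complex ring lra.
Import Normc.
Import Order.TTheory GRing.Theory Num.Theory.
Import numFieldNormedType.Exports.
Set Implicit Arguments.
Unset Strict Implicit.
Unset Printing Implicit Defensive.
Local Open Scope classical_set_scope.
Local Open Scope ring_scope.

(** * Semi-inner products and approximate eigenvectors *)

(** The forms are studied on test fields, an incomplete space in which b0 cannot be inverted. The
    companion operator is therefore replaced by a relation that carries an error, and eigenvectors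
    by unit vectors with arbitrarily small residual. Riesz's argument needs compactness, but the
    companion map sends (x1, x2) to (- b0^-1 (b1 x1 + b2 x2), x1) and merely copies x1 into its
    second component. Only its square is controlled by the L^2 norm, so images are estimated after
    two applications and an eigenvalue mu enters as mu^2. The almost annihilated fields change with
    the required precision. Their linear independence must thus hold with constants that depend on
    the eigenvalues alone and are fixed before any vector is picked. Frequency zero is the base
    point because its temperature row can be multiplied by a large M without disturbing the elastic
    row. The coupling of p into the elastic row keeps its size, while the diffusion of p grows with
    M. The layer enters through one sector condition on the stretch factors, with slope t such that
    t < 1 and (lam + 2 mu) t^2 < mu. Both bounds come from the lower bounds on zeta. *)

Section ComplexNorm.
Context {R : rcfType}.
Implicit Types (x y : R[i]) (k : R).

Lemma normc_ge0 x : 0 <= normc x.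
Proof. by case: x => a b; rewrite sqrtr_ge0. Qed.

Lemma normc_eq0 x : (normc x == 0) = (x == 0).
Proof. by apply/eqP/eqP => [/eq0_normc//|->]; rewrite normc0. Qed.

Lemma sqr_normcE x : normc x ^+ 2 = complex.Re x ^+ 2 + complex.Im x ^+ 2.
Proof. by case: x => a b; rewrite /= sqr_sqrtr// addr_ge0 ?sqr_ge0. Qed.

Lemma normc_conj x : normc (conjc x) = normc x.
Proof. by case: x => a b; rewrite /= sqrrN. Qed.

Lemma normc_real k : normc k%:C%C = `|k|.
Proof. by rewrite /= expr0n addr0 sqrtr_sqr. Qed.

Lemma norm_Re_le x : `|complex.Re x| <= normc x.
Proof. by case: x => a b /=; rewrite -sqrtr_sqr ler_sqrt ?addr_ge0 ?sqr_ge0// lerDl sqr_ge0. Qed.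

Lemma norm_Im_le x : `|complex.Im x| <= normc x.
Proof. by case: x => a b /=; rewrite -sqrtr_sqr ler_sqrt ?addr_ge0 ?sqr_ge0// lerDr sqr_ge0. Qed.

Lemma Re_le_normc x : complex.Re x <= normc x.
Proof. exact: le_trans (ler_norm _) (norm_Re_le x). Qed.

Lemma normc_le_ReIm x : normc x <= `|complex.Re x| + `|complex.Im x|.
Proof.
rewrite -(@ler_pXn2r _ 2)// ?nnegrE ?normc_ge0 ?addr_ge0// sqr_normcE sqrrD !real_normK ?num_real//.
by rewrite -addrA [_ *+ 2 + _]addrC addrA lerDl mulrn_wge0// mulr_ge0.
Qed.

Lemma mul_conjc x : x * conjc x = (normc x ^+ 2)%:C%C.
Proof.
apply/eqP; rewrite eq_complex sqr_normcE; case: x => a b /=.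
by apply/andP; split; apply/eqP; ring.
Qed.

Lemma normc_sum (I : Type) (r : seq I) (Q : pred I) (F : I -> R[i]) :
  normc (\sum_(i <- r | Q i) F i) <= \sum_(i <- r | Q i) normc (F i).
Proof.
elim/big_ind2: _ => [|x a y b xa yb|//]; first by rewrite normc0.
by apply: (le_trans (le_normcD _ _)); exact: lerD.
Qed.

Lemma normcB x y : normc (x - y) <= normc x + normc y.
Proof. by rewrite -(normcN y) le_normcD. Qed.

Lemma normcX x n : normc (x ^+ n) = normc x ^+ n.
Proof. by elim: n => [|n IH]; rewrite ?expr0 ?normc1// !exprS normcM IH. Qed.

Lemma ReD x y : complex.Re (x + y) = complex.Re x + complex.Re y.
Proof. by case: x y => a b []. Qed.

Lemma ReM_real k x : complex.Re (k%:C%C * x) = k * complex.Re x.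
Proof. by case: x => a b /=; rewrite mul0r subr0. Qed.

End ComplexNorm.

Section SemiInner.
Context {R : rcfType} {V : lmodType R[i]}.
Implicit Types (x y z : V) (a : R[i]).

(** Vectors of zero seminorm are allowed, so that no quotient has to be formed. Hermitian symmetry
    makes [h x x] real, whence positivity is asked of its real part only. *)
Definition semi_inner (h : V -> V -> R[i]) : Prop :=
  [/\ forall a x y z, h (a *: x + y) z = a * h x z + h y z,
      forall x y, h x y = conjc (h y x) & forall x, 0 <= complex.Re (h x x)].

Variables (h : V -> V -> R[i]) (hh : semi_inner h).

Definition seminorm_of x : R := Num.sqrt (complex.Re (h x x)).
Local Notation P := seminorm_of.

Let hl a x y z : h (a *: x + y) z = a * h x z + h y z. Proof. by case: hh. Qed.
Let hC x y : h x y = conjc (h y x). Proof. by case: hh. Qed.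
Let h_ge0 x : 0 <= complex.Re (h x x). Proof. by case: hh. Qed.

Lemma semi_innerDl x y z : h (x + y) z = h x z + h y z.
Proof. by have := hl 1 x y z; rewrite scale1r mul1r. Qed.

Lemma semi_inner0l z : h 0 z = 0.
Proof. by apply: (addrI (h 0 z)); rewrite -semi_innerDl !addr0. Qed.

Lemma semi_innerZl a x z : h (a *: x) z = a * h x z.
Proof. by rewrite -[a *: x]addr0 hl semi_inner0l addr0. Qed.

Lemma semi_innerNl x z : h (- x) z = - h x z.
Proof. by rewrite -scaleN1r semi_innerZl mulN1r. Qed.

Lemma semi_innerDr x y z : h z (x + y) = h z x + h z y.
Proof. by rewrite hC semi_innerDl rmorphD/= -!hC. Qed.

Lemma semi_innerZr a x z : h z (a *: x) = conjc a * h z x.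
Proof. by rewrite hC semi_innerZl rmorphM/= -hC. Qed.

Lemma semi_inner_suml n (F : nat -> V) z :
  h (\sum_(i < n) F i) z = \sum_(i < n) h (F i) z.
Proof.
elim: n => [|n IH]; first by rewrite !big_ord0 semi_inner0l.
by rewrite !big_ord_recr/= semi_innerDl IH.
Qed.

Lemma semi_inner_sumr n (F : nat -> V) z :
  h z (\sum_(i < n) F i) = \sum_(i < n) h z (F i).
Proof. by rewrite hC semi_inner_suml raddf_sum; apply: eq_bigr => i _; rewrite [RHS]hC. Qed.

Lemma seminorm_ge0 x : 0 <= P x. Proof. exact: sqrtr_ge0. Qed.

Lemma seminorm_sqr x : P x ^+ 2 = complex.Re (h x x).
Proof. by rewrite sqr_sqrtr. Qed.

Lemma semi_inner_diag x : h x x = (P x ^+ 2)%:C%C.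
Proof.
rewrite seminorm_sqr; have := hC x x; case: (h x x) => a b [] /= /eqP.
by rewrite -addr_eq0 -mulr2n mulrn_eq0/= => /eqP ->.
Qed.

Lemma seminormZ a x : P (a *: x) = normc a * P x.
Proof.
apply/eqP; rewrite -(@eqrXn2 _ 2)// ?mulr_ge0 ?seminorm_ge0 ?normc_ge0//.
rewrite seminorm_sqr semi_innerZl semi_innerZr mulrA mul_conjc semi_inner_diag.
by rewrite -rmorphM/= exprMn.
Qed.

Lemma seminormN x : P (- x) = P x.
Proof. by rewrite -scaleN1r seminormZ normcN normc1 mul1r. Qed.

Lemma seminorm_sqrD x y : P (x + y) ^+ 2 = P x ^+ 2 + complex.Re (h x y) *+ 2 + P y ^+ 2.
Proof.
rewrite !seminorm_sqr !(semi_innerDl, semi_innerDr) [h y x]hC mulr2n.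
by case: (h x x) (h x y) (h y y) => a b [c d] [e f] /=; rewrite !addrA.
Qed.

Lemma cauchy_schwarz x y : normc (h x y) <= P x * P y.
Proof.
have Px := seminorm_ge0 x; have Py := seminorm_ge0 y.
(* Expansion of the squared seminorm of [x] minus [t * h x y] times [y], for real [t]. *)
have quad (t : R) : 0 <= P x ^+ 2 - (t * normc (h x y) ^+ 2) *+ 2 +
    (t * normc (h x y)) ^+ 2 * P y ^+ 2.
  have := sqr_ge0 (P (x + (- (t%:C%C * h x y)) *: y)).
  rewrite seminorm_sqrD semi_innerZr seminormZ normcN normcM normc_real.
  have -> : complex.Re (conjc (- (t%:C%C * h x y)) * h x y) = - (t * normc (h x y) ^+ 2).
    by rewrite sqr_normcE; case: (h x y) => c d /=; ring.
  by rewrite !exprMn real_normK ?num_real// mulNrn.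
rewrite -(@ler_pXn2r _ 2)// ?nnegrE ?mulr_ge0 ?normc_ge0//.
have := normc_ge0 (h x y); set n := normc _ in quad * => n0.
(* If [P y] vanishes, [quad] is affine in [t], and the value chosen below makes it negative unless
   [h x y] is zero. Otherwise the minimum, at [P y ^- 2], gives the inequality. *)
have [Py0|Py0] := eqVneq (P y) 0.
  rewrite Py0 mulr0 expr0n/=; apply/idPn; rewrite -ltNge => n2.
  have := quad ((P x ^+ 2 + 1) / n ^+ 2).
  rewrite Py0 expr0n/= mulr0 addr0 divfK ?gt_eqF//.
  have := sqr_ge0 (P x); lra.
have Py2 : 0 < P y ^+ 2 by rewrite exprn_even_gt0.
have := quad (P y ^- 2).
have -> : (P y ^- 2 * n) ^+ 2 * P y ^+ 2 = n ^+ 2 / P y ^+ 2 by field.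
rewrite [P y ^- 2 * _]mulrC => q.
have : n ^+ 2 / P y ^+ 2 <= P x ^+ 2 by lra.
by rewrite ler_pdivrMr// exprMn.
Qed.

Lemma seminorm_triangle x y : P (x + y) <= P x + P y.
Proof.
rewrite -(@ler_pXn2r _ 2)// ?nnegrE ?addr_ge0 ?seminorm_ge0// seminorm_sqrD sqrrD.
rewrite lerD2r lerD2l lerMn2r/=.
exact: le_trans (Re_le_normc _) (cauchy_schwarz x y).
Qed.

Lemma seminorm0 : P 0 = 0.
Proof. by rewrite /seminorm_of semi_inner0l sqrtr0. Qed.

Lemma seminorm_sum n (F : nat -> V) : P (\sum_(i < n) F i) <= \sum_(i < n) P (F i).
Proof.
elim: n => [|n IH]; first by rewrite !big_ord0 seminorm0.
rewrite !big_ord_recr/=; apply: (le_trans (seminorm_triangle _ _)).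
by rewrite lerD2r.
Qed.

(* Gram matrix: its invertibility is the independence hypothesis. *)
Lemma orthogonal_projection n (x : nat -> V) (v : V) :
  (forall a : nat -> R[i], P (\sum_(i < n) a i *: x i) = 0 ->
     forall i, (i < n)%N -> a i = 0) ->
  exists b : nat -> R[i], forall i, (i < n)%N ->
    h (v - \sum_(j < n) b j *: x j) (x i) = 0.
Proof.
move=> indep.
pose G : 'M[R[i]]_n := \matrix_(i, j) h (x i) (x j).
pose ext (u : 'rV[R[i]]_n) (k : nat) := if insub k is Some i then u 0 i else 0.
have extE u (i : 'I_n) : ext u i = u 0 i by rewrite /ext insubT//= => ?; congr (u _ _); exact: val_inj.
have Gu : G \in unitmx.
  rewrite -row_free_unit; apply: inj_row_free => u uG.
  apply/rowP => i; rewrite mxE -extE; apply: indep => //.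
  apply/eqP; rewrite -sqrf_eq0 seminorm_sqr.
  rewrite (semi_inner_sumr _ (fun k => ext u k *: x k)).
  rewrite big1// => j _; rewrite semi_innerZr.
  rewrite (semi_inner_suml _ (fun k => ext u k *: x k)).
  have : (u *m G) 0 j = 0 by rewrite uG mxE.
  rewrite mxE => uGj; rewrite (_ : \sum_(k < n) _ = 0) ?mulr0//.
  by rewrite -[RHS]uGj; apply: eq_bigr => k _; rewrite semi_innerZl extE mxE.
pose b := (\row_j h v (x j)) *m invmx G.
exists (ext b) => i ilt.
have : (b *m G) 0 (Ordinal ilt) = h v (x i) by rewrite mulmxKV// mxE.
rewrite mxE => bG; rewrite semi_innerDl semi_innerNl.
rewrite (semi_inner_suml _ (fun k => ext b k *: x k)) -bG.
apply/eqP; rewrite subr_eq0; apply/eqP; apply: eq_bigr => k _.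
by rewrite semi_innerZl extE; congr (_ * _); rewrite mxE.
Qed.

(** No Riesz representative of [l] is available. The functional is evaluated instead at the
    combination of the [y i] with coefficients [conjc (l (y i))]: its value and the squared seminorm
    of this vector are both the sum [S], so [S] is at most [c] times its square root. *)
Lemma bessel n (y : nat -> V) (l : V -> R[i]) (c : R) : 0 <= c ->
  (forall a x z, l (a *: x + z) = a * l x + l z) ->
  (forall x, normc (l x) <= c * P x) ->
  (forall i j, (i < n)%N -> (j < n)%N -> h (y i) (y j) = (i == j)%:R) ->
  \sum_(i < n) normc (l (y i)) ^+ 2 <= c ^+ 2.
Proof.
move=> c0 ll lc orth.
pose S := \sum_(i < n) normc (l (y i)) ^+ 2.
pose x := \sum_(i < n) conjc (l (y i)) *: y i.
have l0 : l 0 = 0 by have := ll 1 0 0; rewrite scale1r addr0 mul1r => /eqP; rewrite -subr_eq subrr eq_sym => /eqP.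
have lx : l x = S%:C%C.
  have lsum (m : nat) (F : nat -> V) : l (\sum_(i < m) F i) = \sum_(i < m) l (F i).
    elim: m => [|m IH]; first by rewrite !big_ord0.
    rewrite !big_ord_recr/= -[X in l (_ + X)]addr0 addrCA addrC.
    by have := ll 1 (\sum_(i < m) F i) (F m); rewrite scale1r mul1r -IH addr0.
  rewrite /x (lsum _ (fun i => conjc (l (y i)) *: y i)) /S rmorph_sum.
  apply: eq_bigr => i _; have := ll (conjc (l (y i))) (y i) 0.
  by rewrite !addr0 l0 addr0 => ->; rewrite mulrC mul_conjc.
have Px : P x ^+ 2 = S.
  rewrite seminorm_sqr /x (semi_inner_suml _ (fun i => conjc (l (y i)) *: y i)).
  rewrite (_ : \sum_(i < n) _ = S%:C%C)// /S rmorph_sum; apply: eq_bigr => i _.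
  rewrite semi_innerZl (semi_inner_sumr _ (fun i => conjc (l (y i)) *: y i)).
  rewrite (bigD1 i)//= big1 ?addr0; last first.
    move=> j ji; rewrite semi_innerZr orth// (_ : (i == j :> nat) = false) ?mulr0//.
    by apply/negbTE; rewrite eq_sym.
  by rewrite semi_innerZr conjcK orth// eqxx mulr1 mulrC mul_conjc.
have S0 : 0 <= S by apply: sumr_ge0 => i _; rewrite sqr_ge0.
have := lc x; rewrite lx normc_real ger0_norm// -/S -Px.
have := seminorm_ge0 x; set p := P x => p0 pp.
have [->|pn0] := eqVneq p 0; first by rewrite expr0n sqr_ge0.
have p_gt0 : 0 < p by rewrite lt_neqAle eq_sym pn0.
have pc : p <= c by move: pp; rewrite expr2 ler_pM2r.
by rewrite ler_pXn2r.
Qed.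

End SemiInner.

(** * Riesz's argument for approximate eigenvectors of a relation *)

Section ApproximateEigenvectors.
Context {R : realType} {V : lmodType R[i]}.
Variables (h : V -> V -> R[i]) (hh : semi_inner h).
Local Notation P := (seminorm_of h).

(* [Res x y r] means that [y] is the image of [x] under an operator that need
   not exist, up to an error of size [r]. *)
Variables (Res : V -> V -> R -> Prop) (Lam : V -> R) (C : R).
Hypothesis C0 : 0 < C.
Hypothesis Res_lin : forall a x y r x' y' r', Res x y r -> Res x' y' r' ->
  Res (a *: x + x') (a *: y + y') (normc a * r + r').
Hypothesis Res00 : Res 0 0 0.
Hypothesis Res_bounded : forall x y r, Res x y r -> P y <= C * (P x + r).
Hypothesis Res2_bounded : forall x y z r r', Res x y r -> Res y z r' ->
  P z <= C * (Lam x + r + r').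
(** Compactness stated without limits: up to a small multiple of [P], the quantity [Lam] is seen by
    finitely many bounded functionals. *)
Hypothesis Lam_precompact : forall e : R, 0 < e ->
  exists (n : nat) (l : 'I_n -> V -> R[i]) (c : R),
  [/\ 0 <= c, forall i a x z, l i (a *: x + z) = a * l i x + l i z,
      forall i x, normc (l i x) <= c * P x &
      forall x, Lam x <= e * P x + \sum_i normc (l i x)].

Lemma Res_sum n (a : nat -> R[i]) (x y : nat -> V) (r : nat -> R) :
  (forall i, (i < n)%N -> Res (x i) (y i) (r i)) ->
  Res (\sum_(i < n) a i *: x i) (\sum_(i < n) a i *: y i) (\sum_(i < n) normc (a i) * r i).
Proof.
elim: n => [|n IH] H; first by rewrite !big_ord0.
rewrite !big_ord_recr/= addrC [X in Res _ X _]addrC [X in Res _ _ X]addrC.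
apply: Res_lin; first exact: H.
by apply: IH => i ilt; apply: H; exact: ltnW.
Qed.

(** The classical induction made quantitative. Passing from a combination to its image and
    subtracting [mu K] times it removes the last vector and multiplies the other coefficients by
    [mu i - mu K], which is bounded away from zero. The constants are produced before the vectors,
    which will depend on the admissible error. *)
Lemma approx_eigenvectors_free (K : nat) (mu : nat -> R[i]) :
  (forall i j, (i < K)%N -> (j < K)%N -> mu i = mu j -> i = j) ->
  exists c d : R, [/\ 0 < c, 0 < d &
    forall (x : nat -> V) (r : R), 0 <= r <= d ->
      (forall i, (i < K)%N -> P (x i) = 1 /\ Res (x i) (mu i *: x i) r) ->
    forall a : nat -> R[i],
      \sum_(i < K) normc (a i) <= c * P (\sum_(i < K) a i *: x i)].
Proof.
elim: K => [|K IH] inj.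
  by exists 1, 1; split => // x r _ _ a; rewrite !big_ord0 mul1r seminorm_ge0.
have [c [d [c0 d0 cd]]] := IH (fun i j iK jK => inj i j (ltnW iK) (ltnW jK)).
pose delta := \big[Num.min/1]_(i < K) normc (mu i - mu K).
have delta0 : 0 < delta.
  rewrite /delta; elim/big_ind: _ => // [p q p0 q0|i _]; first by rewrite lt_min p0.
  rewrite lt_neqAle normc_ge0 andbT eq_sym normc_eq0 subr_eq0.
  apply/eqP => muiK; have := inj i K (ltnW (ltn_ord i)) (ltnSn K) muiK.
  by move=> iK; have := ltn_ord i; rewrite iK ltnn.
have deltaP (i : 'I_K) : delta <= normc (mu i - mu K).
  by rewrite /delta (bigD1 i)//= ge_min lexx.
pose M := normc (mu K).
have M0 : 0 <= M by exact: normc_ge0.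
pose c' := c * (C + M) / delta.
have c'0 : 0 <= c' by rewrite divr_ge0 ?mulr_ge0 ?addr_ge0 ?(ltW C0) ?(ltW c0) ?(ltW delta0).
(* With this bound on [r], the residual contributes at most a quarter of [A] to [A']. Since [A] is
   at most [2 * A' + P X], half of [A] can be absorbed, which leaves [2 * (2 * c' + 1) * P X]. *)
exists (2 * (2 * c' + 1)), (Num.min d (4 * c' + 1)^-1); split.
- by rewrite mulr_gt0// ltr_wpDl// mulr_ge0.
- by rewrite lt_min d0 invr_gt0 ltr_wpDl// mulr_ge0.
move=> x r /andP[r0]; rewrite le_min => /andP[rd rc] xP a.
pose X := \sum_(i < K.+1) a i *: x i.
pose A := \sum_(i < K.+1) normc (a i).
pose A' := \sum_(i < K) normc (a i).
have A'0 : 0 <= A' by apply: sumr_ge0 => i _; exact: normc_ge0.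
have AE : A = A' + normc (a K) by rewrite /A big_ord_recr.
pose X' := \sum_(i < K.+1) a i *: (mu i *: x i).
have PX' : P X' <= C * (P X + A * r).
  have := Res_sum (r := fun=> r) a (fun i iK => (xP i iK).2).
  by rewrite -mulr_suml => /Res_bounded.
pose Y := \sum_(i < K) (a i * (mu i - mu K)) *: x i.
have YE : Y = X' + (- mu K) *: X.
  rewrite /Y /X /X' scaler_sumr -big_split/= big_ord_recr/= !scalerA -scalerDl.
  rewrite mulNr [mu K * _]mulrC subrr scale0r addr0; apply: eq_bigr => i _.
  by rewrite !scalerA -scalerDl mulrBr mulNr [mu K * _]mulrC.
have PY : P Y <= C * (P X + A * r) + M * P X.
  rewrite YE; apply: (le_trans (seminorm_triangle hh _ _)).
  by rewrite seminormZ// normcN lerD2r.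
have A'Y : delta * A' <= c * P Y.
  apply: le_trans (cd x r _ _ (fun i => a i * (mu i - mu K))) => //.
  - by rewrite /A' mulr_sumr; apply: ler_sum => i _; rewrite normcM mulrC ler_wpM2l// normc_ge0.
  - by rewrite r0.
  - by move=> i iK; apply: xP; exact: ltnW.
have PX0 : 0 <= P X by exact: seminorm_ge0.
have A0 : 0 <= A by rewrite AE addr_ge0// normc_ge0.
have A'le : A' <= c' * (P X + A * r).
  have : c * P Y <= c * (C + M) * (P X + A * r).
    rewrite -mulrA ler_pM2l//; apply: (le_trans PY).
    by rewrite mulrDl lerD2l ler_wpM2l// lerDl mulr_ge0.
  move=> /(le_trans A'Y); rewrite mulrC -ler_pdivlMr// => /le_trans; apply.
  by rewrite /c' [in leRHS]mulrAC.
have aK : normc (a K) <= P X + A'.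
  have := xP K (ltnSn K) => -[PxK _].
  have -> : normc (a K) = P (a K *: x K) by rewrite seminormZ// PxK mulr1.
  have -> : a K *: x K = X - \sum_(i < K) a i *: x i.
    by rewrite /X big_ord_recr/= [X in X - _]addrC addrK.
  apply: (le_trans (seminorm_triangle hh _ _)); rewrite seminormN// lerD2l.
  apply: (le_trans (seminorm_sum hh _ (fun i => a i *: x i))).
  apply: ler_sum => i _; rewrite seminormZ//.
  by have [-> _] := xP i (ltnW (ltn_ord i)); rewrite mulr1.
have cr : c' * r * 4 <= 1.
  have c4 : 0 < 4 * c' + 1 by rewrite ltr_wpDl// mulr_ge0.
  move: rc; rewrite -[X in _ <= X]mul1r ler_pdivlMr// => rc.
  by clearbody c'; lra.
have : c' * r * 4 * A <= 1 * A by rewrite ler_wpM2r.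
rewrite -/A -/X; move: A'le; rewrite AE; nra.
Qed.

(** Gram-Schmidt yields orthonormal [y k] whose second image [z k] has component [mu k ^+ 2] along
    [y k]. Hence [Lam (y k)] is bounded below, and so is the sum of the functionals at [y k].
    Bessel's inequality then limits the number of vectors by a bound in which neither [K] nor [mu]
    occurs. *)
Lemma approx_eigenvalues_bounded (m : R) : 0 < m -> exists K0 : nat,
  forall (K : nat) (mu : nat -> R[i]), (K0 <= K)%N ->
    (forall i j, (i < K)%N -> (j < K)%N -> mu i = mu j -> i = j) ->
    (forall i, (i < K)%N -> m <= normc (mu i)) ->
    ~ (forall i, (i < K)%N -> forall r, 0 < r ->
        exists x, P x = 1 /\ Res x (mu i *: x) r).
Proof.
(* Budget: the term with [e] and the residual, through the choice of [r], use [m ^+ 2 / 4] each. The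
   remaining [m ^+ 2 / 2] is [C * s], the share of the functionals. *)
move=> m0; pose e := m ^+ 2 / (4 * C).
have e0 : 0 < e by rewrite divr_gt0 ?exprn_gt0// mulr_gt0.
have [n [l [c [c0 ll lc Lle]]]] := Lam_precompact e0.
pose s := m ^+ 2 / (2 * C).
have s0 : 0 < s by rewrite divr_gt0 ?exprn_gt0// mulr_gt0.
pose K0 := (Num.truncn ((n%:R * (n%:R * c ^+ 2)) / s ^+ 2)).+1.
exists K0 => K mu KK0 inj mum appr.
have [b [d [b0 d0 bd]]] := approx_eigenvectors_free inj.
pose M := \sum_(i < K) normc (mu i).
have M0 : 0 <= M by apply: sumr_ge0 => i _; exact: normc_ge0.
have muM i : (i < K)%N -> normc (mu i) <= M.
  move=> iK; rewrite /M (bigD1 (Ordinal iK))//= lerDl.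
  by apply: sumr_ge0 => j _; exact: normc_ge0.
pose r := Num.min d (m ^+ 2 / (4 * C * (b + b * M))).
have bM0 : 0 < b + b * M by rewrite ltr_pwDl// mulr_ge0// ltW.
have r0 : 0 < r by rewrite lt_min d0 divr_gt0 ?exprn_gt0// mulr_gt0// mulr_gt0.
have rd : r <= d by rewrite ge_min lexx.
have rC : C * (b + b * M) * r <= m ^+ 2 / 4.
  have : r <= m ^+ 2 / (4 * C * (b + b * M)) by rewrite ge_min lexx orbT.
  rewrite ler_pdivlMr; last by rewrite mulr_gt0// mulr_gt0.
  by lra.
pose Q (i : nat) (x : V) := (i < K)%N -> P x = 1 /\ Res x (mu i *: x) r.
have /choice[x xQ] : forall i, exists x, Q i x.
  move=> i; rewrite /Q; case: (ltnP i K) => iK; last by exists 0.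
  by have [x xP] := appr i iK r r0; exists x.
have indep := bd x r _ xQ; rewrite (ltW r0) rd in indep; have {}indep := indep isT.
(* Gram-Schmidt: the n-th vector is orthogonal to x_0, ..., x_(n-1). *)
have gs k : exists a : nat -> R[i], (k < K)%N ->
    [/\ forall i, (k < i)%N -> a i = 0, P (\sum_(i < K) a i *: x i) = 1 &
    forall i, (i < k)%N -> h (\sum_(i < K) a i *: x i) (x i) = 0].
  case: (ltnP k K) => kK; last by exists (fun=> 0).
  have trunc (a : nat -> R[i]) p : (p <= K)%N ->
      \sum_(i < K) (if (i < p)%N then a i else 0) *: x i = \sum_(i < p) a i *: x i.
    move=> pK; rewrite (big_ord_widen K (fun i => a i *: x i) pK) [RHS]big_mkcond/=.
    by apply: eq_bigr => i _; case: ifP => _; rewrite ?scale0r.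
  have truncn (a : nat -> R[i]) p : (p <= K)%N ->
      \sum_(i < K) normc (if (i < p)%N then a i else 0) = \sum_(i < p) normc (a i).
    move=> pK; rewrite (big_ord_widen K (fun i => normc (a i)) pK) [RHS]big_mkcond/=.
    by apply: eq_bigr => i _; case: ifP => _; rewrite ?normc0.
  have ind_k (a : nat -> R[i]) : P (\sum_(i < k) a i *: x i) = 0 ->
      forall i, (i < k)%N -> a i = 0.
    move=> P0 i ik; have := indep (fun i => if (i < k)%N then a i else 0).
    rewrite trunc ?(ltnW kK)// truncn ?(ltnW kK)// P0 mulr0 => le0.
    apply: eq0_normc; apply/eqP; rewrite eq_le normc_ge0 andbT.
    apply: le_trans le0; rewrite (bigD1 (Ordinal ik))//= lerDl.
    by apply: sumr_ge0 => j _; exact: normc_ge0.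
  have [p pP] := orthogonal_projection hh (x k) ind_k.
  pose a i := if (i < k)%N then - p i else 1.
  pose w := x k - \sum_(j < k) p j *: x j.
  have wE : w = \sum_(i < k.+1) a i *: x i.
    rewrite big_ord_recr/= {2}/a ltnn scale1r /w addrC; congr (_ + _).
    rewrite -sumrN; apply: eq_bigr => i _.
    by rewrite /a ltn_ord scaleNr.
  have Pw : 0 < P w.
    have := indep (fun i => if (i < k.+1)%N then a i else 0).
    rewrite trunc// truncn// -wE => le1.
    have : 0 < b * P w.
      apply: lt_le_trans le1; rewrite big_ord_recr/= {2}/a ltnn normc1.
      by rewrite ltr_wpDl// sumr_ge0// => i _; exact: normc_ge0.
    by rewrite pmulr_rgt0.
  exists (fun i => ((P w)^-1)%:C%C * (if (i < k.+1)%N then a i else 0)) => _.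
  have sumE : \sum_(i < K) (((P w)^-1)%:C%C * (if (i < k.+1)%N then a i else 0)) *: x i =
      ((P w)^-1)%:C%C *: w.
    rewrite wE -(trunc a k.+1 kK) scaler_sumr.
    by apply: eq_bigr => i _; rewrite scalerA.
  split.
  - by move=> i ki; rewrite ltnS leqNgt ki mulr0.
  - by rewrite sumE seminormZ// normc_real ger0_norm ?invr_ge0 ?(ltW Pw)// mulVf// gt_eqF.
  - by move=> i ik; rewrite sumE semi_innerZl// pP// mulr0.
have /choice[a aP] := gs.
pose y k := \sum_(i < K) a k i *: x i.
(* The image of the image of [y k]: one factor [mu i] for each application of the relation. *)
pose z k := \sum_(i < K) (a k i * mu i) *: (mu i *: x i).
have orthx j k : (k < K)%N -> (j < k)%N -> h (y k) (x j) = 0.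
  by move=> kK jk; have [_ _] := aP k kK; apply.
have orthy k (g : nat -> R[i]) : (k < K)%N -> (forall i, (k <= i)%N -> g i = 0) ->
    h (\sum_(i < K) g i *: x i) (y k) = 0.
  move=> kK g0; rewrite (semi_inner_suml hh _ (fun i => g i *: x i)) big1// => i _.
  have [ki|ik] := leqP k i; first by rewrite g0// scale0r semi_inner0l.
  rewrite semi_innerZl//; case: (hh) => _ hC _; rewrite hC orthx//.
  by rewrite conjc0 mulr0.
have Py k : (k < K)%N -> P (y k) = 1 by move=> kK; have [] := aP k kK.
have ortho i j : (i < K)%N -> (j < K)%N -> h (y i) (y j) = (i == j)%:R.
  move=> iK jK; have [ij|ji|->] := ltngtP i j.
  - apply: orthy => // k jk; have [a0 _ _] := aP i iK.
    by apply: a0; apply: leq_trans jk.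
  - case: (hh) => _ hC _; rewrite hC (_ : h _ _ = 0) ?conjc0//; apply: orthy => // k ik.
    by have [a0 _ _] := aP j jK; apply: a0; apply: leq_trans ik.
  - by rewrite semi_inner_diag// Py// expr1n.
have zy k : (k < K)%N -> h (z k) (y k) = mu k ^+ 2.
  move=> kK; have [a0 _ _] := aP k kK.
  (* The coefficient [mu i ^+ 2 - mu k ^+ 2] vanishes at [i = k], so the remainder lies in the span
     of the earlier vectors, which is orthogonal to [y k]. *)
  have -> : z k = mu k ^+ 2 *: y k +
      \sum_(i < K) (a k i * (mu i ^+ 2 - mu k ^+ 2)) *: x i.
    rewrite /z /y scaler_sumr -big_split/=; apply: eq_bigr => i _.
    by rewrite !scalerA -scalerDl; congr (_ *: _); ring.
  rewrite semi_innerDl// (orthy k (fun i => a k i * (mu i ^+ 2 - mu k ^+ 2)))//; last first.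
    move=> i; rewrite leq_eqVlt => /predU1P[<-|ki]; first by rewrite subrr mulr0.
    by rewrite a0// mul0r.
  by rewrite semi_innerZl// ortho// eqxx mulr1 addr0.
have zle k : (k < K)%N -> m ^+ 2 <= C * (Lam (y k) + b * r + b * M * r).
  move=> kK; have Ab : \sum_(i < K) normc (a k i) <= b.
    by have := indep (a k); rewrite -/(y k) Py// mulr1.
  have R1 := Res_sum (a k) (fun i iK => (xQ i iK).2).
  have R2 := Res_sum (fun i => a k i * mu i) (fun i iK => (xQ i iK).2).
  have y'E : \sum_(i < K) (a k i * mu i) *: x i = \sum_(i < K) a k i *: (mu i *: x i).
    by apply: eq_bigr => i _; rewrite scalerA.
  rewrite y'E in R2; have := Res2_bounded R1 R2; rewrite -/(y k) -/(z k) => Pz.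
  have : m ^+ 2 <= P (z k).
    have := cauchy_schwarz hh (z k) (y k); rewrite zy// Py// mulr1 normcX.
    by apply: le_trans; rewrite ler_pXn2r ?nnegrE ?normc_ge0 ?(ltW m0)//; exact: mum.
  move=> /le_trans -> //; apply: (le_trans Pz); rewrite ler_pM2l// -!addrA lerD2l.
  rewrite -!mulr_suml lerD// ler_wpM2r ?(ltW r0)//.
  apply: (@le_trans _ _ (\sum_(i < K) normc (a k i) * M)).
    by apply: ler_sum => i _; rewrite normcM ler_wpM2l ?normc_ge0// muM.
  by rewrite -mulr_suml ler_wpM2r.
have Lamle k : (k < K)%N -> s <= \sum_(i < n) normc (l i (y k)).
  move=> kK; have := zle k kK; have := Lle (y k); rewrite Py// mulr1 => L1 m2.
  rewrite /s ler_pdivrMr ?mulr_gt0//.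
  have Ce : C * e = m ^+ 2 / 4 by rewrite /e; field; rewrite gt_eqF.
  have : C * Lam (y k) <= C * (e + \sum_(i < n) normc (l i (y k))) by rewrite ler_pM2l.
  by move: m2 rC; rewrite !mulrDr Ce; set T := \sum_(i < n) _; lra.
have sq_sum (u : 'I_n -> R) : (\sum_i u i) ^+ 2 <= n%:R * \sum_i u i ^+ 2.
  have : 0 <= \sum_i \sum_j (u i - u j) ^+ 2.
    by apply: sumr_ge0 => i _; apply: sumr_ge0 => j _; exact: sqr_ge0.
  have -> : \sum_i \sum_j (u i - u j) ^+ 2 =
      2 * (n%:R * \sum_i u i ^+ 2) - 2 * (\sum_i u i) ^+ 2.
    transitivity (\sum_i (n%:R * u i ^+ 2 - 2 * (u i * \sum_j u j) + \sum_j u j ^+ 2)).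
      apply: eq_bigr => i _; under eq_bigr do rewrite sqrrB.
      rewrite big_split/= big_split/= sumr_const card_ord sumrN.
      congr (_ - _ + _); first by rewrite mulr_natl.
      rewrite mulr_sumr mulr_sumr; apply: eq_bigr => j _.
      by rewrite mulr2n; ring.
    rewrite big_split/= big_split/= sumr_const card_ord sumrN -[_ *+ n]mulr_natl.
    by rewrite -!mulr_sumr -mulr_suml; ring.
  by lra.
(* One factor [n] comes from squaring a sum of [n] terms, the other from adding the [n] Bessel
   inequalities. *)
have : K%:R * s ^+ 2 <= n%:R * (n%:R * c ^+ 2).
  apply: (@le_trans _ _ (\sum_(k < K) n%:R * \sum_(i < n) normc (l i (y k)) ^+ 2)).
    rewrite mulr_natl -[X in s ^+ 2 *+ X](card_ord K) -sumr_const.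
    apply: ler_sum => k _; apply: le_trans (sq_sum _).
    rewrite ler_pXn2r ?nnegrE ?(ltW s0)//; first exact: Lamle.
    by apply: sumr_ge0 => i _; exact: normc_ge0.
  rewrite -mulr_sumr ler_wpM2l// exchange_big/=.
  rewrite mulr_natl -[X in _ *+ X](card_ord n) -sumr_const; apply: ler_sum => i _.
  exact: (bessel hh c0 (ll i) (lc i) ortho).
rewrite -ler_pdivlMr ?exprn_gt0// leNgt => /negP; apply.
by apply: lt_le_trans (truncnS_gt _) _; rewrite ler_nat.
Qed.

End ApproximateEigenvectors.

Section PencilConstant.
Context {R : realFieldType}.

(** A common bound for the two estimates below: after collecting terms, their monomials have degree
    at most five in [c] and coefficients at most two. *)
Definition pencil_const (c : R) : R :=
  2 * (1 + c + c ^+ 2 + c ^+ 3 + c ^+ 4 + c ^+ 5).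

Lemma pencil_const_le1 (c p r u v w : R) : 0 < c -> 0 <= p -> 0 <= r ->
  u <= c * (c * (c * p + c * p) + r) -> v <= w + r -> w <= p ->
  u + v <= pencil_const c * (p + r).
Proof.
move=> c0 p0 r0 hu hv hw; rewrite /pencil_const.
have pos k t : 0 <= t -> 0 <= c ^+ k * t by move=> t0; rewrite mulr_ge0// exprn_ge0// ltW.
have := pos 1%N p p0; have := pos 2%N p p0; have := pos 3%N p p0.
have := pos 4%N p p0; have := pos 5%N p p0.
have := pos 1%N r r0; have := pos 2%N r r0; have := pos 3%N r r0.
have := pos 4%N r r0; have := pos 5%N r r0.
lra.
Qed.

Lemma pencil_const_le2 (c p r r' u v w : R) : 0 < c -> 0 <= p -> 0 <= r -> 0 <= r' ->
  u <= c * (c * (c * (c * (c * p + r)) + (p + c * r)) + r') -> v <= w + r' ->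
  w <= c * (c * p + r) -> u + v <= pencil_const c * (p + r + r').
Proof.
move=> c0 p0 r0 r'0 hu hv hw; rewrite /pencil_const.
have pos k t : 0 <= t -> 0 <= c ^+ k * t by move=> t0; rewrite mulr_ge0// exprn_ge0// ltW.
have := pos 1%N p p0; have := pos 2%N p p0; have := pos 3%N p p0.
have := pos 4%N p p0; have := pos 5%N p p0.
have := pos 1%N r r0; have := pos 2%N r r0; have := pos 3%N r r0.
have := pos 4%N r r0; have := pos 5%N r r0.
have := pos 1%N r' r'0; have := pos 2%N r' r'0; have := pos 3%N r' r'0.
have := pos 4%N r' r'0; have := pos 5%N r' r'0.
lra.
Qed.

End PencilConstant.

(** * Approximate kernels of a quadratic pencil *)

Section QuadraticPencil.
Context {R : realType} {X : lmodType R[i]}.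
Variables (h : X -> X -> R[i]) (hh : semi_inner h).
Local Notation N := (seminorm_of h).
Variables (L : X -> R) (b0 b1 b2 : X -> X -> R[i]) (c : R).
Hypothesis c0 : 0 < c.
Hypothesis L_ge0 : forall x, 0 <= L x.
Hypothesis LD : forall x y, L (x + y) <= L x + L y.
Hypothesis L_le : forall x, L x <= c * N x.
Hypothesis L_precompact : forall e : R, 0 < e ->
  exists (n : nat) (l : 'I_n -> X -> R[i]) (k : R),
  [/\ 0 <= k, forall i a x z, l i (a *: x + z) = a * l i x + l i z,
      forall i x, normc (l i x) <= k * N x &
      forall x, L x <= e * N x + \sum_i normc (l i x)].
Hypothesis b0l : forall a x y z, b0 (a *: x + y) z = a * b0 x z + b0 y z.
Hypothesis b1l : forall a x y z, b1 (a *: x + y) z = a * b1 x z + b1 y z.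
Hypothesis b2l : forall a x y z, b2 (a *: x + y) z = a * b2 x z + b2 y z.
Hypothesis b0_infsup : forall x r, 0 <= r ->
  (forall z, normc (b0 x z) <= r * N z) -> N x <= c * r.
Hypothesis b1_le : forall x z, normc (b1 x z) <= c * L x * N z.
Hypothesis b2_le : forall x z, normc (b2 x z) <= c * L x * N z.

(** The failure of every inf-sup constant at [w], written for unit vectors. *)
Definition approx_kernel (w : R[i]) : Prop := forall d : R, 0 < d ->
  exists x, N x = 1 /\
    forall z, normc (b0 x z + w * b1 x z + w ^+ 2 * b2 x z) <= d * N z.

Let H (x y : X * X) := h x.1 y.1 + h x.2 y.2.

Let HH : semi_inner H.
Proof.
case: hh => hl hC hge0; split.
- by move=> a x y z; rewrite /H /= !hl mulrDr; ring.
- by move=> x y; rewrite /H hC (hC x.2) rmorphD.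
- move=> x; rewrite /H; have := hge0 x.1; have := hge0 x.2.
  by case: (h _ _) => a b; case: (h _ _) => a' b' /= ? ?; exact: addr_ge0.
Qed.
Local Notation P := (seminorm_of H).

Let P_sqr x : P x ^+ 2 = N x.1 ^+ 2 + N x.2 ^+ 2.
Proof. by rewrite (seminorm_sqr HH) !(seminorm_sqr hh) /H raddfD. Qed.

Let N_le1 x : N x.1 <= P x.
Proof.
by rewrite -(@ler_pXn2r _ 2)// ?nnegrE ?seminorm_ge0// P_sqr lerDl sqr_ge0.
Qed.

Let N_le2 x : N x.2 <= P x.
Proof.
by rewrite -(@ler_pXn2r _ 2)// ?nnegrE ?seminorm_ge0// P_sqr lerDr sqr_ge0.
Qed.

Let P_le x : P x <= N x.1 + N x.2.
Proof.
rewrite -(@ler_pXn2r _ 2)// ?nnegrE ?addr_ge0 ?seminorm_ge0// P_sqr sqrrD.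
by rewrite -addrA [_ *+ 2 + _]addrC addrA lerDl mulrn_wge0// mulr_ge0 ?seminorm_ge0.
Qed.

(* The companion relation: eigenvectors are the pairs (x, w x), with
   eigenvalue 1 / w. *)
Let Res (x y : X * X) (r : R) : Prop := 0 <= r /\
  (forall z, normc (b0 y.1 z + b1 x.1 z + b2 x.2 z) <= r * N z) /\
  N (y.2 - x.1) <= r.

Let Lam (x : X * X) := L x.1 + L x.2.

Let b00 z : b0 0 z = 0.
Proof. by apply: (addrI (b0 0 z)); rewrite -{1}[b0 0 z]mul1r -b0l scaler0 !addr0. Qed.
Let b10 z : b1 0 z = 0.
Proof. by apply: (addrI (b1 0 z)); rewrite -{1}[b1 0 z]mul1r -b1l scaler0 !addr0. Qed.
Let b20 z : b2 0 z = 0.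
Proof. by apply: (addrI (b2 0 z)); rewrite -{1}[b2 0 z]mul1r -b2l scaler0 !addr0. Qed.

Let Res_lin a x y r x' y' r' : Res x y r -> Res x' y' r' ->
  Res (a *: x + x') (a *: y + y') (normc a * r + r').
Proof.
move=> [r0 [H1 H2]] [r'0 [H1' H2']]; split; first by rewrite addr_ge0// mulr_ge0// normc_ge0.
split=> [z|].
  have -> : b0 (a *: y + y').1 z + b1 (a *: x + x').1 z + b2 (a *: x + x').2 z =
      a * (b0 y.1 z + b1 x.1 z + b2 x.2 z) + (b0 y'.1 z + b1 x'.1 z + b2 x'.2 z).
    by rewrite /= b0l b1l b2l; ring.
  apply: (le_trans (le_normcD _ _)); rewrite mulrDl normcM lerD//.
  by rewrite -mulrA ler_wpM2l ?normc_ge0.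
have -> : (a *: y + y').2 - (a *: x + x').1 = a *: (y.2 - x.1) + (y'.2 - x'.1).
  by rewrite /= scalerBr opprD addrACA.
apply: (le_trans (seminorm_triangle hh _ _)); rewrite lerD//.
by rewrite seminormZ// ler_wpM2l ?normc_ge0.
Qed.

Let Res00 : Res 0 0 0.
Proof.
split=> //; split=> [z|]; last by rewrite subr0 seminorm0.
by rewrite b00 b10 b20 !addr0 normc0 mul0r.
Qed.

(** The source of compactness: [b1] and [b2] see their first argument through [L] only, so the
    inf-sup bound for [b0] controls the first component of an image by the weak quantity [Lam]. *)
Let Res1 x y r : Res x y r -> N y.1 <= c * (c * Lam x + r).
Proof.
move=> [r0 [H1 _]]; apply: b0_infsup.
  by rewrite addr_ge0// mulr_ge0 ?(ltW c0)// addr_ge0.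
move=> z.
have -> : b0 y.1 z = (b0 y.1 z + b1 x.1 z + b2 x.2 z) - (b1 x.1 z + b2 x.2 z) by ring.
apply: (le_trans (normcB _ _)); rewrite addrC mulrDl lerD//.
apply: (le_trans (le_normcD _ _)); rewrite /Lam mulrDr mulrDl lerD//.
Qed.

Let Res2 x y r : Res x y r -> N y.2 <= N x.1 + r.
Proof.
move=> [_ [_ H2]]; rewrite -[y.2](subrK x.1) addrC.
by apply: (le_trans (seminorm_triangle hh _ _)); rewrite lerD2l.
Qed.

Let C := pencil_const c.

Let Res_bounded x y r : Res x y r -> P y <= C * (P x + r).
Proof.
move=> Rxy; have [r0 _] := Rxy.
apply: (le_trans (P_le _)).
have := Res1 Rxy; have := Res2 Rxy; rewrite /Lam.
have := L_le x.1; have := L_le x.2; have := N_le1 x; have := N_le2 x.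
set p := P x; move=> n2 n1 l2 l1 y2 y1.
have p0 : 0 <= p by apply: le_trans n1; exact: seminorm_ge0.
have L1 : L x.1 <= c * p by apply: (le_trans l1); rewrite ler_pM2l.
have L2 : L x.2 <= c * p by apply: (le_trans l2); rewrite ler_pM2l.
have y1' : N y.1 <= c * (c * (c * p + c * p) + r).
  apply: (le_trans y1); rewrite ler_pM2l// lerD2r ler_pM2l// lerD//.
exact: pencil_const_le1 y1' y2 n1.
Qed.

(** After one step only [y.1] is controlled by [Lam x], as [y.2] is a copy of [x.1]. The second step
    copies [y.1] into [z.2], and [z.1] needs [y] in the weak seminorm only, in which the copy of
    [x.1] is harmless. *)
Let Res2_bounded x y z r r' : Res x y r -> Res y z r' ->
  P z <= C * (Lam x + r + r').
Proof.
move=> Rxy Ryz; have [r0 _] := Rxy; have [r'0 _] := Ryz.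
apply: (le_trans (P_le _)).
have y1 := Res1 Rxy; have z1 := Res1 Ryz; have z2 := Res2 Ryz.
have Ly1 : L y.1 <= c * (c * (c * Lam x + r)).
  by apply: (le_trans (L_le _)); rewrite ler_pM2l.
have Ly2 : L y.2 <= Lam x + c * r.
  rewrite -[y.2](subrK x.1) addrC; apply: (le_trans (LD _ _)); rewrite lerD//.
    by rewrite /Lam lerDl.
  apply: (le_trans (L_le _)); rewrite ler_pM2l//.
  by case: Rxy => _ [].
have Lam0 : 0 <= Lam x by rewrite addr_ge0.
have z1' : N z.1 <= c * (c * (c * (c * (c * Lam x + r)) + (Lam x + c * r)) + r').
  by apply: (le_trans z1); rewrite ler_pM2l// lerD2r ler_pM2l// lerD.
exact: pencil_const_le2 z1' z2 y1.
Qed.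

Let Lam_precompact e : 0 < e ->
  exists (n : nat) (l : 'I_n -> X * X -> R[i]) (k : R),
  [/\ 0 <= k, forall i a x z, l i (a *: x + z) = a * l i x + l i z,
      forall i x, normc (l i x) <= k * P x &
      forall x, Lam x <= e * P x + \sum_i normc (l i x)].
Proof.
move=> e0; have e20 : 0 < e / 2 by rewrite divr_gt0.
have [n [l [k [k0 ll lk lL]]]] := L_precompact e20.
exists (n + n)%N, (fun (i : 'I_(n + n)) x => match fintype.split i with inl j => l j x.1 | inr j => l j x.2 end), k.
split => //.
- by move=> i a x z; case: (fintype.split i) => j /=; rewrite ll.
- by move=> i x; case: (fintype.split i) => j; apply: (le_trans (lk _ _)); rewrite ler_wpM2l.
move=> x; rewrite /Lam big_split_ord/=.
under eq_bigr do rewrite (unsplitK (inl _)).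
under [X in _ + (_ + X)]eq_bigr do rewrite (unsplitK (inr _)).
have h1 : e / 2 * N x.1 <= e / 2 * P x by rewrite ler_pM2l.
have h2 : e / 2 * N x.2 <= e / 2 * P x by rewrite ler_pM2l.
have := lL x.1; have := lL x.2; lra.
Qed.

Let C_gt0 : 0 < C.
Proof. by rewrite mulr_gt0// -!addrA ltr_pwDl// !addr_ge0// ?exprn_ge0 ?(ltW c0). Qed.

(** The inf-sup bound for [b0] excludes [w = 0]. For other [w], the pencil divided by [w] says that
    [(x, w *: x)] is almost sent to its multiple by [w^-1], so the precision must be taken relative
    to [normc w]. *)
Lemma approx_kernel_Res w r : approx_kernel w -> 0 < r -> w != 0 /\
  exists x, P x = 1 /\ Res x (w^-1 *: x) r.
Proof.
move=> aw r0.
have w0 : w != 0.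
  apply/eqP => w0; have d0 : 0 < (2 * c)^-1 by rewrite invr_gt0 mulr_gt0.
  have [x [Nx xz]] := aw _ d0.
  have : N x <= c * (2 * c)^-1.
    apply: b0_infsup; first exact: ltW.
    by move=> z; have := xz z; rewrite w0 expr0n/= !mul0r !addr0.
  rewrite Nx invfM mulrCA divff ?gt_eqF// mulr1; lra.
split=> //.
have n0 : 0 < normc w by rewrite lt_neqAle normc_ge0 andbT eq_sym normc_eq0.
have d0 : 0 < r * normc w by rewrite mulr_gt0.
have [x [Nx xz]] := aw _ d0.
pose y : X * X := (x, w *: x).
have Py : 1 <= P y by rewrite -Nx; exact: (N_le1 y).
have Py0 : 0 < P y by exact: lt_le_trans ltr01 Py.
have Ry : Res y (w^-1 *: y) r.
  split; first exact: ltW.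
  split=> [z|]; last by rewrite /= scalerA mulVf// scale1r subrr seminorm0// ltW.
  have b0Z a u v : b0 (a *: u) v = a * b0 u v by rewrite -[a *: u]addr0 b0l b00 addr0.
  have b2Z a u v : b2 (a *: u) v = a * b2 u v by rewrite -[a *: u]addr0 b2l b20 addr0.
  rewrite /= b0Z b2Z.
  have -> : w^-1 * b0 x z + b1 x z + w * b2 x z =
      w^-1 * (b0 x z + w * b1 x z + w ^+ 2 * b2 x z).
    by rewrite !mulrDr mulrA mulVf// mul1r expr2 !mulrA mulVf// mul1r.
  rewrite normcM normcV ler_pdivrMl//; apply: (le_trans (xz z)).
  by rewrite mulrA [normc w * r]mulrC.
exists ((P y)^-1%:C%C *: y); split.
  by rewrite (seminormZ HH) normc_real ger0_norm ?invr_ge0 ?(ltW Py0)// mulVf// gt_eqF.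
have := Res_lin ((P y)^-1%:C%C) Ry Res00; rewrite !addr0 normc_real.
rewrite ger0_norm ?invr_ge0 ?(ltW Py0)// scalerA [_ * w^-1]mulrC -scalerA => -[_ [h1 h2]].
(* Normalising [y] does not enlarge the error, since [P y] is at least [N x = 1]. *)
have le1 : (P y)^-1 * r <= r by rewrite ler_piMl ?(ltW r0)// invf_le1.
split; first exact: ltW.
split=> [z|]; last exact: le_trans h2 le1.
by apply: (le_trans (h1 z)); rewrite ler_wpM2r ?seminorm_ge0.
Qed.

Lemma approx_kernel_finite (rho : R) :
  finite_set [set w : R[i] | normc w <= rho /\ approx_kernel w].
Proof.
apply: contrapT => /infinite_set_fset inf.
(* A lower bound for the moduli of the eigenvalues [w^-1]. The absolute value covers negative
   radii. *)
have m0 : 0 < (`|rho| + 1)^-1 by rewrite invr_gt0 ltr_wpDl.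
have [K0 HK] := approx_eigenvalues_bounded HH C_gt0 Res_lin Res00 Res_bounded
  Res2_bounded Lam_precompact m0.
have [B BW KB] := inf K0.
pose mu i : R[i] := (nth 0 (finmap.enum_fset B) i)^-1.
have Bin i : (i < (size (finmap.enum_fset B)))%N -> normc (nth 0 (finmap.enum_fset B) i) <= rho /\
    approx_kernel (nth 0 (finmap.enum_fset B) i).
  by move=> iK; apply: BW; rewrite /=; exact: mem_nth.
apply: (HK (size (finmap.enum_fset B)) mu KB).
- move=> i j iK jK /invr_inj/eqP; rewrite nth_uniq//; first by move/eqP.
  exact: finmap.fset_uniq.
- move=> i iK; have [le_rho ak] := Bin i iK.
  have [w0 _] := approx_kernel_Res ak ltr01.
  have n0 : 0 < normc (nth 0 (finmap.enum_fset B) i).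
    by rewrite lt_neqAle normc_ge0 andbT eq_sym normc_eq0.
  rewrite /mu normcV lef_pV2 ?posrE ?ltr_wpDl//.
  by apply: (le_trans le_rho); apply: (le_trans (ler_norm _)); rewrite lerDl.
- move=> i iK r r0; have [_ ak] := Bin i iK.
  by have [_] := approx_kernel_Res ak r0.
Qed.

End QuadraticPencil.

(** * Ellipticity of the stretched elastic density *)

Section Ellipticity.
Context {R : realType}.

Lemma sum_ord3 (V : nmodType) (F : 'I_3 -> V) : \sum_i F i = F 0 + F 1 + F 2.
Proof.
rewrite !big_ord_recl big_ord0 addr0 addrA.
by congr (F _ + F _ + F _); exact: val_inj.
Qed.

Lemma prod_ord3_neq (s : 'I_3 -> R[i]) :
  (\prod_(k | k != 0) s k = s 1 * s 2) * (\prod_(k | k != 1) s k = s 0 * s 2) *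
  (\prod_(k | k != 2) s k = s 0 * s 1).
Proof.
by split; [split|]; rewrite big_mkcond !big_ord_recl big_ord0 /= ?mul1r ?mulr1;
  congr (s _ * s _); exact: val_inj.
Qed.

(* In terms of the slopes t_i = b_i / a_i the bracket is
   (l + 2 m) (1 - t2 t3 + t1 (t2 + t3)) - (l + m) (1 + t1^2). *)
Lemma diag_margin (l m t a1 a2 a3 b1 b2 b3 : R) :
  0 < m -> 0 < l + m -> 0 <= t -> t <= 1 -> (l + 2 * m) * t ^+ 2 <= m ->
  0 < a1 -> 0 < a2 -> 0 < a3 ->
  0 <= b1 <= t * a1 -> 0 <= b2 <= t * a2 -> 0 <= b3 <= t * a3 ->
  (m - (l + 2 * m) * t ^+ 2) * (a1 ^+ 2 * (a2 * a3)) <=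
  (l + 2 * m) * (a1 * (a2 * a3 - b2 * b3) + b1 * (a2 * b3 + b2 * a3)) * a1 -
  (l + m) * (a2 * a3) * (a1 ^+ 2 + b1 ^+ 2).
Proof.
move=> m0 lm0 t0 t1 lmt a10 a20 a30 /andP[b10 b1a] /andP[b20 b2a] /andP[b30 b3a].
have slope a b : 0 < a -> 0 <= b -> b <= t * a ->
    exists u, [/\ b = u * a, 0 <= u & u <= t].
  move=> a0 b0 ba; exists (b / a); split; first by rewrite divfK// gt_eqF.
    by rewrite divr_ge0// ltW.
  by rewrite ler_pdivrMr.
have [u1 [-> u10 u1t]] := slope _ _ a10 b10 b1a.
have [u2 [-> u20 u2t]] := slope _ _ a20 b20 b2a.
have [u3 [-> u30 u3t]] := slope _ _ a30 b30 b3a.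
have lm2 : 0 < l + 2 * m by lra.
have u23 : u2 * u3 <= t ^+ 2 by rewrite expr2 ler_pM.
have u11 : u1 ^+ 2 <= t ^+ 2 by rewrite ler_pXn2r ?nnegrE.
have key : m - (l + 2 * m) * t ^+ 2 <=
    (l + 2 * m) * (1 - u2 * u3 + u1 * (u2 + u3)) - (l + m) * (1 + u1 ^+ 2).
  (* If [u1] dominates [u3] or [u2], one of the products [u1 * u2], [u1 * u3] absorbs [u2 * u3], and
     only [(l + m) * u1 ^+ 2] is lost. If [u1] is the smallest slope, [u1 * u3] absorbs [u1 ^+ 2],
     and only [u2 * u3] is lost. *)
  have [u31|u13] := leP u3 u1.
    have h1 : u2 * u3 <= u1 * u2 by rewrite mulrC ler_wpM2r.
    have h2 : 0 <= u1 * u3 by rewrite mulr_ge0.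
    have h3 : (l + 2 * m) * (u2 * u3) <= (l + 2 * m) * (u1 * u2) by rewrite ler_pM2l.
    have h4 : 0 <= (l + 2 * m) * (u1 * u3) by rewrite mulr_ge0// ltW.
    have h5 : (l + m) * u1 ^+ 2 <= (l + m) * t ^+ 2 by rewrite ler_pM2l.
    have h6 : 0 <= m * t ^+ 2 by rewrite mulr_ge0 ?sqr_ge0// ltW.
    by lra.
  have [u21|u12] := leP u2 u1.
    have h1 : u2 * u3 <= u1 * u3 by rewrite ler_wpM2r.
    have h2 : 0 <= u1 * u2 by rewrite mulr_ge0.
    have h3 : (l + 2 * m) * (u2 * u3) <= (l + 2 * m) * (u1 * u3) by rewrite ler_pM2l.
    have h4 : 0 <= (l + 2 * m) * (u1 * u2) by rewrite mulr_ge0// ltW.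
    have h5 : (l + m) * u1 ^+ 2 <= (l + m) * t ^+ 2 by rewrite ler_pM2l.
    have h6 : 0 <= m * t ^+ 2 by rewrite mulr_ge0 ?sqr_ge0// ltW.
    by lra.
  have h1 : u1 ^+ 2 <= u1 * u3 by rewrite expr2 ler_wpM2l// ltW.
  have h2 : (l + m) * u1 ^+ 2 <= (l + m) * (u1 * u3) by rewrite ler_pM2l.
  have h3 : 0 <= m * (u1 * u3) by rewrite mulr_ge0 ?mulr_ge0// ltW.
  have h4 : 0 <= (l + 2 * m) * (u1 * u2) by rewrite mulr_ge0 ?mulr_ge0// ltW.
  have h5 : (l + 2 * m) * (u2 * u3) <= (l + 2 * m) * t ^+ 2 by rewrite ler_pM2l.
  by lra.
have -> : (l + 2 * m) * (a1 * (a2 * a3 - u2 * a2 * (u3 * a3)) +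
      u1 * a1 * (a2 * (u3 * a3) + u2 * a2 * a3)) * a1 -
    (l + m) * (a2 * a3) * (a1 ^+ 2 + (u1 * a1) ^+ 2) =
    ((l + 2 * m) * (1 - u2 * u3 + u1 * (u2 + u3)) - (l + m) * (1 + u1 ^+ 2)) *
    (a1 ^+ 2 * (a2 * a3)) by ring.
by rewrite ler_wpM2r// mulr_ge0 ?sqr_ge0// mulr_ge0// ltW.
Qed.

(** A truncated sector of the right half plane: [A] limits the real part and [t] is the largest
    tangent of the argument. *)
Definition admissible (t A : R) (s : R[i]) : Prop :=
  [/\ 1 <= complex.Re s, complex.Re s <= A, 0 <= complex.Im s &
      complex.Im s <= t * complex.Re s].

Lemma admissible_neq0 t A s : admissible t A s -> s != 0.
Proof.
case=> s1 _ _ _; apply/eqP => s0; move: s1.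
by rewrite s0 /= ler10.
Qed.

Lemma Re_ratio (s1 s2 s3 : R[i]) :
  complex.Re (s2 * s3 / s1) =
  (complex.Re s1 * (complex.Re s2 * complex.Re s3 - complex.Im s2 * complex.Im s3) +
   complex.Im s1 * (complex.Re s2 * complex.Im s3 + complex.Im s2 * complex.Re s3)) /
  (complex.Re s1 ^+ 2 + complex.Im s1 ^+ 2).
Proof.
case: s1 s2 s3 => a1 b1 [a2 b2] [a3 b3] /=.
by rewrite mulrDl; ring.
Qed.

(** The denominator [2 * A] arises because [Im s1] is at most [Re s1], so that the squared modulus
    of [s1] is at most [2 * A] times its real part. *)
Lemma Re_ratio_ge (t A : R) (s1 s2 s3 : R[i]) : 0 <= t -> t <= 1 ->
  admissible t A s1 -> admissible t A s2 -> admissible t A s3 ->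
  (1 - t ^+ 2) / (2 * A) <= complex.Re (s2 * s3 / s1).
Proof.
move=> t0 t1 [a1 a1A b1 b1t] [a2 a2A b2 b2t] [a3 a3A b3 b3t]; rewrite Re_ratio.
move: (complex.Re s1) (complex.Im s1) (complex.Re s2) (complex.Im s2)
  (complex.Re s3) (complex.Im s3) a1 a1A b1 b1t a2 a2A b2 b2t a3 a3A b3 b3t
  => {s1 s2 s3} a1 b1 a2 b2 a3 b3 a11 a1A b10 b1t a21 a2A b20 b2t a31 a3A b30 b3t.
have A0 : 0 < A by lra.
have n0 : 0 < a1 ^+ 2 + b1 ^+ 2 by rewrite ltr_pwDl ?sqr_ge0// exprn_gt0//; lra.
rewrite ler_pdivlMr// mulrAC ler_pdivrMr ?mulr_gt0//.
have b1a : b1 <= a1.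
  by apply: (le_trans b1t); rewrite ler_piMl//; lra.
have b11 : b1 ^+ 2 <= a1 ^+ 2 by rewrite ler_pXn2r ?nnegrE//; lra.
have b23 : b2 * b3 <= t ^+ 2 * (a2 * a3).
  have -> : t ^+ 2 * (a2 * a3) = (t * a2) * (t * a3) by ring.
  by rewrite ler_pM.
have a23 : 1 <= a2 * a3 by rewrite -[1]mulr1 ler_pM.
have t2 : t ^+ 2 <= 1 by rewrite expr_le1.
have h1 : (1 - t ^+ 2) * (a1 ^+ 2 + b1 ^+ 2) <= (1 - t ^+ 2) * (2 * a1 ^+ 2).
  by rewrite ler_wpM2l ?subr_ge0//; lra.
apply: (le_trans h1).
have h2 : (1 - t ^+ 2) * (2 * a1 ^+ 2) <= (1 - t ^+ 2) * (2 * a1 * A).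
  by rewrite ler_wpM2l ?subr_ge0// expr2 mulrA ler_wpM2l//; lra.
apply: (le_trans h2).
have h3 : 1 - t ^+ 2 <= a2 * a3 - b2 * b3.
  have : (1 - t ^+ 2) * 1 <= (1 - t ^+ 2) * (a2 * a3) by rewrite ler_wpM2l ?subr_ge0.
  by lra.
have -> : (1 - t ^+ 2) * (2 * a1 * A) = (a1 * (1 - t ^+ 2)) * (2 * A) by ring.
rewrite ler_wpM2r ?mulr_ge0 ?(ltW A0)//.
have h4 : a1 * (1 - t ^+ 2) <= a1 * (a2 * a3 - b2 * b3) by rewrite ler_wpM2l//; lra.
apply: (le_trans h4); rewrite lerDl.
have [a20 a30] : 0 <= a2 /\ 0 <= a3 by split; lra.
by rewrite mulr_ge0// addr_ge0// mulr_ge0.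
Qed.

(** The second term on the left is the diagonal weight that [psd3] requires in order to dominate the
    mixed derivatives. The first is what remains for ellipticity. *)
Lemma Re_ratio_margin (l m t A : R) (s1 s2 s3 : R[i]) :
  0 < m -> 0 < l + m -> 0 <= t -> t <= 1 -> (l + 2 * m) * t ^+ 2 <= m ->
  admissible t A s1 -> admissible t A s2 -> admissible t A s3 ->
  (m - (l + 2 * m) * t ^+ 2) / (2 * A) +
    (l + m) * (complex.Re s2 * complex.Re s3 / complex.Re s1) <=
  (l + 2 * m) * complex.Re (s2 * s3 / s1).
Proof.
move=> m0 lm0 t0 t1 lmt.
move=> [a1 a1A b1 b1t] [a2 a2A b2 b2t] [a3 a3A b3 b3t]; rewrite Re_ratio.
move: (complex.Re s1) (complex.Im s1) (complex.Re s2) (complex.Im s2)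
  (complex.Re s3) (complex.Im s3) a1 a1A b1 b1t a2 a2A b2 b2t a3 a3A b3 b3t
  => {s1 s2 s3} a1 b1 a2 b2 a3 b3 a11 a1A b10 b1t a21 a2A b20 b2t a31 a3A b30 b3t.
have A0 : 0 < A by lra.
have a10 : 0 < a1 by lra. have a20 : 0 < a2 by lra. have a30 : 0 < a3 by lra.
have n0 : 0 < a1 ^+ 2 + b1 ^+ 2 by rewrite ltr_pwDl ?sqr_ge0// exprn_gt0//.
have := @diag_margin l m t a1 a2 a3 b1 b2 b3 m0 lm0 t0 t1 lmt a10 a20 a30.
rewrite b10 b1t b20 b2t b30 b3t => /(_ isT isT isT).
set X := a1 * _ + _; set d := m - _ => dX.
have d0 : 0 <= d by rewrite subr_ge0.
rewrite [leRHS]mulrA ler_pdivlMr//.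
have b1a : b1 <= a1 by apply: (le_trans b1t); rewrite ler_piMl// ltW.
have b11 : b1 ^+ 2 <= a1 ^+ 2 by rewrite ler_pXn2r ?nnegrE// ltW.
rewrite -(ler_pM2r a10).
apply: le_trans (_ : d * (a1 ^+ 2 * (a2 * a3)) + (l + m) * (a2 * a3) * (a1 ^+ 2 + b1 ^+ 2) <= _); last by lra.
rewrite [leLHS](_ : _ = d / (2 * A) * ((a1 ^+ 2 + b1 ^+ 2) * a1) +
    (l + m) * (a2 * a3) * (a1 ^+ 2 + b1 ^+ 2)); last by field; rewrite ?gt_eqF.
rewrite lerD2r -mulrA ler_wpM2l// mulrC ler_pdivrMr ?mulr_gt0//.
have a23 : 1 <= a2 * a3 by rewrite -[1]mulr1 ler_pM.
have h1 : (a1 ^+ 2 + b1 ^+ 2) * a1 <= (2 * a1 ^+ 2) * A.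
  by apply: ler_pM => //; [exact: ltW|exact: ltW|lra].
apply: (le_trans h1); have -> : 2 * a1 ^+ 2 * A = a1 ^+ 2 * 1 * (2 * A) by ring.
by rewrite ler_pM2r ?mulr_gt0// ler_pM2l ?exprn_gt0.
Qed.

(** The form is [a1 * a2 * a3] times the square of the sum of the [x_i / a_i], a weighted squared
    divergence. Its mixed coefficients are the third factors [a_k], as in the elastic density. *)
Lemma psd3 (a1 a2 a3 x1 x2 x3 : R) : 0 < a1 -> 0 < a2 -> 0 < a3 ->
  0 <= a2 * a3 / a1 * x1 ^+ 2 + a1 * a3 / a2 * x2 ^+ 2 + a1 * a2 / a3 * x3 ^+ 2 +
    2 * (a3 * (x1 * x2) + a2 * (x1 * x3) + a1 * (x2 * x3)).
Proof.
move=> a10 a20 a30; rewrite [leRHS](_ : _ = a1 * a2 * a3 * (x1 / a1 + x2 / a2 + x3 / a3) ^+ 2).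
  by rewrite mulr_ge0 ?sqr_ge0// !mulr_ge0// ltW.
by field; rewrite ?gt_eqF.
Qed.

(** The integrand after the exchange of derivatives: for [i != j] the shear product of weight [m]
    and the dilatation product of weight [l] have merged into one term of weight [l + m]. *)
Definition elastic_density (l m : R) (s : 'I_3 -> R[i]) (G : 'I_3 -> 'I_3 -> R[i]) : R[i] :=
  \sum_i \sum_j (if i == j
    then (l + 2 * m)%:C%C * ((\prod_(k | k != j) s k) / s j) * (G j j * conjc (G j j))
    else m%:C%C * ((\prod_(k | k != j) s k) / s j) * (G i j * conjc (G i j)) +
      (l + m)%:C%C * ((\prod_(k | k != j) s k) / s i) * (G j j * conjc (G i i))).

Lemma elastic_density_ge (l m t A : R) (s : 'I_3 -> R[i]) (G : 'I_3 -> 'I_3 -> R[i]) :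
  0 < m -> 0 < l + m -> 0 <= t -> t <= 1 -> (l + 2 * m) * t ^+ 2 <= m ->
  (forall j, admissible t A (s j)) ->
  Num.min ((m - (l + 2 * m) * t ^+ 2) / (2 * A)) (m * ((1 - t ^+ 2) / (2 * A))) *
    \sum_i \sum_j normc (G i j) ^+ 2 <= complex.Re (elastic_density l m s G).
Proof.
move=> m0 lm0 t0 t1 lmt adm.
set c := Num.min _ _.
have ReMr k (x : R[i]) (n : R) : complex.Re (k%:C%C * x * n%:C%C) = k * complex.Re x * n.
  by case: x => a b /=; ring.
have offd x y z : admissible t A x -> admissible t A y -> admissible t A z -> forall w : R[i],
    c * normc w ^+ 2 <= complex.Re (m%:C%C * (y * z / x) * (w * conjc w)).
  move=> ax ay az w; rewrite mul_conjc ReMr ler_wpM2r ?sqr_ge0//.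
  apply: (@le_trans _ _ (m * ((1 - t ^+ 2) / (2 * A)))); first by rewrite ge_min lexx orbT.
  by rewrite ler_pM2l//; exact: Re_ratio_ge.
have diag x y z : admissible t A x -> admissible t A y -> admissible t A z -> forall w : R[i],
    c * normc w ^+ 2 + (l + m) * (complex.Re y * complex.Re z / complex.Re x) * normc w ^+ 2 <=
    complex.Re ((l + 2 * m)%:C%C * (y * z / x) * (w * conjc w)).
  move=> ax ay az w; rewrite mul_conjc ReMr -mulrDl ler_wpM2r ?sqr_ge0//.
  apply: le_trans (Re_ratio_margin m0 lm0 t0 t1 lmt ax ay az).
  by rewrite lerD2r ge_min lexx.
(* The mixed terms for (i, j) and (j, i) have the same coefficient and conjugate products, so only
   the real part of the third stretch factor survives. This reduces them to [psd3] for the real and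
   for the imaginary parts. *)
have cross (y z w : R[i]) :
    complex.Re ((l + m)%:C%C * y * (z * conjc w)) +
    complex.Re ((l + m)%:C%C * y * (w * conjc z)) =
    2 * ((l + m) * (complex.Re y * (complex.Re z * complex.Re w + complex.Im z * complex.Im w))).
  by case: y z w => a b [a1 b1] [a2 b2] /=; ring.
have n0 j : s j != 0 by exact: admissible_neq0 (adm j).
have cl x y : x != 0 -> x * y / x = y :> R[i] by move=> x0; rewrite mulrAC divff// mul1r.
rewrite /elastic_density !sum_ord3 /= !prod_ord3_neq.
rewrite !(cl (s _) (s _) (n0 _)) !(mulfK (n0 _)) !ReD.
have A0 := adm 0; have A1 := adm 1; have A2 := adm 2.
have d0 := diag _ _ _ A0 A1 A2 (G 0 0); have d1 := diag _ _ _ A1 A0 A2 (G 1 1).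
have d2 := diag _ _ _ A2 A0 A1 (G 2 2).
have o01 := offd _ _ _ A1 A0 A2 (G 0 1); have o02 := offd _ _ _ A2 A0 A1 (G 0 2).
have o10 := offd _ _ _ A0 A1 A2 (G 1 0); have o12 := offd _ _ _ A2 A0 A1 (G 1 2).
have o20 := offd _ _ _ A0 A1 A2 (G 2 0); have o21 := offd _ _ _ A1 A0 A2 (G 2 1).
have c01 := cross (s 2) (G 1 1) (G 0 0); have c02 := cross (s 1) (G 2 2) (G 0 0).
have c12 := cross (s 0) (G 2 2) (G 1 1).
have pos t' A' x : admissible t' A' x -> 0 < complex.Re x.
  by case=> h _ _ _; exact: lt_le_trans h.
have a0 := pos _ _ _ A0; have a1 := pos _ _ _ A1; have a2 := pos _ _ _ A2.
have pR := psd3 (complex.Re (G 0 0)) (complex.Re (G 1 1)) (complex.Re (G 2 2)) a0 a1 a2.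
have pI := psd3 (complex.Im (G 0 0)) (complex.Im (G 1 1)) (complex.Im (G 2 2)) a0 a1 a2.
have := mulr_ge0 (ltW lm0) (addr_ge0 pR pI).
move: d0 d1 d2 c01 c02 c12.
rewrite !(sqr_normcE (G 0 0)) !(sqr_normcE (G 1 1)) !(sqr_normcE (G 2 2)).
move: o01 o02 o10 o12 o20 o21; clear -l; lra.
Qed.

End Ellipticity.

(** * Lebesgue measure on R^3 *)

Section SigmaFiniteProduct.
Local Open Scope ereal_scope.
Context d1 d2 (T1 : measurableType d1) (T2 : measurableType d2) (R : realType).
Variable m1 : {sigma_finite_measure set T1 -> \bar R}.
Variable m2 : {sigma_finite_measure set T2 -> \bar R}.

(** Makes a product measure eligible as a factor of a further product, so that Fubini's theorem can
    be iterated. *)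
Lemma product_measure_sigma_finite : sigma_finite setT (m1 \x m2).
Proof.
have /sigma_finiteP[F [TF ndF Foo]] := sigma_finiteT m1.
have /sigma_finiteP[G [TG ndG Goo]] := sigma_finiteT m2.
exists (fun n => F n `*` G n).
  rewrite -setXTT TF TG predeqE => -[x y]; split; last first.
    by move=> [n _ []/= ? ?]; split; exists n.
  move=> [/= [n _ Fnx] [k _ Gky]]; exists (maxn n k) => //; split.
    by move: x Fnx; exact/subsetPset/ndF/leq_maxl.
  by move: y Gky; exact/subsetPset/ndG/leq_maxr.
move=> k; have [? ?] := Foo k; have [? ?] := Goo k.
split; first exact: measurableX.
by rewrite product_measure1E// lte_mul_pinfty// ge0_fin_numE.
Qed.

End SigmaFiniteProduct.

Notation leb := lebesgue_measure.

Section Volume.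
Context {R : realType}.
Local Notation mR := (measurableTypeR R).

(** [leb_sf], [area] and [vol3] carry the sigma-finite structures and are convertible with the
    measures from which [volume] is built. *)
Definition leb_sf : {sigma_finite_measure set mR -> \bar R} :=
  @lebesgue_measure R.

Definition area : set (mR * mR)%type -> \bar R := (leb_sf \x leb_sf)%E.
HB.instance Definition _ := Measure.on area.
HB.instance Definition _ := Measure_isSigmaFinite.Build _ _ _ area
  (product_measure_sigma_finite _ _).

Definition vol3 : set (mspace3 R) -> \bar R := (area \x leb_sf)%E.
HB.instance Definition _ := Measure.on vol3.
HB.instance Definition _ := Measure_isSigmaFinite.Build _ _ _ vol3
  (product_measure_sigma_finite _ _).

Lemma Fubini_volume (f : mspace3 R -> \bar R) : (@volume R).-integrable setT f ->
  (\int[@volume R]_x f x = \int[area]_y \int[leb]_c f (y, c))%E.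
Proof.
by move/(@integral12_prod_meas1 _ _ _ _ _ area leb_sf f).
Qed.

Lemma Fubini_volume_swap (f : mspace3 R -> \bar R) : (@volume R).-integrable setT f ->
  (\int[@volume R]_x f x = \int[leb]_c \int[area]_y f (y, c))%E.
Proof.
by move/(@integral21_prod_meas1 _ _ _ _ _ area leb_sf f).
Qed.

Lemma Fubini_area (f : mR * mR -> \bar R) : area.-integrable setT f ->
  (\int[area]_x f x = \int[leb]_a \int[leb]_b f (a, b))%E.
Proof.
by move/(@integral12_prod_meas1 _ _ _ _ _ leb_sf leb_sf f).
Qed.

Lemma Fubini_area_swap (f : mR * mR -> \bar R) : area.-integrable setT f ->
  (\int[area]_x f x = \int[leb]_b \int[leb]_a f (a, b))%E.
Proof.
by move/(@integral21_prod_meas1 _ _ _ _ _ leb_sf leb_sf f).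
Qed.

End Volume.

Section EuclideanSets.
Context {R : realType}.
Implicit Types (D : set (space3 R)) (x : space3 R).
Local Notation mR := (measurableTypeR R).

Definition oprod3 (A B C : set R) : set (space3 R) := (A `*` B) `*` C.

Lemma open_cube_sub D x : open D -> D x -> exists2 e : R, 0 < e &
  oprod3 `[x.1.1 - e, x.1.1 + e] `[x.1.2 - e, x.1.2 + e]
         `[x.2 - e, x.2 + e] `<=` D.
Proof.
move=> oD Dx; have : nbhs x D by exact: open_nbhs_nbhs.
move=> /nbhs_ballP[e /= e0 eD].
exists (e / 2); first by rewrite divr_gt0.
move=> [[a b] c] /= [[]]; rewrite /= !in_itv/= => /andP[a1 a2] /andP[b1 b2] /andP[c1 c2].
by apply: eD; split; [split|]; rewrite /ball/= ltr_norml; apply/andP; split; lra.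
Qed.

Definition rat_box (q : (rat * rat) * (rat * rat) * (rat * rat)) : set (space3 R) :=
  oprod3 `]ratr q.1.1.1, ratr q.1.1.2[ `]ratr q.1.2.1, ratr q.1.2.2[
         `]ratr q.2.1, ratr q.2.2[.

Definition rat_cbox (q : (rat * rat) * (rat * rat) * (rat * rat)) : set (space3 R) :=
  oprod3 `[ratr q.1.1.1, ratr q.1.1.2] `[ratr q.1.2.1, ratr q.1.2.2]
         `[ratr q.2.1, ratr q.2.2].

(** The cover is countable, and it is the closed boxes that must lie in [D]: bump functions on such
    a box are then test functions on [D]. *)
Lemma open_rat_cover D : open D ->
  D = \bigcup_(q in [set q | rat_cbox q `<=` D]) rat_box q.
Proof.
move=> oD; apply/seteqP; split => [x Dx|x [q qD [[]]]]; last first.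
  rewrite /= !in_itv/= => /andP[/ltW ? /ltW ?] /andP[/ltW ? /ltW ?] /andP[/ltW ? /ltW ?].
  by apply: qD; split; [split|]; rewrite /= in_itv/=; apply/andP; split.
have [e e0 eD] := open_cube_sub oD Dx.
have lo (t : R) : exists q : rat, t - e < ratr q < t.
  have /rat_in_itvoo[q] : t - e < t by lra.
  by rewrite in_itv => qt; exists q.
have hi (t : R) : exists q : rat, t < ratr q < t + e.
  have /rat_in_itvoo[q] : t < t + e by lra.
  by rewrite in_itv => qt; exists q.
have [a1 /andP[? ?]] := lo x.1.1; have [a2 /andP[? ?]] := hi x.1.1.
have [b1 /andP[? ?]] := lo x.1.2; have [b2 /andP[? ?]] := hi x.1.2.
have [c1 /andP[? ?]] := lo x.2; have [c2 /andP[? ?]] := hi x.2.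
exists ((a1, a2), (b1, b2), (c1, c2)); last first.
  by split; [split|]; rewrite /= in_itv/=; apply/andP; split.
move=> y [[]]; rewrite /= !in_itv/= => /andP[? ?] /andP[? ?] /andP[? ?].
apply: eD; split; [split|]; rewrite /= in_itv/=; apply/andP; split; lra.
Qed.

Lemma measurable_oprod3 (A B C : set R) : measurable A -> measurable B ->
  measurable C -> measurable (oprod3 A B C : set (mspace3 R)).
Proof. by move=> mA mB mC; apply: measurableX => //; exact: measurableX. Qed.

Lemma open_measurable3 D : open D -> measurable (D : set (mspace3 R)).
Proof.
move=> /open_rat_cover ->.
rewrite bigcup_mkcond; apply: countable_bigcupT_measurable => // q.
case: ifP => // _; apply: measurable_oprod3; exact: measurable_itv.
Qed.

Lemma continuous_measurable3 (f : space3 R -> R) : continuous f ->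
  measurable_fun [set: mspace3 R] f.
Proof.
move=> /continuousP cf; apply: (measurability _ (RGenOpens.measurableE R)).
move=> _ [_ [a [b ->] <-]]; rewrite setTI; apply: open_measurable3.
exact/cf/interval_open.
Qed.

Lemma bounded_set_cube D : bounded_set D ->
  exists2 M : R, 0 < M & D `<=` oprod3 `[- M, M] `[- M, M] `[- M, M].
Proof.
move=> [M [_ MD]].
have M1 : M < Num.max M 0 + 1 by rewrite ltr_pwDr// le_max lexx.
exists (Num.max M 0 + 1); first by rewrite ltr_pwDr// le_max lexx orbT.
move=> [[a b] c] /(MD _ M1); rewrite /= !prod_normE/= !ge_max.
by move=> /andP[/andP[? ?] ?]; split; [split|]; rewrite /= in_itv/= -ler_norml.
Qed.

Lemma volume_oprod3 (A B C : set R) : measurable A -> measurable B ->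
  measurable C -> @volume R (oprod3 A B C) = (leb A * leb B * leb C)%E.
Proof.
move=> mA mB mC.
rewrite -(@product_measure1E _ _ _ _ _ leb_sf leb_sf A B)//.
by apply: (@product_measure1E _ _ _ _ _ area leb_sf) => //; exact: measurableX.
Qed.

Lemma bounded_set_volume D : bounded_set D -> measurable (D : set (mspace3 R)) ->
  (@volume R D < +oo)%E.
Proof.
move=> /bounded_set_cube[M M0 DM] mD.
have mI : measurable (`[- M, M]%classic : set R) by exact: measurable_itv.
apply: (@le_lt_trans _ _ (volume (oprod3 `[- M, M] `[- M, M] `[- M, M]))).
  apply: le_measure => //; rewrite inE//.
  by apply: measurableX => //; exact: measurableX.
rewrite volume_oprod3//.
have -> : leb `[- M, M] = (M - - M)%:E.
  by rewrite (lebesgue_measure_itv `[- M, M])/= lte_fin ifT ?EFinB//; lra.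
by rewrite -!EFinM ltry.
Qed.

End EuclideanSets.

(** * Bump functions and the du Bois-Reymond lemma *)

Section SmoothLine.
Context {R : realType}.
Implicit Types (f g : R -> R).

(** Smoothness is encoded as membership in some class of functions stable under differentiation.
    Iterated derivatives then never have to be computed: it suffices to exhibit a stable class. *)
Definition derivation_closed (P : set (R -> R)) : Prop :=
  forall f, P f -> exists2 f', P f' & forall x : R, is_derive x 1 f (f' x).

Definition smooth1 f : Prop := exists2 P, derivation_closed P & P f.

Lemma smooth1_derive f : smooth1 f ->
  exists2 f', smooth1 f' & forall x : R, is_derive x 1 f (f' x).
Proof. by move=> [P dP Pf]; have [f' Pf' ff'] := dP f Pf; exists f' => //; exists P. Qed.

Lemma smooth1_continuous f : smooth1 f -> continuous f.
Proof.
move=> /smooth1_derive[f' _ ff'] x; apply/differentiable_continuous/derivable1_diffP.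
by case: (ff' x).
Qed.

Lemma smooth1_cst k : smooth1 (cst k).
Proof.
exists [set f | exists k, f = cst k]; last by exists k.
by move=> _ [l ->]; exists (cst 0); [exists 0|move=> x; exact: is_derive_cst].
Qed.

Lemma smooth1D f g : smooth1 f -> smooth1 g -> smooth1 (fun x => f x + g x).
Proof.
move=> [P dP Pf] [Q dQ Qg].
exists [set h | exists a b, [/\ P a, Q b & h = fun x => a x + b x]]; last first.
  by exists f, g.
move=> _ [a [b [Pa Qb ->]]]; have [a' Pa' aa'] := dP a Pa; have [b' Qb' bb'] := dQ b Qb.
exists (fun x => a' x + b' x); first by exists a', b'.
by move=> x; exact: is_deriveD.
Qed.

(** The class generated by Leibniz's rule from products of one function of each class. *)
Inductive sum_of_products (P Q : set (R -> R)) : set (R -> R) :=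
| SumProdOne a b of P a & Q b : sum_of_products P Q (fun x => a x * b x)
| SumProdAdd u v of sum_of_products P Q u & sum_of_products P Q v :
    sum_of_products P Q (fun x => u x + v x).

Lemma smooth1M f g : smooth1 f -> smooth1 g -> smooth1 (fun x => f x * g x).
Proof.
move=> [P dP Pf] [Q dQ Qg].
exists (sum_of_products P Q); last exact: SumProdOne.
move=> h; elim => [a b Pa Qb|u v _ [u' Pu' uu'] _ [v' Pv' vv']].
  have [a' Pa' aa'] := dP a Pa; have [b' Qb' bb'] := dQ b Qb.
  exists (fun x => a x * b' x + a' x * b x).
    by apply: SumProdAdd; exact: SumProdOne.
  move=> x; apply: (is_derive_eq (is_deriveM (aa' x) (bb' x))).
  by rewrite /GRing.scale/= [b x * _]mulrC.
exists (fun x => u' x + v' x); first exact: SumProdAdd.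
by move=> x; exact: is_deriveD.
Qed.

Lemma smooth1Z k f : smooth1 f -> smooth1 (fun x => k * f x).
Proof. by move=> sf; exact: (smooth1M (smooth1_cst k) sf). Qed.

Lemma smooth1X f n : smooth1 f -> smooth1 (fun x => f x ^+ n).
Proof.
move=> sf; elim: n => [|n IHn].
  by have := smooth1_cst 1; congr smooth1; apply/funext => x; rewrite expr0.
suff -> : (fun x => f x ^+ n.+1) = (fun x => f x * f x ^+ n) by exact: smooth1M.
by apply/funext => x; rewrite exprS.
Qed.

Lemma smooth1_affine f s c : smooth1 f -> smooth1 (fun x => f (s * x + c)).
Proof.
move=> [P dP Pf].
exists [set h | exists k g, P g /\ h = fun x => k * g (s * x + c)]; last first.
  by exists 1, f; split=> //; apply/funext => x; rewrite mul1r.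
move=> _ [k [g [Pg ->]]]; have [g' Pg' gg'] := dP g Pg.
exists (fun x => (k * s) * g' (s * x + c)); first by exists (k * s), g'.
move=> x; have h1 : is_derive x 1 (fun x => s * x + c) s.
  have := is_deriveD (is_deriveZ s (is_derive_id x 1)) (is_derive_cst c x 1).
  by move/is_derive_eq; apply; rewrite /GRing.scale/= addr0 mulr1.
have h2 := @is_derive1_comp _ g (fun x => s * x + c) x _ _ (gg' _) h1.
apply: (is_derive_eq (is_deriveZ k h2)).
by rewrite /GRing.scale/=; ring.
Qed.

Let flat (p : {poly R}) (s : R) := if 0 < s then p.[s^-1] * expR (- s^-1) else 0.

Lemma poly_expR_bounded (q : {poly R}) :
  exists2 K : R, 0 <= K & forall y, 0 <= y -> `|q.[y]| * expR (- y) <= K.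
Proof.
exists (\sum_(i < size q) `|q`_i| * i`!%:R).
  by apply: sumr_ge0 => i _; rewrite mulr_ge0.
move=> y y0; rewrite horner_coef expRN ler_pdivrMr ?expR_gt0//.
apply: (le_trans (ler_norm_sum _ _ _)); rewrite mulr_suml; apply: ler_sum => i _.
rewrite normrM -mulrA ler_wpM2l// normrX (ger0_norm y0).
case: (nat_of_ord i) => [|n].
  by rewrite expr0 fact0 mul1r -[leLHS]expR0 ler_expR.
have := expR_ge1Dxn n y0; rewrite -lerBrDl => /le_trans h.
have : y ^+ n.+1 / n.+1`!%:R <= expR y by apply: h; rewrite lerBlDl lerDr ler01.
by rewrite ler_pdivrMr ?ltr0n ?fact_gt0// mulrC.
Qed.

(** Quadratic decay at the origin makes the difference quotient there tend to zero, the one point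
    where the formula for the derivative needs an argument. *)
Lemma flat_le_sqr p : exists2 K : R, 0 <= K & forall s, `|flat p s| <= K * s ^+ 2.
Proof.
have [K K0 Kb] := poly_expR_bounded ('X^2 * p).
exists K => // s; rewrite /flat; case: ifPn => s0; last first.
  by rewrite normr0 mulr_ge0// sqr_ge0.
have := Kb _ (ltW (etrans (invr_gt0 s) s0)).
rewrite hornerM hornerXn normrM normrX gtr0_norm ?invr_gt0//.
rewrite exprVn -mulrA mulrC ler_pdivrMr ?exprn_gt0//.
by rewrite normrM (gtr0_norm (expR_gt0 _)).
Qed.

Lemma is_derive_flat p (x : R) : is_derive x 1 (flat p) (flat ('X^2 * (p - p^`())) x).
Proof.
have [x0|x0|->] := ltgtP x 0.
- have nx : {near x, cst 0 =1 flat p}.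
    near=> y; rewrite /flat ltNge.
    suff /ltW -> : y < 0 by [].
    by near: y; apply: open_nbhs_nbhs; split => //; exact: open_lt.
  rewrite {2}/flat ltNge (ltW x0)/=.
  apply: DeriveDef.
    by apply: (near_eq_derivable nx); exact: derivable_cst.
  by rewrite -(near_eq_derive _ nx) derive_cst.
- have nx : {near x, (fun s => p.[s^-1] * expR (- s^-1)) =1 flat p}.
    near=> y; rewrite /flat ifT//.
    by near: y; apply: open_nbhs_nbhs; split => //; exact: open_gt.
  suff H : is_derive x 1 (fun s => p.[s^-1] * expR (- s^-1))
      (('X^2 * (p - p^`())).[x^-1] * expR (- x^-1)).
    rewrite {2}/flat x0; apply: DeriveDef.
      by apply: (near_eq_derivable nx); case: H.
    by rewrite -(near_eq_derive _ nx); case: H.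
  have hV : is_derive x 1 (fun s : R => s^-1) (- x ^- 2).
    have := @is_deriveV R id x 1 1 (lt0r_neq0 x0) (is_derive_id _ _).
    by move/is_derive_eq; apply; rewrite /GRing.scale/= mulr1.
  have h1 := @is_derive1_comp _ (horner p) _ x _ _ (is_derive_poly p _) hV.
  have hN := @is_deriveN _ _ _ _ _ _ _ hV.
  have h2 := @is_derive1_comp _ expR _ x _ _ (is_derive_expR _) hN.
  apply: (is_derive_eq (is_deriveM h1 h2)).
  rewrite /GRing.scale/= !(hornerE, hornerXn) exprVn.
  have -> : (- (fun s : R => s^-1)) x = - x^-1 by [].
  move: p.[x^-1] p^`().[x^-1] (expR (- x^-1)) (x ^- 2) => a b c e.
  rewrite -[LHS]/(a * c * - - e + c * b * - e); ring.
- have [K K0 Kb] := flat_le_sqr p.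
  have f0 : flat ('X^2 * (p - p^`())) 0 = 0 by rewrite /flat ltxx.
  rewrite f0.
  suff H : h^-1 *: (flat p (h *: 1 + 0) - flat p 0) @[h --> 0^'] --> (0 : R).
    by apply: DeriveDef; [apply/cvg_ex; exists 0|exact: cvg_lim H].
  apply/cvgrPdist_le => e e0; near=> h.
  have h0 : h != 0 by near: h; exact: nbhs_dnbhs_neq.
  rewrite {2}/flat ltxx subr0 addr0 sub0r normrN /GRing.scale/= mulr1 normrM normfV.
  rewrite mulrC ler_pdivrMr ?normr_gt0//; apply: (le_trans (Kb h)).
  rewrite -normr_id -[in leLHS](@ger0_norm _ (h ^+ 2)) ?sqr_ge0// normrX expr2 normr_id mulrA.
  rewrite ler_wpM2r//.
  have : `|h| <= e / (K + 1).
    by near: h; apply: dnbhs0_le; rewrite divr_gt0// ltr_wpDl.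
  rewrite ler_pdivlMr ?ltr_wpDl// => /(le_trans _); apply.
  by rewrite mulrC ler_wpM2l// lerDl.
Unshelve. all: by end_near. Qed.

Lemma smooth1_hfun : smooth1 hfun.
Proof.
exists [set f | exists p, f = flat p].
  move=> _ [p ->]; exists (flat ('X^2 * (p - p^`()))); first by eexists.
  by move=> x; exact: is_derive_flat.
by exists 1%:P; apply/funext => s; rewrite /flat /hfun hornerE mul1r.
Qed.

Lemma hfun_gt0 (s : R) : (0 < hfun s) = (0 < s).
Proof. by rewrite /hfun; case: ifPn => //; rewrite ?expR_gt0 ?ltxx. Qed.

Lemma hfun_ge0 (s : R) : 0 <= hfun s.
Proof. by rewrite /hfun; case: ifPn => //; rewrite expR_ge0. Qed.

Lemma hfun_le1 (s : R) : hfun s <= 1.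
Proof.
rewrite /hfun; case: ifPn => // s0.
by rewrite -[leRHS]expR0 ler_expR oppr_le0 invr_ge0 ltW.
Qed.

(* As [n] grows, these smooth functions increase to the indicator of
   [a < t < b]. *)
Definition bump (a b : R) (n : nat) (t : R) : R :=
  1 - (1 - hfun (t - a) * hfun (b - t)) ^+ n.

Lemma smooth1_bump a b n : smooth1 (bump a b n).
Proof.
have s1 : smooth1 (fun t => hfun (t - a)).
  have := smooth1_affine 1 (- a) smooth1_hfun.
  by congr smooth1; apply/funext => t; rewrite mul1r.
have s2 : smooth1 (fun t => hfun (b - t)).
  have := smooth1_affine (-1) b smooth1_hfun.
  by congr smooth1; apply/funext => t; rewrite mulN1r addrC.
have s3 := smooth1D (smooth1_cst 1) (smooth1Z (-1) (smooth1M s1 s2)).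
have := smooth1D (smooth1_cst 1) (smooth1Z (-1) (smooth1X n s3)).
by congr smooth1; apply/funext => t; rewrite /bump !mulN1r.
Qed.

Lemma bump_ge0_le1 a b n t : 0 <= bump a b n t <= 1.
Proof.
have p01 : 0 <= hfun (t - a) * hfun (b - t) <= 1.
  by rewrite mulr_ge0 ?hfun_ge0//= mulr_ile1 ?hfun_ge0 ?hfun_le1.
rewrite /bump subr_ge0 lerBlDr lerDl exprn_ge0 ?subr_ge0 ?andbT; last by lra.
by rewrite exprn_ile1//; lra.
Qed.

Lemma bump_out a b n t : ~ (a < t < b) -> bump a b n t = 0.
Proof.
move=> atb; rewrite /bump.
suff -> : hfun (t - a) * hfun (b - t) = 0 by rewrite subr0 expr1n subrr.
apply/eqP; rewrite mulf_eq0; apply: contra_notT atb; rewrite negb_or.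
rewrite !neq_lt !ltNge !hfun_ge0/= -!ltNge !hfun_gt0 !subr_gt0.
by move=> /andP[-> ->].
Qed.

Lemma bump_cvg a b t : bump a b n t @[n --> \oo] --> (\1_(`]a, b[) t : R).
Proof.
have [atb|atb] := boolP (a < t < b); last first.
  rewrite indicE memNset/=; last by rewrite in_itv/=; exact/negP.
  rewrite (_ : bump a b ^~ t = cst 0); first exact: cvg_cst.
  by apply/funext => n; rewrite bump_out//; exact/negP.
rewrite indicE mem_set/= ?in_itv//.
rewrite -[X in _ --> X]subr0; apply: cvgB; first exact: cvg_cst.
have /andP[at_ tb] := atb.
have p0 : 0 < hfun (t - a) * hfun (b - t) by rewrite mulr_gt0// hfun_gt0 subr_gt0.
have p1 : hfun (t - a) * hfun (b - t) <= 1.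
  by rewrite mulr_ile1 ?hfun_ge0 ?hfun_le1.
apply: cvg_expr; rewrite ger0_norm; lra.
Qed.

End SmoothLine.

(** * Partial derivatives along lines and tensor products *)

Section Lines.
Context {R : realType}.
Implicit Types (x : space3 R) (f g : space3 R -> R).

Definition upd3 (j : 'I_3) x (t : R) : space3 R :=
  (if j == 0 :> nat then t else x.1.1, if j == 1 :> nat then t else x.1.2,
   if j == 2 :> nat then t else x.2).

Lemma ord3P (Q : 'I_3 -> Prop) : Q 0 -> Q 1 -> Q 2 -> forall j, Q j.
Proof.
move=> Q0 Q1 Q2 [[|[|[|//]]] lt3].
- by rewrite (_ : Ordinal lt3 = 0)//; exact: val_inj.
- by rewrite (_ : Ordinal lt3 = 1)//; exact: val_inj.
- by rewrite (_ : Ordinal lt3 = 2)//; exact: val_inj.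
Qed.

Lemma xcoordE x : (xcoord x 0 = x.1.1) * (xcoord x 1 = x.1.2) * (xcoord x 2 = x.2).
Proof. by rewrite /xcoord !(tnth_nth 0). Qed.

Lemma upd3_id j x : upd3 j x (xcoord x j) = x.
Proof. by move: j; apply: ord3P; rewrite /upd3/= !xcoordE; case: x => [[]]. Qed.

Lemma basis_vec_shift j x h : h *: basis_vec j + x = upd3 j x (h + xcoord x j).
Proof.
move: j; apply: ord3P; rewrite /upd3 /basis_vec/= !xcoordE; case: x => [[a b] c];
by congr (_, _, _); rewrite /= /GRing.scale/= ?mulr1 ?mulr0 ?add0r.
Qed.

Lemma growth_rate_line j f x :
  (fun h => h^-1 *: ((f \o shift x) (h *: basis_vec j) - f x)) =
  (fun h => h^-1 *: (((fun t => f (upd3 j x t)) \o shift (xcoord x j)) (h *: 1)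
      - (fun t => f (upd3 j x t)) (xcoord x j))).
Proof.
by apply/funext => h; rewrite /= basis_vec_shift upd3_id /GRing.scale/= mulr1.
Qed.

Lemma is_derive_line j f x d :
  is_derive x (basis_vec j) f d <->
  is_derive (xcoord x j) 1 (fun t => f (upd3 j x t)) d.
Proof.
by split=> -[]; rewrite /derivable /derive ?growth_rate_line => h1 h2; apply: DeriveDef;
  rewrite /derivable /derive ?growth_rate_line.
Qed.

Definition tensor3 (a b c : R -> R) : space3 R -> R :=
  fun x => a x.1.1 * b x.1.2 * c x.2.

Lemma is_derive_tensor3 j (a b c a' b' c' : R -> R) x :
  (forall t : R, is_derive t 1 a (a' t)) -> (forall t : R, is_derive t 1 b (b' t)) ->
  (forall t : R, is_derive t 1 c (c' t)) ->
  is_derive x (basis_vec j) (tensor3 a b c)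
    (tensor3 (if j == 0 :> nat then a' else a) (if j == 1 :> nat then b' else b)
       (if j == 2 :> nat then c' else c) x).
Proof.
move=> aa' bb' cc'; apply/is_derive_line; move: j; apply: ord3P;
rewrite /tensor3/= !xcoordE /=.
- have := is_deriveZ (b x.1.2 * c x.2) (aa' x.1.1).
  rewrite (_ : _ \*: _ = fun t => a t * b x.1.2 * c x.2).
    by move/is_derive_eq; apply; exact: (esym (etrans (esym (mulrA _ _ _)) (mulrC _ _))).
  by apply/funext => t; exact: (esym (etrans (esym (mulrA _ _ _)) (mulrC _ _))).
- have := is_deriveZ (a x.1.1 * c x.2) (bb' x.1.2).
  rewrite (_ : _ \*: _ = fun t => a x.1.1 * b t * c x.2).
    by move/is_derive_eq; apply; exact: mulrAC.
  by apply/funext => t; exact: mulrAC.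
- have := is_deriveZ (a x.1.1 * b x.1.2) (cc' x.2).
  by move/is_derive_eq; apply.
Qed.

(** Every iterated derivative of a tensor product is again a tensor product of smooth functions of
    one variable, so continuity and derivability are checked on tensor products only. *)
Lemma smooth_tensor3 a b c : smooth1 a -> smooth1 b -> smooth1 c ->
  smooth (tensor3 a b c).
Proof.
move=> sa sb sc s.
have [a1 [b1 [c1 [sa1 sb1 sc1 ->]]]] : exists a1 b1 c1, [/\ smooth1 a1, smooth1 b1,
    smooth1 c1 & iter_pderiv s (tensor3 a b c) = tensor3 a1 b1 c1].
  elim: s => [|j s [a1 [b1 [c1 [sa1 sb1 sc1 E]]]]]; first by exists a, b, c.
  have [a' sa' aa'] := smooth1_derive sa1; have [b' sb' bb'] := smooth1_derive sb1.
  have [c' sc' cc'] := smooth1_derive sc1.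
  exists (if j == 0 :> nat then a' else a1), (if j == 1 :> nat then b' else b1),
     (if j == 2 :> nat then c' else c1).
  split; [by case: ifP|by case: ifP|by case: ifP|].
  apply/funext => x; rewrite /= E /pderiv.
  by have [_ ->] := is_derive_tensor3 j x aa' bb' cc'.
split.
  move=> x; apply: cvgM; first apply: cvgM.
  - apply: (@cvg_comp _ _ _ (fun x : space3 R => x.1.1) a1); last exact: smooth1_continuous.
    by apply: (@cvg_comp _ _ _ fst fst); exact: cvg_fst.
  - apply: (@cvg_comp _ _ _ (fun x : space3 R => x.1.2) b1); last exact: smooth1_continuous.
    by apply: (@cvg_comp _ _ _ fst snd); [exact: cvg_fst|exact: cvg_snd].
  - apply: (@cvg_comp _ _ _ (fun x : space3 R => x.2) c1); last exact: smooth1_continuous.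
    exact: cvg_snd.
move=> j x.
have [a' _ aa'] := smooth1_derive sa1; have [b' _ bb'] := smooth1_derive sb1.
have [c' _ cc'] := smooth1_derive sc1.
by have [] := is_derive_tensor3 j x aa' bb' cc'.
Qed.

Lemma compact_box3 (a a' b b' c c' : R) :
  compact (oprod3 `[a, a'] `[b, b'] `[c, c'] : set (space3 R)).
Proof.
by apply: compact_setX; [apply: compact_setX|]; exact: segment_compact.
Qed.

Lemma test_function_bump D (a a' b b' c c' : R) n :
  oprod3 `[a, a'] `[b, b'] `[c, c'] `<=` D ->
  test_function D (tensor3 (bump a a' n) (bump b b' n) (bump c c' n)).
Proof.
move=> QD; split; first by apply: smooth_tensor3; exact: smooth1_bump.
exists (oprod3 `[a, a'] `[b, b'] `[c, c']); split => //; first exact: compact_box3.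
move=> x Qx; apply/eqP; rewrite /tensor3 !mulf_eq0.
apply: contra_notT Qx; rewrite !negb_or => /andP[/andP[ha hb] hc].
have inI l u t : bump l u n t != 0 -> l <= t <= u.
  apply: contra_neqT => /negP tlu; apply: bump_out; apply: contra_not tlu.
  by move=> /andP[/ltW -> /ltW ->].
by split; [split|]; rewrite /= in_itv/=; exact: inI.
Qed.

End Lines.

Section InducedMeasure.
Local Open Scope ereal_scope.
Context d (T : measurableType d) (R : realType) (mu : {measure set T -> \bar R}).
Variables (f : T -> \bar R) (mf : measurable_fun setT f) (f0 : forall x, 0 <= f x).

(** The two proofs are arguments of the definition, so that the measure structure declared below can
    be inferred from the term. *)
Definition induced_measure of measurable_fun setT f & (forall x, 0 <= f x) :=
  fun A : set T => \int[mu]_(x in A) f x.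

Let induced0 : induced_measure mf f0 set0 = 0.
Proof. by rewrite /induced_measure integral_set0. Qed.

Let induced_ge0 A : 0 <= induced_measure mf f0 A.
Proof. by apply: integral_ge0 => *; exact: f0. Qed.

HB.instance Definition _ := isMeasure.Build _ _ _ (induced_measure mf f0)
  induced0 induced_ge0 (semi_sigma_additive_nng_induced mf f0).

Definition nng_measure : {measure set T -> \bar R} := induced_measure mf f0.

End InducedMeasure.

(** * The du Bois-Reymond lemma *)

Section DuBoisReymond.
Context {R : realType}.
Local Notation mR := (measurableTypeR R).
Implicit Types D : set (space3 R).

Definition open_boxes : set (set (mspace3 R)) :=
  [set A | exists a a' b b' c c', A = oprod3 `]a, a'[ `]b, b'[ `]c, c'[].

Lemma oo_boxI (a a' b b' c c' x x' y y' z z' : R) :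
  oprod3 `]a, a'[ `]b, b'[ `]c, c'[ `&` oprod3 `]x, x'[ `]y, y'[ `]z, z'[ =
  oprod3 `]Num.max a x, Num.min a' x'[ `]Num.max b y, Num.min b' y'[
         `]Num.max c z, Num.min c' z'[.
Proof.
have itvI (r r' s s' : R) : `]r, r'[%classic `&` `]s, s'[%classic =
    `]Num.max r s, Num.min r' s'[%classic.
  apply/seteqP; split => t /=; rewrite !in_itv/= gt_max lt_min.
    by move=> [/andP[-> ->] /andP[-> ->]].
  by move=> /andP[/andP[-> ->] /andP[-> ->]].
by rewrite /oprod3 -!setXI !itvI.
Qed.

Lemma open_boxes_setI : setI_closed open_boxes.
Proof.
move=> _ _ [a [a' [b [b' [c [c' ->]]]]]] [x [x' [y [y' [z [z' ->]]]]]].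
by rewrite oo_boxI; do 6 eexists.
Qed.

Lemma open_boxes_cover :
  \bigcup_n (oprod3 `]- n%:R, n%:R[ `]- n%:R, n%:R[ `]- n%:R, n%:R[ : set (mspace3 R))
    = setT.
Proof.
rewrite -subTset => -[[a b] c] _.
have [n nabc] : exists n : nat, `|a| + `|b| + `|c| < n%:R.
  by exists (Num.truncn (`|a| + `|b| + `|c|)).+1; rewrite truncnS_gt.
exists n => //.
have := normr_ge0 a; have := normr_ge0 b; have := normr_ge0 c => ? ? ?.
by split; [split|]; rewrite /= in_itv/= -ltr_norml; lra.
Qed.

(** The preimage of an interval under a coordinate is an unbounded slab, hence a countable union of
    boxes that exhaust the other two axes. So the coordinates are measurable for the sigma-algebra
    generated by the boxes. *)
Lemma measurable_open_boxes :
  @measurable _ (mspace3 R) = <<s open_boxes >>.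
Proof.
apply/seteqP; split; last first.
  apply: smallest_sub; first exact: sigma_algebra_measurable.
  move=> _ [a [a' [b [b' [c [c' ->]]]]]].
  by apply: measurable_oprod3; exact: measurable_itv.
pose T := g_sigma_algebraType open_boxes.
have slab (p : T -> mR) : (forall x y, exists F : nat -> set T,
    (forall n, open_boxes (F n)) /\ p @^-1` `]x, y[ = \bigcup_n F n) ->
    measurable_fun setT p.
  move=> slabF; apply: (measurability _ (RGenOpens.measurableE R)).
  move=> _ [_ [x [y ->]] <-]; have [F [FO ->]] := slabF x y.
  rewrite setTI; apply: bigcupT_measurable => n.
  by apply: sub_sigma_algebra; exact: FO.
have cov (t : R) : exists n : nat, `|t| < n%:R.
  by exists (Num.truncn `|t|).+1; rewrite truncnS_gt.
have cov2 (s t : R) : exists n : nat, - n%:R < s < n%:R /\ - n%:R < t < n%:R.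
  have [n nst] := cov (`|s| + `|t|); exists n; rewrite -!ltr_norml.
  have := normr_ge0 s; have := normr_ge0 t => ? ?.
  by move: nst; rewrite ger0_norm ?addr_ge0// => ?; split; lra.
have mid : measurable_fun setT (fun x : T => (x : mspace3 R)).
  rewrite (_ : (fun x : T => _) = (fun x : T => ((x.1.1, x.1.2), x.2))); last first.
    by apply/funext => -[[]].
  apply: measurable_fun_pair; first apply: measurable_fun_pair.
  - apply: slab => x y.
    exists (fun n => oprod3 `]x, y[ `]- n%:R, n%:R[ `]- n%:R, n%:R[); split.
      by move=> n; do 6 eexists.
    apply/seteqP; split => [[[a b] c] /= abc|[[a b] c] /= [n _ [[]]]//].
    have [n [nb nc]] := cov2 b c.
    by exists n.
  - apply: slab => x y.
    exists (fun n => oprod3 `]- n%:R, n%:R[ `]x, y[ `]- n%:R, n%:R[); split.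
      by move=> n; do 6 eexists.
    apply/seteqP; split => [[[a b] c] /= abc|[[a b] c] /= [n _ [[]]]//].
    have [n [nb nc]] := cov2 a c.
    by exists n.
  - apply: slab => x y.
    exists (fun n => oprod3 `]- n%:R, n%:R[ `]- n%:R, n%:R[ `]x, y[); split.
      by move=> n; do 6 eexists.
    apply/seteqP; split => [[[a b] c] /= abc|[[a b] c] /= [n _ [[]]]//].
    have [n [nb nc]] := cov2 a b.
    by exists n.
move=> A mA.
by have := mid measurableT A mA; rewrite setTI.
Qed.

(* The measures of densities [f^+] and [f^-] agree on the pi-system of open boxes. *)
Lemma integral_open_boxes_ae0 (f : mspace3 R -> \bar R) :
  (@volume R).-integrable setT f ->
  (forall A, open_boxes A -> \int[@volume R]_(x in A) f x = 0)%E ->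
  ae_eq (@volume R) setT f (cst 0%E).
Proof.
move=> intf f0.
have mf := measurable_int _ intf.
have mp : measurable_fun setT (f^\+)%E by exact: measurable_funepos.
have mn : measurable_fun setT (f^\-)%E by exact: measurable_funeneg.
pose nup := nng_measure (@volume R) mp (funepos_ge0 f).
pose nun := nng_measure (@volume R) mn (funeneg_ge0 f).
have mbox A : open_boxes A -> measurable A.
  by move=> ?; rewrite measurable_open_boxes; exact: sub_sigma_algebra.
have intp A : measurable A -> (\int[@volume R]_(x in A) (f^\+ x) \is a fin_num)%E.
  move=> mA; apply: integrable_fin_num => //.
  by apply: (integrableS measurableT) => //; exact: integrable_funepos.
have intn A : measurable A -> (\int[@volume R]_(x in A) (f^\- x) \is a fin_num)%E.
  move=> mA; apply: integrable_fin_num => //.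
  by apply: (integrableS measurableT) => //; exact: integrable_funeneg.
have eqm : forall A, measurable A -> nup A = nun A.
  apply: (@measure_unique _ _ _ open_boxes
    (fun n => oprod3 `]- n%:R, n%:R[ `]- n%:R, n%:R[ `]- n%:R, n%:R[)).
  - exact: measurable_open_boxes.
  - exact: open_boxes_setI.
  - by move=> n; do 6 eexists.
  - exact: open_boxes_cover.
  - move=> A oA; rewrite /nup /nun/= /induced_measure.
    have fsub : forall a b : \bar R, (a \is a fin_num -> b \is a fin_num ->
        a - b = 0 -> a = b)%E.
      by move=> [a| |] [b| |]//= _ _ [/subr0_eq ->].
    have HA := mbox A oA.
    apply: fsub; [exact: (intp A HA)|exact: (intn A HA)|].
    by rewrite -integralE; exact: f0.
  - move=> n; rewrite -ge0_fin_numE; last by apply: integral_ge0 => x _; exact: funepos_ge0.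
    by apply: intp; apply: mbox; do 6 eexists.
apply: integral_ae_eq => //.
move=> E _ mE; rewrite integral_cst// mul0e integralE.
have := eqm E mE; rewrite /nup /nun/= /induced_measure => ->.
by rewrite subee//; exact: intn.
Qed.

Lemma test_function_continuous D (f : space3 R -> R) :
  test_function D f -> continuous f.
Proof. by case=> sf _; have [] := sf [::]. Qed.

(** Tensor products of bumps converge pointwise to the indicator of the open box and stay between 0
    and 1. The integrals against them vanish, and dominated convergence with majorant [g] passes to
    the limit. *)
Lemma integral_test_box D (g : space3 R -> R) (a a' b b' c c' : R) : open D ->
  (@volume R).-integrable D (EFin \o g) ->
  (forall phi, test_function D phi -> \int[@volume R]_(x in D) (g x * phi x) = 0) ->
  oprod3 `[a, a'] `[b, b'] `[c, c'] `<=` D ->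
  (\int[@volume R]_(x in oprod3 `]a, a'[ `]b, b'[ `]c, c'[) (g x)%:E = 0)%E.
Proof.
move=> oD intg gphi QD.
have mD := open_measurable3 oD.
pose Q : set (mspace3 R) := oprod3 `]a, a'[ `]b, b'[ `]c, c'[.
have mQ : measurable Q by apply: measurable_oprod3; exact: measurable_itv.
have QoD : Q `<=` D.
  move=> x [[]]; rewrite /= !in_itv/= => /andP[/ltW ? /ltW ?] /andP[/ltW ? /ltW ?] /andP[/ltW ? /ltW ?].
  by apply: QD; split; [split|]; rewrite /= in_itv/=; apply/andP; split.
pose phi n : space3 R -> R := tensor3 (bump a a' n) (bump b b' n) (bump c c' n).
have phi01 n x : `|phi n x| <= 1.
  have /andP[? ?] := bump_ge0_le1 a a' n x.1.1.
  have /andP[? ?] := bump_ge0_le1 b b' n x.1.2.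
  have /andP[? ?] := bump_ge0_le1 c c' n x.2.
  by rewrite ger0_norm ?mulr_ge0// /phi /tensor3 !mulr_ile1 ?mulr_ge0.
have tphi n : test_function D (phi n) by exact: test_function_bump.
have mphi n : measurable_fun [set: mspace3 R] (phi n).
  by apply: continuous_measurable3; exact: test_function_continuous (tphi n).
have mg : measurable_fun (D : set (mspace3 R)) g.
  by apply/measurable_EFinP; exact: measurable_int intg.
have intphi n : (@volume R).-integrable D (EFin \o (fun x => g x * phi n x)).
  apply: (le_integrable mD _ _ intg).
    apply/measurable_EFinP/measurable_funM => //; exact: measurable_funTS.
  move=> x _; rewrite /= lee_fin normrM.  by rewrite ler_piMr.
pose f_ (n : nat) (x : mspace3 R) := (g x * phi n x)%:E.
pose f (x : mspace3 R) := (g x * \1_Q x)%:E.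
have mf_ n : measurable_fun D (f_ n) by exact: measurable_int (intphi n).
have mf : measurable_fun D f.
  by apply/measurable_EFinP/measurable_funM.
have f_f : {ae @volume R, forall x, D x -> f_ ^~ x @ \oo --> f x}.
  apply: aeW => x Dx; apply: cvg_EFin; first by near=> n.
  apply: cvgM; first exact: cvg_cst.
  rewrite (_ : \1_Q x = \1_(`]a, a'[) x.1.1 * \1_(`]b, b'[) x.1.2 * \1_(`]c, c'[) x.2).
    by apply: cvgM; [apply: cvgM|]; exact: bump_cvg.
  by rewrite /Q /oprod3 !indicE !in_setX -!natrM !mulnb.
have f_g : {ae @volume R, forall x n, D x -> (`|f_ n x| <= `|(EFin \o g) x|)%E}.
  by apply: aeW => x n Dx; rewrite /f_ /= lee_fin/= normrM ler_piMr.
have [_ _] := dominated_convergence mD mf_ mf f_f (integrable_abse intg) f_g.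
rewrite (_ : [sequence _]_n = cst 0%E); last first.
  apply/funext => n; rewrite /= -[LHS]fineK; last exact: (integrable_fin_num mD (intphi n)).
  by have := gphi _ (tphi n); rewrite /Rintegral => ->.
move=> /(cvg_unique (@ereal_hausdorff R) (cvg_cst _)) lim0.
rewrite -[X in integral _ X _](setIidr QoD) integral_mkcondr lim0.
apply: eq_integral => x _; rewrite patchE /f indicE.
by case: ifPn => _; rewrite ?mulr1 ?mulr0.
Unshelve. all: by end_near. Qed.

Lemma du_bois_reymond D (g : space3 R -> R) : open D ->
  (@volume R).-integrable D (EFin \o g) ->
  (forall phi, test_function D phi -> \int[@volume R]_(x in D) (g x * phi x) = 0) ->
  {ae @volume R, forall x : mspace3 R, D x -> g x = 0}.
Proof.
move=> oD intg gphi; have mD := open_measurable3 oD.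
have aebox q : rat_cbox q `<=` D ->
    {ae @volume R, forall x : mspace3 R, rat_box q x -> g x = 0}.
  move=> qD.
  have mq : measurable (rat_box q : set (mspace3 R)).
    by apply: measurable_oprod3; exact: measurable_itv.
  have qD' : rat_box q `<=` D.
    by rewrite [D](open_rat_cover oD) => x qx; exists q.
  have intq : (@volume R).-integrable setT ((EFin \o g) \_ (rat_box q)).
    by apply/(integrable_mkcond _ mq); exact: integrableS intg.
  have := integral_open_boxes_ae0 intq.
  have int0 A : open_boxes A ->
      (\int[@volume R]_(x in A) ((EFin \o g) \_ (rat_box q)) x = 0)%E.
    move=> oA; rewrite -integral_mkcondr.
    have [a [a' [b [b' [c [c' ->]]]]]] := oA.
    (* The intersection of the two boxes is a box whose closed version stays within [rat_cbox q],
       hence within [D]. *)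
    rewrite oo_boxI; apply: (integral_test_box oD intg gphi) => y [[]].
    rewrite /= !in_itv/= !ge_max !le_min.
    move=> /andP[/andP[_ ?] /andP[_ ?]] /andP[/andP[_ ?] /andP[_ ?]].
    move=> /andP[/andP[_ ?] /andP[_ ?]].
    by apply: qD; split; [split|]; rewrite /= in_itv/=; apply/andP; split.
  move=> /(_ int0); apply: filterS => x /(_ I) + qx.
  by rewrite patchE mem_set// => -[].
have : {ae @volume R, forall x : mspace3 R,
    forall q, rat_cbox q `<=` D -> rat_box q x -> g x = 0}.
  (* Null sets are united over natural numbers, so the rational boxes are enumerated through
     [unpickle]. *)
  have : {ae @volume R, forall x : mspace3 R, forall n q, unpickle n = Some q ->
      rat_cbox q `<=` D -> rat_box q x -> g x = 0}.
    apply: ae_foralln => n.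
    have [[q [nq qD]]|nex] :=
        pselect (exists q, unpickle n = Some q /\ rat_cbox q `<=` D); last first.
      by apply: aeW => x q nq qD; exfalso; apply: nex; exists q.
    by apply: filterS (aebox q qD) => x qx q'; rewrite nq => -[<-].
  by apply: filterS => x H q qD qx; apply: (H _ _ (pickleK q)).
move=> H; apply: filterS H => x H; rewrite {1}(open_rat_cover oD) => -[q qD qx].
exact: H qD qx.
Qed.

End DuBoisReymond.

(** * Test functions and integration by parts *)

Section TestCalculus.
Context {R : realType}.
Local Notation mR := (measurableTypeR R).
Implicit Types (x : space3 R) (f g : space3 R -> R) (D : set (space3 R)).

Lemma is_derive_along f (v x : space3 R) (t d : R) :
  is_derive (t *: v + x) v f d -> is_derive t 1 (fun s : R => f (s *: v + x)) d.
Proof.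
have E : (fun h : R => h^-1 *: ((f \o shift (t *: v + x)) (h *: v) - f (t *: v + x))) =
    (fun h => h^-1 *: (((fun s : R => f (s *: v + x)) \o shift t) (h *: 1)
      - (fun s : R => f (s *: v + x)) t)).
  apply/funext => h; have h1 : h *: (1 : R) = h by rewrite /GRing.scale/= mulr1.
  by rewrite /= addrA -scalerDl h1.
move=> -[]; rewrite /derivable /derive E => h1 h2.
by apply: DeriveDef; rewrite /derivable /derive.
Qed.

Lemma smooth_pderiv f j : smooth f -> smooth (pderiv j f).
Proof.
move=> sf s.
suff -> : iter_pderiv s (pderiv j f) = iter_pderiv (rcons s j) f by exact: sf.
by rewrite /iter_pderiv foldr_rcons.
Qed.

Lemma smooth_continuous f : smooth f -> continuous f.
Proof. by move=> sf; have [] := sf [::]. Qed.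

Lemma smooth_is_derive f j x : smooth f -> is_derive x (basis_vec j) f (pderiv j f x).
Proof. by move=> sf; have [_ /(_ j x)] := sf [::]; exact: derivableP. Qed.

Lemma pderivD f g j : smooth f -> smooth g ->
  pderiv j (f \+ g) = pderiv j f \+ pderiv j g.
Proof.
move=> sf sg; apply/funext => x.
by have [_ H] := is_deriveD (smooth_is_derive j x sf) (smooth_is_derive j x sg).
Qed.

Lemma pderivZ k f j : smooth f -> pderiv j (k \*o f) = k \*o pderiv j f.
Proof.
move=> sf; apply/funext => x.
by have [_ H] := is_deriveZ k (smooth_is_derive j x sf).
Qed.

Lemma smoothD f g : smooth f -> smooth g -> smooth (f \+ g).
Proof.
move=> sf sg s.
have -> : iter_pderiv s (f \+ g) = iter_pderiv s f \+ iter_pderiv s g.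
  elim/last_ind: s f g sf sg => [//|s j IH] f g sf sg.
  by rewrite /iter_pderiv !foldr_rcons pderivD//; apply: IH; exact: smooth_pderiv.
have [cf df] := sf s; have [cg dg] := sg s; split.
  by move=> x; apply: cvgD; [exact: cf|exact: cg].
by move=> j x; apply: derivableD; [exact: df|exact: dg].
Qed.

Lemma smoothZ k f : smooth f -> smooth (k \*o f).
Proof.
move=> sf s.
have -> : iter_pderiv s (k \*o f) = k \*o iter_pderiv s f.
  elim/last_ind: s f sf => [//|s j IH] f sf.
  by rewrite /iter_pderiv !foldr_rcons pderivZ//; apply: IH; exact: smooth_pderiv.
have [cf df] := sf s; split.
  by move=> x; apply: cvgM; [exact: cvg_cst|exact: cf].
by move=> j x; apply: derivableZ; exact: df.
Qed.

Lemma smooth0 : smooth (fun=> 0 : R).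
Proof.
move=> s; have -> : iter_pderiv s (fun=> 0) = fun=> 0 :> R.
  elim: s => [//|j s /= ->]; apply/funext => x.
  exact: derive_cst.
by split=> [x|j x]; [exact: cvg_cst|exact: derivable_cst].
Qed.

Lemma test_function_pderiv D f j : test_function D f -> test_function D (pderiv j f).
Proof.
move=> [sf [K [cK KD fK]]]; split; first exact: smooth_pderiv.
exists K; split => // x nKx.
have cl : closed K by apply: compact_closed => //; exact: norm_hausdorff.
have nx : {near x, cst 0 =1 f}.
  have : nbhs x (~` K) by apply: open_nbhs_nbhs; split => //; exact: closed_openC.
  by apply: filterS => y nKy; rewrite fK.
rewrite /pderiv -(near_eq_derive _ nx) ?derive_cst//.
Qed.

Lemma test_functionD D f g : test_function D f -> test_function D g ->
  test_function D (f \+ g).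
Proof.
move=> [sf [K [cK KD fK]]] [sg [L [cL LD gL]]]; split; first exact: smoothD.
exists (K `|` L); split; [exact: compactU|by move=> x [/KD|/LD]|].
by move=> x /not_orP[nK nL]; rewrite /= fK// gL// addr0.
Qed.

Lemma test_functionZ D k f : test_function D f -> test_function D (k \*o f).
Proof.
move=> [sf [K [cK KD fK]]]; split; first exact: smoothZ.
by exists K; split => // x nK; rewrite /= fK// mulr0.
Qed.

Lemma test_function0 D : test_function D (fun=> 0 : R).
Proof. by split; [exact: smooth0|exists set0; split => //; exact: compact0]. Qed.

(* Clairaut: compare the second difference quotient in both orders. *)
Lemma pderivC f i j : smooth f -> pderiv i (pderiv j f) = pderiv j (pderiv i f).
Proof.
move=> sf; apply/funext => x; apply/eqP; rewrite -subr_eq0 -normr_le0.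
apply/ler_addgt0Pr => e e0; rewrite add0r.
set A := pderiv i (pderiv j f); set B := pderiv j (pderiv i f).
have near_x g : smooth g -> exists2 d : R, 0 < d & forall s t : R,
    0 <= s <= d -> 0 <= t <= d ->
    `|g (s *: basis_vec i + (t *: basis_vec j + x)) - g x| < e / 2.
  move=> /smooth_continuous/(_ x)/cvgrPdist_lt/(_ (e / 2)) H; move: H.
  have e20 : 0 < e / 2 by rewrite divr_gt0.
  move=> /(_ e20)/nbhs_ballP[r /= r0 rg].
  exists (r / 3); first by rewrite divr_gt0.
  move=> s t /andP[s0 sd] /andP[t0 td]; rewrite distrC; apply: rg.
  have bv (l : 'I_3) (k : nat) : 0 <= ((l == k :> nat)%:R : R) <= 1.
    by rewrite ler0n lern1 leq_b1.
  have ineq (y p q : R) : 0 <= p <= 1 -> 0 <= q <= 1 -> ball y r (s * p + (t * q + y)).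
    move=> /andP[p0 p1] /andP[q0 q1]; rewrite /ball/= ltr_norml.
    have : 0 <= s * p <= r / 3 by rewrite mulr_ge0//= (le_trans _ sd)// ler_piMr.
    have : 0 <= t * q <= r / 3 by rewrite mulr_ge0//= (le_trans _ td)// ler_piMr.
    by move=> /andP[? ?] /andP[? ?]; apply/andP; split; lra.
  split; [split|].
  - exact: (ineq x.1.1 _ _ (bv i 0%N) (bv j 0%N)).
  - exact: (ineq x.1.2 _ _ (bv i 1%N) (bv j 1%N)).
  - exact: (ineq x.2 _ _ (bv i 2%N) (bv j 2%N)).
have sA : smooth A by do 2 apply: smooth_pderiv.
have sB : smooth B by do 2 apply: smooth_pderiv.
have [d1 d10 nA] := near_x A sA; have [d2 d20 nB] := near_x B sB.
pose d := Num.min d1 d2.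
have d0 : 0 < d by rewrite lt_min d10.
pose ei : space3 R := basis_vec i; pose ej : space3 R := basis_vec j.
pose F (s t : R) := f (s *: ei + (t *: ej + x)).
have swap (s t : R) : s *: ei + (t *: ej + x) = t *: ej + (s *: ei + x) by rewrite addrCA.
have der1 g k (y : space3 R) (t : R) : smooth g ->
    is_derive t 1 (fun s : R => g (s *: basis_vec k + y)) (pderiv k g (t *: basis_vec k + y)).
  by move=> sg; apply: is_derive_along; exact: smooth_is_derive.
have mvt (h h' : R -> R) : (forall t : R, is_derive t 1 h (h' t)) ->
    exists2 c, 0 <= c <= d & h d - h 0 = h' c * d.
  move=> hh'.
  have hd (t : R) : t \in `]0, d[ -> is_derive t 1 h (h' t) by move=> _; exact: hh'.
  have hc : {within `[0, d], continuous h}.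
    apply: continuous_subspaceT => t.
    by apply/differentiable_continuous/derivable1_diffP; case: (hh' t).
  have [c] := MVT d0 hd hc.
  rewrite in_itv/= subr0 => /andP[c0 cd] ->; exists c => //.
  by rewrite (ltW c0) (ltW cd).
have [c1 c1d E1] := mvt (fun s => F s d - F s 0)
  (fun s => pderiv i f (s *: ei + (d *: ej + x)) - pderiv i f (s *: ei + (0 *: ej + x)))
  (fun s => is_deriveB (der1 f i _ s sf) (der1 f i _ s sf)).
have [c2 c2d E2] := mvt (fun t => pderiv i f (t *: ej + (c1 *: ei + x)))
  (fun t => B (t *: ej + (c1 *: ei + x)))
  (fun t => der1 (pderiv i f) j _ t (smooth_pderiv i sf)).
have [c3 c3d E3] := mvt (fun t => f (t *: ej + (d *: ei + x)) - f (t *: ej + (0 *: ei + x)))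
  (fun t => pderiv j f (t *: ej + (d *: ei + x)) - pderiv j f (t *: ej + (0 *: ei + x)))
  (fun t => is_deriveB (der1 f j _ t sf) (der1 f j _ t sf)).
have [c4 c4d E4] := mvt (fun s => pderiv j f (s *: ei + (c3 *: ej + x)))
  (fun s => A (s *: ei + (c3 *: ej + x)))
  (fun s => der1 (pderiv j f) i _ s (smooth_pderiv j sf)).
have EA : F d d - F d 0 - (F 0 d - F 0 0) = A (c4 *: ei + (c3 *: ej + x)) * d * d.
  by rewrite -E4 !(swap _ c3) -E3 /F !swap; ring.
have EB : F d d - F d 0 - (F 0 d - F 0 0) = B (c1 *: ei + (c2 *: ej + x)) * d * d.
  by rewrite E1 (swap c1 c2) -E2 !swap.
have mulI2 (a b : R) : a * d * d = b * d * d -> a = b.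
  by rewrite -!mulrA; apply: mulIf; rewrite mulf_neq0 ?gt_eqF.
have AB := mulI2 _ _ (etrans (esym EA) EB).
clearbody A B.
have le_d c : 0 <= c <= d -> 0 <= c <= d1 /\ 0 <= c <= d2.
  by move=> /andP[-> /=]; rewrite le_min => /andP[-> ->].
have := nA _ _ (le_d _ c4d).1 (le_d _ c3d).1; rewrite AB => hA.
have := nB _ _ (le_d _ c1d).2 (le_d _ c2d).2 => hB.
have -> : A x - B x = (B (c1 *: ei + (c2 *: ej + x)) - B x) -
   (B (c1 *: ei + (c2 *: ej + x)) - A x) by ring.
apply: (le_trans (ler_normB _ _)).
by apply: (le_trans (ltW (ltrD hB hA))); rewrite -splitr ?add0r.
Qed.

End TestCalculus.

(** * Integration by parts with a weight constant along the direction *)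

Section IntegrationByParts.
Context {R : realType}.
Local Notation mR := (measurableTypeR R).
Implicit Types (x : space3 R) (f g F : space3 R -> R) (D : set (space3 R)).

Definition cube (M : R) : set (space3 R) := oprod3 `[- M, M] `[- M, M] `[- M, M].

Lemma cubeP M x : cube M x <-> forall j, `|xcoord x j| <= M.
Proof.
split=> [[[]]|H].
  rewrite /= !in_itv/= => H1 H2 H3; apply: ord3P; rewrite !xcoordE ler_norml//.
have := H 0; have := H 1; have := H 2; rewrite !xcoordE !ler_norml => H1 H2 H3.
by split; [split|]; rewrite /= in_itv.
Qed.

Lemma integral_derive_line (phi phi' : R -> R) (M : R) :
  (forall t : R, is_derive t 1 phi (phi' t)) -> continuous phi' ->
  (forall t, M < `|t| -> phi t = 0) -> (\int[leb]_t (phi' t)%:E = 0)%E.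
Proof.
move=> dphi cphi' phi0.
pose N := Num.max M 0 + 1.
have N0 : 0 < N by rewrite ltr_pwDr// le_max lexx orbT.
have MN : M < N by rewrite ltr_pwDr// le_max lexx.
have phi'0 t : N < `|t| -> phi' t = 0.
  move=> Nt; have [_ <-] := dphi t.
  have nt : {near t, cst 0 =1 phi}.
    have : nbhs t [set s | N < `|s|].
      apply: (@open_nbhs_nbhs _ t); split => //.
      apply: (@open_comp _ _ (fun s : R => `|s|) [set s | N < s]); last exact: open_gt.
      by move=> s _; exact: norm_continuous.
    by apply: filterS => s Ns; rewrite phi0// (lt_trans MN).
  by rewrite -(near_eq_derive _ nt) derive_cst.
have mphi' : measurable_fun setT phi' by exact: continuous_measurable_fun.
pose I : set R := `[- N, N]%classic.
rewrite (_ : integral _ _ _ = \int[leb]_(t in I) (phi' t)%:E)%E; last first.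
  rewrite [RHS]integral_mkcond; apply: eq_integral => t _; rewrite patchE.
  case: ifPn => // /negP tN; rewrite phi'0// ltNge; apply/negP => tN'.
  by apply: tN; rewrite inE/= /I/= in_itv/= -ler_norml.
have cphi : continuous phi.
  by move=> t; apply/differentiable_continuous/derivable1_diffP; case: (dphi t).
rewrite /I (@continuous_FTC2 _ phi' phi)//.
- by rewrite !phi0 ?normrN ?gtr0_norm// subee.
- by lra.
- exact: continuous_subspaceT.
- split; [by move=> t _; case: (dphi t)| |].
  + by apply: cvg_at_right_filter; exact: cphi.
  + by apply: cvg_at_left_filter; exact: cphi.
- by move=> t _; rewrite derive1E; case: (dphi t).
Qed.

Lemma cube_bounded F M : continuous F -> (forall x, ~ cube M x -> F x = 0) ->
  exists2 K, 0 <= K & forall x, `|F x| <= K.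
Proof.
move=> cF F0.
have : compact (F @` cube M).
  apply: continuous_compact; last exact: compact_box3.
  exact: continuous_subspaceT.
move=> /compact_bounded[K [_ KF]].
exists (Num.max K 0 + 1); first by rewrite addr_ge0// le_max lexx orbT.
move=> x; have [cx|ncx] := pselect (cube M x); last first.
  by rewrite F0// normr0 addr_ge0// le_max lexx orbT.
by apply: KF; [rewrite ltr_pwDr// le_max lexx|exists x].
Qed.

Lemma measurable_cube M : measurable (cube M : set (mspace3 R)).
Proof. by apply: measurable_oprod3; exact: measurable_itv. Qed.

Lemma leb_segment_lty (a b : R) : (leb (`[a, b]%classic : set R) < +oo)%E.
Proof. by rewrite (lebesgue_measure_itv `[a, b])/=; case: ifP => _; rewrite ltry. Qed.

Lemma volume_cube_lty M : (@volume R (cube M) < +oo)%E.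
Proof.
rewrite volume_oprod3//; have := leb_segment_lty (- M) M => h.
have f : leb `[- M, M]%classic \is a fin_num by rewrite ge0_fin_numE.
by rewrite -ge0_fin_numE ?mule_ge0// fin_numM// fin_numM.
Qed.

Lemma restricted_integrable d (T : measurableType d) (mu : {measure set T -> \bar R})
    (A : set T) (f : T -> R) (K : R) : measurable A -> (mu A < +oo)%E ->
  measurable_fun setT f -> (forall y, `|f y| <= K) -> (forall y, ~ A y -> f y = 0) ->
  mu.-integrable setT (EFin \o f).
Proof.
move=> mA Aoo mf fK f0.
rewrite (_ : EFin \o f = (EFin \o f) \_ A); last first.
  apply/funext => x; rewrite patchE; case: ifPn => // /negP xA /=.
  by rewrite f0// => Ax; apply: xA; rewrite inE.
apply/(integrable_mkcond _ mA); apply: measurable_bounded_integrable => //.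
  exact: measurable_funTS.
by exists K; split; [exact: num_real|move=> y Ky x _; apply: (le_trans (fK x)); exact: ltW].
Qed.

Lemma cube_integrable (f : mspace3 R -> R) K M : measurable_fun setT f ->
  (forall x, `|f x| <= K) -> (forall x, ~ cube M x -> f x = 0) ->
  (@volume R).-integrable setT (EFin \o f).
Proof.
by move=> mf fK f0; apply: (restricted_integrable (measurable_cube M) _ mf fK f0);
  exact: volume_cube_lty.
Qed.

Lemma square_integrable (f : mR * mR -> R) K M : measurable_fun setT f ->
  (forall y, `|f y| <= K) ->
  (forall y, ~ (`[- M, M] `*` `[- M, M]) y -> f y = 0) ->
  (@area R).-integrable setT (EFin \o f).
Proof.
have mI : measurable (`[- M, M]%classic : set mR) by exact: measurable_itv.
move=> mf fK f0; apply: (restricted_integrable _ _ mf fK f0).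
  exact: measurableX.
rewrite [X in (X < _)%E](@product_measure1E _ _ _ _ _ (@leb_sf R) (@leb_sf R) _ _ mI mI).
have := leb_segment_lty (- M) M => h.
have lf : leb `[- M, M]%classic \is a fin_num by rewrite ge0_fin_numE.
by rewrite -ge0_fin_numE ?mule_ge0// fin_numM.
Qed.

Definition indep_coord (j : 'I_3) (w : space3 R -> R) :=
  forall x t, w (upd3 j x t) = w x.

Lemma upd3_upd3 j x s t : upd3 j (upd3 j x s) t = upd3 j x t.
Proof. by apply: (ord3P (Q := fun j => upd3 j (upd3 j x s) t = upd3 j x t)). Qed.

Lemma xcoord_upd3 j x t : xcoord (upd3 j x t) j = t.
Proof. by apply: (ord3P (Q := fun j => xcoord (upd3 j x t) j = t)); rewrite xcoordE. Qed.

Lemma continuous_upd3 j x : continuous (upd3 j x).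
Proof.
have -> : upd3 j x = fun t => (t - xcoord x j) *: basis_vec j + x.
  by apply/funext => t; rewrite basis_vec_shift subrK.
move=> t; apply: cvgD; last exact: cvg_cst.
by apply: cvgZ; [apply: cvgB; [exact: cvg_id|exact: cvg_cst]|exact: cvg_cst].
Qed.

(** On each line in direction [j] the weight is a constant factor, so it is never differentiated and
    may be merely bounded and measurable. The fundamental theorem of calculus gives zero on the
    line. *)
Lemma integral_pderiv0 (w F F' : space3 R -> R) (j : 'I_3) (M Kw : R) :
  measurable_fun [set: mspace3 R] w -> (forall x, `|w x| <= Kw) -> indep_coord j w ->
  (forall x, is_derive x (basis_vec j) F (F' x)) -> continuous F' ->
  (forall x, ~ cube M x -> F x = 0) -> (forall x, ~ cube M x -> F' x = 0) ->
  (\int[@volume R]_x (w x * F' x)%:E = 0)%E.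
Proof.
move=> mw wK wj FF' cF' F0 F'0.
have [KF KF0 F'K] := cube_bounded cF' F'0.
have line x : (\int[leb]_t (w (upd3 j x t) * F' (upd3 j x t))%:E = 0)%E.
  apply: (@integral_derive_line (fun t => w x * F (upd3 j x t)) _ M).
  - move=> t; have := FF' (upd3 j x t).
    rewrite is_derive_line xcoord_upd3.
    under [X in is_derive _ _ X _]eq_fun do rewrite upd3_upd3.
    by move=> H; have := is_deriveZ (w x) H; rewrite wj.
  - have -> : (fun t => w (upd3 j x t) * F' (upd3 j x t)) =
        (fun t => w x * F' (upd3 j x t)) by apply/funext => t; rewrite wj.
    move=> t; apply: cvgM; first exact: cvg_cst.
    by apply: (@continuous_comp _ _ _ (upd3 j x) F'); [exact: continuous_upd3|exact: cF'].
  - move=> t Mt; rewrite F0 ?mulr0// => /cubeP/(_ j).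
    by rewrite xcoord_upd3 leNgt Mt.
have mF' : measurable_fun [set: mspace3 R] F' by exact: continuous_measurable3.
pose h (x : mspace3 R) := w x * F' x.
have mh : measurable_fun [set: mspace3 R] h by exact: measurable_funM.
have hK x : `|h x| <= Kw * KF by rewrite normrM ler_pM.
have h0 x : ~ cube M x -> h x = 0 by move=> ncx; rewrite /h F'0// mulr0.
have inth := cube_integrable mh hK h0.
have sq c : (@area R).-integrable setT (EFin \o (fun y => h (y, c))).
  apply: (@square_integrable _ (Kw * KF) M).
  - exact: measurableT_comp mh (pair2_measurable c).
  - by move=> y; exact: hK.
  - by move=> [a b] nab; apply: h0 => -[].
(* The order of integration is chosen so that the coordinate [j] is the innermost variable. *)
move: j wj FF' line; apply: ord3P => _ _ line.
- rewrite Fubini_volume_swap//; apply: integral0_eq => c _.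
  rewrite (Fubini_area_swap (sq c)); apply: integral0_eq => b _.
  exact: (line (0, b, c)).
- rewrite Fubini_volume_swap//; apply: integral0_eq => c _.
  rewrite (Fubini_area (sq c)); apply: integral0_eq => a _.
  exact: (line (a, 0, c)).
- rewrite Fubini_volume//; apply: integral0_eq => -[a b] _.
  exact: (line (a, b, 0)).
Qed.

Lemma test_function_cube D f : test_function D f ->
  exists2 M, 0 < M & forall x, ~ cube M x -> f x = 0.
Proof.
move=> [_ [K [cK _ fK]]].
have [M M0 KM] := bounded_set_cube (compact_bounded cK).
by exists M => // x ncx; apply: fK => /KM.
Qed.

Lemma test_function_bounded D f : test_function D f ->
  exists2 K, 0 <= K & forall x, `|f x| <= K.
Proof.
move=> tf; have [M _ fM] := test_function_cube tf.
exact: cube_bounded (test_function_continuous tf) fM.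
Qed.

Lemma test_function_measurable D f : test_function D f ->
  measurable_fun [set: mspace3 R] f.
Proof. by move=> tf; exact: continuous_measurable3 (test_function_continuous tf). Qed.

Lemma test_function_out D f x : test_function D f -> ~ D x -> f x = 0.
Proof. by move=> [_ [K [_ KD fK]]] nDx; apply: fK => /KD. Qed.

Lemma cubeS M N : M <= N -> cube M `<=` cube N.
Proof. by move=> MN x /cubeP xM; apply/cubeP => j; apply: le_trans MN. Qed.

Lemma integration_by_parts_weight (w f phi : space3 R -> R) D (j : 'I_3) (Kw : R) :
  measurable_fun [set: mspace3 R] w -> (forall x, `|w x| <= Kw) -> indep_coord j w ->
  smooth f -> test_function D phi ->
  (\int[@volume R]_x (w x * (f x * pderiv j phi x + pderiv j f x * phi x))%:E = 0)%E.
Proof.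
move=> mw wK wj sf tphi.
have tp := test_function_pderiv j tphi.
have [M1 M10 phi0] := test_function_cube tphi; have [M2 M20 p0] := test_function_cube tp.
have out x : ~ cube (Num.max M1 M2) x -> phi x = 0 /\ pderiv j phi x = 0.
  move=> nc; split; [apply: phi0|apply: p0] => c; apply: nc; apply: cubeS c;
  by rewrite le_max lexx ?orbT.
apply: (@integral_pderiv0 w (f \* phi) _ j (Num.max M1 M2) Kw) => //.
- move=> x; have H := is_deriveM (smooth_is_derive j x sf) (smooth_is_derive j x tphi.1).
  by apply: (is_derive_eq H); rewrite [phi x *: _]mulrC.
- have cf := smooth_continuous sf; have cphi := smooth_continuous tphi.1.
  have cdf := smooth_continuous (smooth_pderiv j sf).
  have cdphi := smooth_continuous (smooth_pderiv j tphi.1).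
  by move=> x; apply: cvgD; apply: cvgM; [exact: cf|exact: cdphi|exact: cdf|exact: cphi].
- by move=> x /out[p _]; rewrite /= p mulr0.
- by move=> x /out[-> ->]; rewrite !mulr0 addr0.
Qed.

End IntegrationByParts.

(** * The inequalities of Poincare and Rellich *)

Section BoundedMeasurable.
Context d (T : measurableType d) (R : realType).
Implicit Types (f g : T -> R) (A : set T).

(** A class stable under algebraic operations on which all integrals over sets of finite measure
    exist, so that integrability needs no separate proof. *)
Definition bdd_meas f := measurable_fun setT f /\ exists K : R, forall x, `|f x| <= K.

Lemma bdd_meas_cst (k : R) : bdd_meas (cst k).
Proof. by split; [exact: measurable_cst|exists `|k|]. Qed.

Lemma bdd_measD f g : bdd_meas f -> bdd_meas g -> bdd_meas (fun x => f x + g x).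
Proof.
move=> [mf [K fK]] [mg [L gL]]; split; first exact: measurable_funD.
by exists (K + L) => x; apply: (le_trans (ler_normD _ _)); exact: lerD.
Qed.

Lemma bdd_measM f g : bdd_meas f -> bdd_meas g -> bdd_meas (fun x => f x * g x).
Proof.
move=> [mf [K fK]] [mg [L gL]]; split; first exact: measurable_funM.
by exists (K * L) => x; rewrite normrM ler_pM.
Qed.

Lemma bdd_measZ k f : bdd_meas f -> bdd_meas (fun x => k * f x).
Proof. by move=> bf; apply: bdd_measM => //; exact: bdd_meas_cst. Qed.

Lemma bdd_measN f : bdd_meas f -> bdd_meas (fun x => - f x).
Proof.
move=> bf; rewrite (_ : (fun x => _) = fun x => (-1) * f x); first exact: bdd_measZ.
by apply/funext => x; rewrite mulN1r.
Qed.

Lemma bdd_measB f g : bdd_meas f -> bdd_meas g -> bdd_meas (fun x => f x - g x).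
Proof. by move=> bf bg; apply: bdd_measD => //; exact: bdd_measN. Qed.

Lemma bdd_meas_sqr f : bdd_meas f -> bdd_meas (fun x => f x ^+ 2).
Proof.
move=> bf; rewrite (_ : (fun x => _) = fun x => f x * f x); first exact: bdd_measM.
by apply/funext => x; rewrite expr2.
Qed.

Lemma bdd_meas_norm f : bdd_meas f -> bdd_meas (fun x => `|f x|).
Proof.
move=> [mf [K fK]]; split; first exact: measurableT_comp.
by exists K => x; rewrite normr_id.
Qed.

Lemma bdd_meas_sum (I : Type) (r : seq I) (F : I -> T -> R) :
  (forall i, bdd_meas (F i)) -> bdd_meas (fun x => \sum_(i <- r) F i x).
Proof.
move=> bF; elim: r => [|i r IH].
  by rewrite (_ : (fun x => _) = cst 0); [exact: bdd_meas_cst|apply/funext => x; rewrite big_nil].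
rewrite (_ : (fun x => _) = fun x => F i x + \sum_(i <- r) F i x); first exact: bdd_measD.
by apply/funext => x; rewrite big_cons.
Qed.

Variables (mu : {measure set T -> \bar R}) (A : set T).
Hypotheses (mA : measurable A) (muA : (mu A < +oo)%E).

Lemma bdd_meas_integrable f : bdd_meas f -> mu.-integrable A (EFin \o f).
Proof.
move=> [mf [K fK]]; apply: measurable_bounded_integrable => //; first exact: measurable_funTS.
by exists K; split; [exact: num_real|move=> y Ky x _; apply: (le_trans (fK x)); exact: ltW].
Qed.

Lemma bdd_RintegralD f g : bdd_meas f -> bdd_meas g ->
  \int[mu]_(x in A) (f x + g x) = \int[mu]_(x in A) f x + \int[mu]_(x in A) g x.
Proof. by move=> bf bg; rewrite RintegralD//; exact: bdd_meas_integrable. Qed.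

Lemma bdd_RintegralB f g : bdd_meas f -> bdd_meas g ->
  \int[mu]_(x in A) (f x - g x) = \int[mu]_(x in A) f x - \int[mu]_(x in A) g x.
Proof. by move=> bf bg; rewrite RintegralB//; exact: bdd_meas_integrable. Qed.

Lemma bdd_RintegralZ k f : bdd_meas f ->
  \int[mu]_(x in A) (k * f x) = k * \int[mu]_(x in A) f x.
Proof. by move=> bf; rewrite RintegralZl//; exact: bdd_meas_integrable. Qed.

Lemma bdd_le_Rintegral f g : bdd_meas f -> bdd_meas g -> (forall x, A x -> f x <= g x) ->
  \int[mu]_(x in A) f x <= \int[mu]_(x in A) g x.
Proof. by move=> bf bg fg; apply: le_Rintegral => //; exact: bdd_meas_integrable. Qed.

Lemma bdd_le_norm_Rintegral f : bdd_meas f ->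
  `|\int[mu]_(x in A) f x| <= \int[mu]_(x in A) `|f x|.
Proof. by move=> bf; apply: le_normr_Rintegral => //; exact: bdd_meas_integrable. Qed.

Local Notation v := (fine (mu A)).

Lemma fine_measure_ge0 : 0 <= v. Proof. exact: fine_ge0. Qed.

(** Cauchy-Schwarz against the constant 1, from the nonnegativity of the integral of
    [(v * f x - m) ^+ 2]. Multiplying by [v] avoids a division, and the null case is treated
    apart. *)
Lemma sqr_Rintegral_le f : bdd_meas f ->
  (\int[mu]_(x in A) f x) ^+ 2 <= v * \int[mu]_(x in A) f x ^+ 2.
Proof.
move=> bf; set m := \int[mu]_(x in A) f x.
have : 0 <= \int[mu]_(x in A) (v * f x - m) ^+ 2 by apply: Rintegral_ge0 => x _; exact: sqr_ge0.
have -> : \int[mu]_(x in A) (v * f x - m) ^+ 2 =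
    \int[mu]_(x in A) ((v ^+ 2) * f x ^+ 2 - (2 * v * m) * f x + m ^+ 2).
  by apply: eq_Rintegral => x _; ring.
have b1 := bdd_measZ (v ^+ 2) (bdd_meas_sqr bf); have b2 := bdd_measZ (2 * v * m) bf.
rewrite bdd_RintegralD; [|exact: bdd_measB|exact: bdd_meas_cst].
rewrite bdd_RintegralB// [X in X - _]bdd_RintegralZ; last exact: bdd_meas_sqr.
rewrite [X in _ - X]bdd_RintegralZ// Rintegral_cst// -/m.
have [v0|] := eqVneq v 0.
  rewrite v0 mul0r => _; suff -> : m = 0 by rewrite expr0n.
  have muA0 : mu A = 0%E by rewrite -[LHS]fineK ?v0// ge0_fin_numE.
  rewrite /m /Rintegral null_set_integral//.
  by case: bf => mf _; apply/measurable_EFinP; exact: measurable_funTS.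
rewrite neq_lt ltNge fine_measure_ge0/= => v0.
have -> : v ^+ 2 * \int[mu]_(x in A) f x ^+ 2 - 2 * v * m * m + m ^+ 2 * v =
   v * (v * \int[mu]_(x in A) f x ^+ 2 - m ^+ 2) by ring.
by rewrite pmulr_rge0// subr_ge0.
Qed.

(** The integral of the square splits into the contribution of the mean and the variance. Each value
    differs from the mean by at most the oscillation [k]. *)
Lemma sqr_oscillation f (k : R) : bdd_meas f -> 0 < v -> 
  (forall x y, A x -> A y -> `|f x - f y| <= k) ->
  \int[mu]_(x in A) f x ^+ 2 <= v^-1 * (\int[mu]_(x in A) f x) ^+ 2 + v * k ^+ 2.
Proof.
move=> bf v0 osc; set m := \int[mu]_(x in A) f x.
have dev x : A x -> (f x - m / v) ^+ 2 <= k ^+ 2.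
  move=> Ax; have k0 : 0 <= k by exact: le_trans (osc x x Ax Ax).
  rewrite -(real_normK (num_real (f x - m / v))) ler_pXn2r ?nnegrE//.
  have -> : f x - m / v = v^-1 * \int[mu]_(y in A) (f x - f y).
    rewrite bdd_RintegralB ?Rintegral_cst//; last exact: bdd_meas_cst.
    by rewrite -/m; field; rewrite gt_eqF.
  rewrite normrM gtr0_norm ?invr_gt0// ler_pdivrMl//.
  have bfx : bdd_meas (fun y => f x - f y) by apply: bdd_measB => //; exact: bdd_meas_cst.
  apply: (le_trans (bdd_le_norm_Rintegral bfx)).
  rewrite mulrC -Rintegral_cst//; apply: bdd_le_Rintegral.
  - exact: bdd_meas_norm.
  - exact: bdd_meas_cst.
  - by move=> y Ay; exact: osc.
have bdev : bdd_meas (fun x => f x - m / v) by apply: bdd_measB => //; exact: bdd_meas_cst.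
have : \int[mu]_(x in A) (f x - m / v) ^+ 2 <= \int[mu]_(x in A) k ^+ 2.
  by apply: bdd_le_Rintegral => //; [exact: bdd_meas_sqr|exact: bdd_meas_cst].
rewrite Rintegral_cst//.
have -> : \int[mu]_(x in A) (f x - m / v) ^+ 2 =
    \int[mu]_(x in A) (f x ^+ 2 - (2 * (m / v)) * f x + (m / v) ^+ 2).
  by apply: eq_Rintegral => x _; ring.
have b1 := bdd_meas_sqr bf; have b2 := bdd_measZ (2 * (m / v)) bf.
rewrite bdd_RintegralD; [|exact: bdd_measB|exact: bdd_meas_cst].
rewrite bdd_RintegralB// bdd_RintegralZ// Rintegral_cst// -/m.
have -> : (m / v) ^+ 2 * v = v^-1 * m ^+ 2 by field; rewrite gt_eqF.
have -> : 2 * (m / v) * m = 2 * (v^-1 * m ^+ 2) by ring.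
by lra.
Qed.

End BoundedMeasurable.

Section PartialIntegrals.
Context d1 d2 (T1 : measurableType d1) (T2 : measurableType d2) (R : realType).
Variable m1 : {sigma_finite_measure set T1 -> \bar R}.
Variable m2 : {sigma_finite_measure set T2 -> \bar R}.
Variables (A : set T1) (B : set T2).
Hypotheses (mA : measurable A) (mB : measurable B).
Hypotheses (fA : (m1 A < +oo)%E) (fB : (m2 B < +oo)%E).
Implicit Type f : T1 * T2 -> R.

Lemma bdd_meas_section1 f y : bdd_meas f -> bdd_meas (fun x => f (x, y)).
Proof.
move=> [mf [K fK]]; split; last by exists K.
exact: measurableT_comp mf (pair2_measurable y).
Qed.

Lemma bdd_meas_section2 f x : bdd_meas f -> bdd_meas (fun y => f (x, y)).
Proof.
move=> [mf [K fK]]; split; last by exists K.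
exact: measurableT_comp mf (pair1_measurable x).
Qed.

Lemma bdd_meas_partial1 f : bdd_meas f -> bdd_meas (fun y => \int[m1]_(x in A) f (x, y)).
Proof.
move=> bf; have [mf [K fK]] := bf.
(* Tonelli's measurability result is for nonnegative functions. Hence the shift by [K], which is
   undone in [E]. *)
have bK : bdd_meas (fun z => f z + K) by apply: bdd_measD => //; exact: bdd_meas_cst.
pose g (z : T1 * T2) := ((f z + K) * \1_(A `*` setT) z)%:E.
have fK0 z : 0 <= f z + K by have := fK z; rewrite ler_norml; lra.
have mg : measurable_fun setT g.
  apply/measurable_EFinP/measurable_funM; first by case: bK.
  by apply: measurable_indic; exact: measurableX.
have g0 z : (0 <= g z)%E by rewrite lee_fin mulr_ge0.
have mG : measurable_fun setT (fubini_G m1 g).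
  exact: measurable_fun_fubini_tonelli_G.
have GE y : fubini_G m1 g y = (\int[m1]_(x in A) (f (x, y) + K)%:E)%E.
  rewrite /fubini_G [RHS]integral_mkcond; apply: eq_integral => x _.
  rewrite /g patchE indicE; case: ifPn => xA.
    by rewrite mem_set ?mulr1//; split => //; rewrite inE in xA.
  by rewrite memNset ?mulr0// => -[/= /mem_set]; rewrite (negbTE xA).
have E y : \int[m1]_(x in A) f (x, y) = fine (fubini_G m1 g y) - K * fine (m1 A).
  rewrite GE -[fine _]/(\int[m1]_(x in A) (f (x, y) + K)).
  rewrite bdd_RintegralD ?Rintegral_cst ?addrK//; last exact: bdd_meas_cst.
  exact: bdd_meas_section1.
split.
  rewrite (_ : (fun y => _) = fun y => fine (fubini_G m1 g y) - K * fine (m1 A)); last exact/funext.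
  apply: measurable_funB; last exact: measurable_cst.
  by apply: measurableT_comp mG; exact: fine_measurable.
exists (K * fine (m1 A)) => y.
apply: (le_trans (bdd_le_norm_Rintegral mA fA (bdd_meas_section1 y bf))).
rewrite -Rintegral_cst//; apply: bdd_le_Rintegral => //.
  by apply: bdd_meas_norm; exact: bdd_meas_section1.
exact: bdd_meas_cst.
Qed.

Lemma bdd_Fubini f : bdd_meas f ->
  \int[m1]_(x in A) \int[m2]_(y in B) f (x, y) =
  \int[m2]_(y in B) \int[m1]_(x in A) f (x, y) /\
  \int[(m1 \x m2)%E]_(z in A `*` B) f z =
  \int[m2]_(y in B) \int[m1]_(x in A) f (x, y).
Proof.
move=> bf; have [mf [K fK]] := bf.
have mAB : measurable (A `*` B) by exact: measurableX.
have fAB : ((m1 \x m2)%E (A `*` B) < +oo)%E.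
  rewrite product_measure1E//.
  have fa : (m1 A \is a fin_num)%E by rewrite ge0_fin_numE.
  have fb : (m2 B \is a fin_num)%E by rewrite ge0_fin_numE.
  by rewrite -ge0_fin_numE ?mule_ge0// fin_numM.
pose g := (EFin \o f) \_ (A `*` B).
have intg : (m1 \x m2)%E.-integrable setT g.
  by apply/(integrable_mkcond _ mAB); exact: bdd_meas_integrable.
have gE x y : g (x, y) = if (x \in A) && (y \in B) then (f (x, y))%:E else 0%E.
  by rewrite /g patchE in_setX.
have F1 x : (\int[m2]_y g (x, y))%E =
    if x \in A then (\int[m2]_(y in B) f (x, y))%:E else 0%E.
  case: ifPn => xA; last by rewrite integral0_eq// => y _; rewrite gE (negbTE xA).
  rewrite /Rintegral fineK; last first.
    by apply: integrable_fin_num => //; apply: bdd_meas_integrable => //; exact: bdd_meas_section2.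
  by rewrite [RHS]integral_mkcond; apply: eq_integral => y _; rewrite gE xA patchE.
have F2 y : (\int[m1]_x g (x, y))%E =
    if y \in B then (\int[m1]_(x in A) f (x, y))%:E else 0%E.
  case: ifPn => yB; last by rewrite integral0_eq// => x _; rewrite gE (negbTE yB) andbF.
  rewrite /Rintegral fineK; last first.
    by apply: integrable_fin_num => //; apply: bdd_meas_integrable => //; exact: bdd_meas_section1.
  by rewrite [RHS]integral_mkcond; apply: eq_integral => x _; rewrite gE yB andbT patchE.
have I1 : (\int[m1]_x \int[m2]_y g (x, y) = \int[m1]_(x in A) (\int[m2]_(y in B) f (x, y))%:E)%E.
  by rewrite [RHS]integral_mkcond; apply: eq_integral => x _; rewrite F1 patchE.
have I2 : (\int[m2]_y \int[m1]_x g (x, y) = \int[m2]_(y in B) (\int[m1]_(x in A) f (x, y))%:E)%E.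
  by rewrite [RHS]integral_mkcond; apply: eq_integral => y _; rewrite F2 patchE.
have Fub := Fubini intg.
split; first by rewrite /Rintegral -I1 -I2 Fub.
rewrite /Rintegral -I2 (integral21_prod_meas1 intg) /g.
by rewrite integral_mkcond.
Qed.

End PartialIntegrals.

(** * Poincare's inequality on a small cube *)

Section Slabs.
Context {R : realType}.
Local Notation mR := (measurableTypeR R).

(** The one-dimensional inequality for the partial integral over [A]. Its oscillation is an integral
    of [psi] over both variables, and Cauchy-Schwarz over [I] and over [A] supplies the factors [h]
    and [v]. *)
Lemma slab_inequality d (Y : measurableType d)
    (nu : {sigma_finite_measure set Y -> \bar R}) (A : set Y) (I : set mR)
    (phi psi : Y * mR -> R) (h v : R) :
  measurable A -> measurable I -> nu A = v%:E -> leb I = h%:E -> 0 < h ->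
  bdd_meas phi -> bdd_meas psi ->
  (forall y s t, A y -> I s -> I t ->
     `|phi (y, s) - phi (y, t)| <= \int[leb]_(r in I) psi (y, r)) ->
  \int[leb]_(s in I) (\int[nu]_(y in A) phi (y, s)) ^+ 2 <=
    h^-1 * (\int[leb]_(s in I) \int[nu]_(y in A) phi (y, s)) ^+ 2 +
    h ^+ 2 * v * \int[leb]_(s in I) \int[nu]_(y in A) psi (y, s) ^+ 2.
Proof.
move=> mA mI nuA lebI h0 bphi bpsi osc.
have fA : (nu A < +oo)%E by rewrite nuA ltry.
have fI : (@leb_sf R I < +oo)%E by rewrite [X in (X < _)%E]lebI ltry.
have v0 : 0 <= v by rewrite -lee_fin -nuA.
have bPhi : bdd_meas (fun s => \int[nu]_(y in A) phi (y, s)) by exact: bdd_meas_partial1.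
pose k s := \int[nu]_(y in A) psi (y, s).
have bk : bdd_meas k by exact: bdd_meas_partial1.
have bpsi2 := bdd_meas_sqr bpsi.
have bk2 : bdd_meas (fun s => \int[nu]_(y in A) psi (y, s) ^+ 2).
  exact: (bdd_meas_partial1 mA fA bpsi2).
have oscPhi s t : I s -> I t ->
    `|\int[nu]_(y in A) phi (y, s) - \int[nu]_(y in A) phi (y, t)| <=
    \int[@leb_sf R]_(r in I) k r.
  move=> Is It.
  have [<- _] := bdd_Fubini mA mI fA fI bpsi.
  have b1 := bdd_meas_section1 s bphi; have b2 := bdd_meas_section1 t bphi.
  rewrite -bdd_RintegralB//.
  apply: (le_trans (bdd_le_norm_Rintegral mA fA (bdd_measB b1 b2))).
  apply: bdd_le_Rintegral => //.
  - by apply: bdd_meas_norm; exact: bdd_measB.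
  - have bsw : bdd_meas (fun z : mR * Y => psi (z.2, z.1)).
      case: bpsi => mpsi [K psiK]; split; last by exists K.
      exact: (measurableT_comp mpsi (measurable_fun_pair measurable_snd measurable_fst)).
    exact: (bdd_meas_partial1 (m1 := @leb_sf R) mI fI bsw).
  - by move=> y Ay; exact: osc.
have fineI : fine (@leb_sf R I) = h by rewrite [X in fine X]lebI.
have fineI0 : 0 < fine (@leb_sf R I) by rewrite fineI.
have := sqr_oscillation mI fI bPhi fineI0 oscPhi; rewrite fineI => /le_trans; apply.
rewrite lerD2l.
have := sqr_Rintegral_le mI fI bk; rewrite fineI => K2.
have : \int[@leb_sf R]_(r in I) k r ^+ 2 <=
    v * \int[@leb_sf R]_(r in I) \int[nu]_(y in A) psi (y, r) ^+ 2.
  rewrite -bdd_RintegralZ//; apply: bdd_le_Rintegral => //.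
  - exact: bdd_meas_sqr.
  - exact: bdd_measZ.
  - move=> r _; have := sqr_Rintegral_le mA fA (bdd_meas_section1 r bpsi).
    by rewrite [X in fine X * _]nuA.
move=> K3; rewrite expr2 -!mulrA ler_pM2l//; apply: (le_trans K2).
by rewrite ler_pM2l.
Qed.

(** Half-open, so that consecutive cells form a partition. *)
Definition cell (p h : R) : set R := `[p, p + h[%classic.

Lemma leb_cell p h : 0 < h -> leb (cell p h : set mR) = h%:E.
Proof.
by move=> h0; rewrite /cell (lebesgue_measure_itv `[p, p + h[)/= lte_fin ltrDl h0 -EFinB addrC addKr.
Qed.

Lemma measurable_cell p h : measurable (cell p h : set mR).
Proof. exact: measurable_itv. Qed.

(** Each coordinate is treated by the one-dimensional inequality applied to the integral over the
    previous ones. The powers [h ^+ 2], [h ^+ 3], [h ^+ 4] that appear are brought back to [h ^+ 2]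
    by the factors 1, [h^-1], [h ^- 2] of the preceding steps. *)
Lemma cell_inequality (f : mspace3 R -> R) (g : 'I_3 -> mspace3 R -> R) (p : 'I_3 -> R) (h : R) :
  0 < h -> bdd_meas f -> (forall j, bdd_meas (g j)) ->
  (forall j x s t, cell (p j) h s -> cell (p j) h t ->
    `|f (upd3 j x s) - f (upd3 j x t)| <=
    \int[leb]_(r in cell (p j) h) `|g j (upd3 j x r)|) ->
  let q := oprod3 (cell (p 0) h) (cell (p 1) h) (cell (p 2) h) in
  \int[@volume R]_(x in q) f x ^+ 2 <=
    h ^+ 2 * \sum_j \int[@volume R]_(x in q) g j x ^+ 2 +
    h ^- 3 * (\int[@volume R]_(x in q) f x) ^+ 2.
Proof.
move=> h0 bf bg osc /=.
set I0 : set mR := cell (p 0) h; set I1 : set mR := cell (p 1) h; set I2 : set mR := cell (p 2) h.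
have mI0 : measurable I0 by exact: measurable_cell.
have mI1 : measurable I1 by exact: measurable_cell.
have mI2 : measurable I2 by exact: measurable_cell.
have l0 : leb I0 = h%:E by exact: leb_cell.
have l1 : leb I1 = h%:E by exact: leb_cell.
have l2 : leb I2 = h%:E by exact: leb_cell.
have f0 : (@leb_sf R I0 < +oo)%E by rewrite [X in (X < _)%E]l0 ltry.
have f1 : (@leb_sf R I1 < +oo)%E by rewrite [X in (X < _)%E]l1 ltry.
have f2 : (@leb_sf R I2 < +oo)%E by rewrite [X in (X < _)%E]l2 ltry.
have mA : measurable (I0 `*` I1) by exact: measurableX.
have areaA : @area R (I0 `*` I1) = (h ^+ 2)%:E.
  rewrite (_ : area _ = (@leb_sf R I0 * @leb_sf R I1)%E); last exact: product_measure1E.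
  by rewrite [X in (X * _)%E]l0 [X in (_ * X)%E]l1 -EFinM expr2.
have fA : (@area R (I0 `*` I1) < +oo)%E by rewrite areaA ltry.
have volE (F : mspace3 R -> R) : bdd_meas F ->
    \int[@volume R]_(x in oprod3 I0 I1 I2) F x =
    \int[@leb_sf R]_(c in I2) \int[@area R]_(y in I0 `*` I1) F (y, c).
  by move=> bF; have [_ H] := bdd_Fubini mA mI2 fA f2 bF; exact: H.
have areaE (F : mspace3 R -> R) c : bdd_meas F ->
    \int[@area R]_(y in I0 `*` I1) F (y, c) =
    \int[@leb_sf R]_(b in I1) \int[@leb_sf R]_(a in I0) F (a, b, c).
  by move=> bF; have [_ H] := bdd_Fubini mI0 mI1 f0 f1 (bdd_meas_section1 c bF); exact: H.
have bf2 := bdd_meas_sqr bf; have bg2 j := bdd_meas_sqr (bg j).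
have bgn j := bdd_meas_norm (bg j).
have sqn (j : 'I_3) x : `|g j x| ^+ 2 = g j x ^+ 2 by rewrite real_normK ?num_real.
(* the coordinates are integrated out one after the other *)
have step0 b c : \int[@leb_sf R]_(a in I0) f (a, b, c) ^+ 2 <=
    h^-1 * (\int[@leb_sf R]_(a in I0) f (a, b, c)) ^+ 2 +
    h ^+ 2 * \int[@leb_sf R]_(a in I0) g 0 (a, b, c) ^+ 2.
  have bs (F : mspace3 R -> R) : bdd_meas F -> bdd_meas (fun a : mR => F (a, b, c)).
    by move=> bF; exact: bdd_meas_section1 b (bdd_meas_section1 c bF).
  have fineI : fine (@leb_sf R I0) = h by rewrite [X in fine X]l0.
  have fineI0 : 0 < fine (@leb_sf R I0) by rewrite fineI.
  have o s t : I0 s -> I0 t -> `|f (s, b, c) - f (t, b, c)| <=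
      \int[@leb_sf R]_(r in I0) `|g 0 (r, b, c)|.
    by move=> Is It; exact: (osc 0 (0, b, c) s t Is It).
  have := sqr_oscillation mI0 f0 (bs f bf) fineI0 o.
  rewrite fineI => /le_trans; apply; rewrite lerD2l expr2 -mulrA ler_pM2l//.
  have := sqr_Rintegral_le mI0 f0 (bs _ (bgn 0)); rewrite fineI => /le_trans; apply.
  rewrite ler_pM2l//; apply: bdd_le_Rintegral => //.
  - by apply: bdd_meas_sqr; exact: (bs _ (bgn 0)).
  - exact: (bs _ (bg2 0)).
  - by move=> a _; rewrite sqn.
have step1 c : \int[@leb_sf R]_(b in I1) (\int[@leb_sf R]_(a in I0) f (a, b, c)) ^+ 2 <=
    h^-1 * (\int[@area R]_(y in I0 `*` I1) f (y, c)) ^+ 2 +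
    h ^+ 3 * \int[@area R]_(y in I0 `*` I1) g 1 (y, c) ^+ 2.
  have := @slab_inequality _ _ (@leb_sf R) I0 I1 (fun y => f (y, c))
    (fun y => `|g 1 (y, c)|) h h mI0 mI1 l0 l1 h0 (bdd_meas_section1 c bf)
    (bdd_meas_section1 c (bgn 1)).
  move=> /(_ _)/le_trans; apply.
    by move=> a s t _ Is It; exact: (osc 1 (a, 0, c) s t Is It).
  rewrite (areaE f c bf) (areaE _ c (bg2 1)) [h ^+ 3]exprSr lerD2l ler_wpM2l//.
    by rewrite mulr_ge0 ?sqr_ge0// ltW.
  rewrite le_eqVlt; apply/orP; left; apply/eqP.
  by apply: eq_Rintegral => b _; apply: eq_Rintegral => a _; rewrite sqn.
have step2 : \int[@leb_sf R]_(c in I2) (\int[@area R]_(y in I0 `*` I1) f (y, c)) ^+ 2 <=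
    h^-1 * (\int[@volume R]_(x in oprod3 I0 I1 I2) f x) ^+ 2 +
    h ^+ 4 * \int[@volume R]_(x in oprod3 I0 I1 I2) g 2 x ^+ 2.
  have := @slab_inequality _ _ (@area R) (I0 `*` I1) I2 f
    (fun x => `|g 2 x|) h (h ^+ 2) mA mI2 areaA l2 h0 bf (bgn 2).
  move=> /(_ _)/le_trans; apply.
    by move=> [a b] s t _ Is It; exact: (osc 2 (a, b, 0) s t Is It).
  rewrite (volE f bf) (volE _ (bg2 2)) -exprD lerD2l ler_wpM2l ?exprn_ge0 ?(ltW h0)//.
  rewrite le_eqVlt; apply/orP; left; apply/eqP.
  by apply: eq_Rintegral => b _; apply: eq_Rintegral => a _; rewrite sqn.
have step01 c : \int[@area R]_(y in I0 `*` I1) f (y, c) ^+ 2 <=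
    h ^- 2 * (\int[@area R]_(y in I0 `*` I1) f (y, c)) ^+ 2 +
    h ^+ 2 * (\int[@area R]_(y in I0 `*` I1) g 0 (y, c) ^+ 2 +
              \int[@area R]_(y in I0 `*` I1) g 1 (y, c) ^+ 2).
  have bp (F : mspace3 R -> R) : bdd_meas F ->
      bdd_meas (fun b : mR => \int[@leb_sf R]_(a in I0) F (a, b, c)).
    by move=> bF; exact: (bdd_meas_partial1 mI0 f0 (bdd_meas_section1 c bF)).
  rewrite (areaE _ c bf2) (areaE _ c (bg2 0)).
  apply: (@le_trans _ _ (\int[@leb_sf R]_(b in I1)
    (h^-1 * (\int[@leb_sf R]_(a in I0) f (a, b, c)) ^+ 2 +
     h ^+ 2 * \int[@leb_sf R]_(a in I0) g 0 (a, b, c) ^+ 2))).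
    apply: bdd_le_Rintegral => //; first exact: (bp _ bf2).
    apply: bdd_measD; first by apply: bdd_measZ; apply: bdd_meas_sqr; exact: bp.
    by apply: bdd_measZ; exact: (bp _ (bg2 0)).
  have b1 := bdd_meas_sqr (bp _ bf); have b2 := bp _ (bg2 0).
  rewrite bdd_RintegralD ?bdd_RintegralZ//; try exact: bdd_measZ.
  rewrite mulrDr addrCA addrC lerD2r.
  have hn : 0 < h^-1 by rewrite invr_gt0.
  have := step1 c; rewrite -(ler_pM2l hn) => /le_trans; apply.
  by rewrite mulrDr; apply: lerD; rewrite le_eqVlt; apply/orP; left; apply/eqP; field; rewrite gt_eqF.
rewrite (volE _ bf2) sum_ord3 !(volE _ (bg2 _)).
have bp (F : mspace3 R -> R) : bdd_meas F ->
    bdd_meas (fun c : mR => \int[@area R]_(y in I0 `*` I1) F (y, c)).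
  by move=> bF; exact: (bdd_meas_partial1 mA fA bF).
apply: (@le_trans _ _ (\int[@leb_sf R]_(c in I2)
    (h ^- 2 * (\int[@area R]_(y in I0 `*` I1) f (y, c)) ^+ 2 +
     h ^+ 2 * (\int[@area R]_(y in I0 `*` I1) g 0 (y, c) ^+ 2 +
               \int[@area R]_(y in I0 `*` I1) g 1 (y, c) ^+ 2)))).
  apply: bdd_le_Rintegral => //; first exact: (bp _ bf2).
  apply: bdd_measD; first by apply: bdd_measZ; apply: bdd_meas_sqr; exact: bp.
  by apply: bdd_measZ; apply: bdd_measD; exact: (bp _ (bg2 _)).
have b0 := bp _ (bg2 0); have b1 := bp _ (bg2 1); have bF := bdd_meas_sqr (bp _ bf).
have b01 := bdd_measD b0 b1.
rewrite bdd_RintegralD ?bdd_RintegralZ ?bdd_RintegralD//; try exact: bdd_measZ.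
move: step2; rewrite (volE _ (bg2 2)).
set S0 := \int[_]_(c in I2) \int[_]_(y in _) (g 0 _) ^+ 2.
set S1 := \int[_]_(c in I2) \int[_]_(y in _) (g 1 _) ^+ 2.
set S2 := \int[_]_(c in I2) \int[_]_(y in _) (g 2 _) ^+ 2.
set X := \int[_]_(c in I2) (\int[_]_(y in _) _) ^+ 2; set Z := \int[volume]_(x in _) _.
move=> XS; have hn : 0 < h ^- 2 by rewrite invr_gt0 exprn_gt0.
have : h ^- 2 * X <= h ^- 2 * (h^-1 * Z ^+ 2 + h ^+ 4 * S2) by rewrite ler_pM2l.
have -> : h ^- 2 * (h^-1 * Z ^+ 2 + h ^+ 4 * S2) = h ^- 3 * Z ^+ 2 + h ^+ 2 * S2.
  by field; rewrite gt_eqF.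
by lra.
Qed.

End Slabs.

Section Rellich.
Context {R : realType}.
Local Notation mR := (measurableTypeR R).
Implicit Types (D : set (space3 R)).

Lemma test_function_bdd D (f : space3 R -> R) : test_function D f ->
  bdd_meas (f : mspace3 R -> R).
Proof.
move=> tf; split; first exact: test_function_measurable tf.
by have [K _ fK] := test_function_bounded tf; exists K.
Qed.

Lemma is_derive_upd3 (f : space3 R -> R) j x (t : R) : smooth f ->
  is_derive t 1 (fun r => f (upd3 j x r)) (pderiv j f (upd3 j x t)).
Proof.
move=> sf; have := smooth_is_derive j (upd3 j x t) sf.
rewrite is_derive_line xcoord_upd3.
by under [X in is_derive _ _ X _]eq_fun do rewrite upd3_upd3.
Qed.

Lemma line_oscillation D (f : space3 R -> R) j x (p h s t : R) : test_function D f ->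
  cell p h s -> cell p h t ->
  `|f (upd3 j x s) - f (upd3 j x t)| <=
  \int[leb]_(r in cell p h) `|pderiv j f (upd3 j x r)|.
Proof.
move=> tf.
wlog st : s t / s <= t.
  move=> H Is It; have [st|/ltW ts] := leP s t; first exact: H.
  by rewrite distrC; exact: H.
move=> Is It.
have tg := test_function_pderiv j tf.
pose phi' r := pderiv j f (upd3 j x r).
have cphi' : continuous phi'.
  move=> r; apply: (@continuous_comp _ _ _ (upd3 j x) (pderiv j f)).
    exact: continuous_upd3.
  exact: (test_function_continuous tg).
have bphi' : bdd_meas (phi' : mR -> R).
  split; first exact: continuous_measurable_fun.
  by have [K _ fK] := test_function_bounded tg; exists K => r; exact: fK.
have mI := @measurable_cell R p h.
have fI : (leb (cell p h : set mR) < +oo)%E.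
  by rewrite /cell (lebesgue_measure_itv `[p, p + h[)/=; case: ifP => _; rewrite ltry.
have [->|neq] := eqVneq s t; first by rewrite subrr normr0; exact: Rintegral_ge0.
have lt_st : s < t by rewrite lt_neqAle neq.
have phi_der (r : R) := is_derive_upd3 j x r tf.1.
have cphi : continuous (fun r => f (upd3 j x r)).
  by move=> r; apply/differentiable_continuous/derivable1_diffP; case: (phi_der r).
pose J : set mR := `[s, t]%classic.
have mJ : measurable J by exact: measurable_itv.
have fJ : (leb J < +oo)%E by exact: leb_segment_lty.
have FTC : (\int[leb]_(r in J) (phi' r)%:E =
    (f (upd3 j x t))%:E - (f (upd3 j x s))%:E)%E.
  apply: (@continuous_FTC2 _ phi' (fun r => f (upd3 j x r))) => //.
  - exact: continuous_subspaceT.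
  - split; [by move=> r _; case: (phi_der r)| |].
    + by apply: cvg_at_right_filter; exact: cphi.
    + by apply: cvg_at_left_filter; exact: cphi.
  - by move=> r _; rewrite derive1E; case: (phi_der r).
have -> : `|f (upd3 j x s) - f (upd3 j x t)| = `|\int[leb]_(r in J) phi' r|.
  by rewrite distrC /Rintegral FTC.
apply: (le_trans (bdd_le_norm_Rintegral mJ fJ bphi')).
have bn := bdd_meas_norm bphi'.
rewrite -lee_fin /Rintegral !fineK; last 2 first.
- by apply: integrable_fin_num => //; exact: bdd_meas_integrable.
- by apply: integrable_fin_num => //; exact: bdd_meas_integrable.
apply: ge0_subset_integral => //.
- by apply/measurable_EFinP; apply: measurable_funTS; case: bn.
- move=> r; move: Is It; rewrite /J /cell /= !in_itv/= => /andP[ps _] /andP[_ th] /andP[sr rt].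
  by rewrite (le_trans ps sr) (le_lt_trans rt th).
Qed.

Lemma sum_cells (a h : R) (n : nat) (t : R) : 0 <= h ->
  \sum_(m < n) (\1_(cell (a + m%:R * h) h) t : R) = \1_(cell a (n%:R * h)) t.
Proof.
move=> h0; elim: n => [|n IH].
  by rewrite big_ord0 mul0r indicE memNset//= /cell/= in_itv/= addr0 => /andP[/le_lt_trans H /H]; rewrite ltxx.
rewrite big_ord_recr/= IH !indicE -natrD; congr (_%:R).
have nh : 0 <= n%:R * h by rewrite mulr_ge0.
have E u v : (t \in cell u v) = (u <= t < u + v).
  by apply/idP/idP => [/set_mem|tu]; rewrite ?/cell/= ?in_itv//; apply/mem_set; rewrite /cell/= in_itv.
rewrite !E -natr1 mulrDl mul1r addrA.
case: (ltP t (a + n%:R * h)) => tn.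
  by rewrite (lt_le_trans tn) ?lerDl ?andbT ?addn0//; case: (a <= t).
by rewrite (le_trans _ tn) ?lerDl.
Qed.

Lemma Rintegral_restrict (A B : set (mspace3 R)) (f : mspace3 R -> R) :
  A `<=` B -> (forall x, ~ A x -> f x = 0) ->
  \int[@volume R]_(x in A) f x = \int[@volume R]_(x in B) f x.
Proof.
move=> AB f0; rewrite Rintegral_mkcond [RHS]Rintegral_mkcond.
apply: eq_Rintegral => x _; rewrite !patchE; case: ifPn => [/set_mem/AB/mem_set -> //|xA].
by case: ifP => // _; rewrite f0// => /mem_set; rewrite (negbTE xA).
Qed.

(** The derivative in the first coordinate of [x_1 f^2] has integral zero, and [2 x_1 f f'] is at
    least [- f^2 / 2 - 2 M^2 f'^2] on the cube. This yields the constant [4 * M ^+ 2]. *)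
Lemma poincare_real (M : R) D (f : space3 R -> R) : 0 < M -> D `<=` cube M ->
  test_function D f ->
  \int[@volume R]_(x in D) f x ^+ 2 <= 4 * M ^+ 2 * \int[@volume R]_(x in D) pderiv 0 f x ^+ 2.
Proof.
move=> M0 DM tf; have tg := test_function_pderiv 0 tf.
have fD x : ~ D x -> f x = 0 by move=> nDx; exact: test_function_out tf nDx.
have gD x : ~ D x -> pderiv 0 f x = 0 by move=> nDx; exact: test_function_out tg nDx.
rewrite !(@Rintegral_restrict D (cube M))//; last 2 first.
- by move=> x /gD ->; rewrite expr0n.
- by move=> x /fD ->; rewrite expr0n.
have mC := measurable_cube M; have fC := volume_cube_lty M.
have bf := test_function_bdd tf; have bg := test_function_bdd tg.
(* The first coordinate, truncated to be bounded on the whole space; on the cube nothing is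
   changed. *)
pose X (x : mspace3 R) := Num.min M (Num.max (- M) x.1.1).
have bX : bdd_meas X.
  split.
    apply: measurable_minr; first exact: measurable_cst.
    apply: measurable_maxr; first exact: measurable_cst.
    exact: (measurableT_comp measurable_fst measurable_fst).
  exists M => x; rewrite /X ler_norml ge_min lexx/= le_min andbT.
  by rewrite le_max lexx/= andbT; lra.
have XE x : cube M x -> X x = x.1.1.
  move=> [[+ _] _]; rewrite /= in_itv/= /X => /andP[lo hi].
  by rewrite (max_idPr lo) (min_idPr hi).
have int0 : \int[@volume R]_(x in cube M) (f x ^+ 2 + 2 * (X x * (f x * pderiv 0 f x))) = 0.
  have out x : ~ cube M x -> f x = 0 by move=> nc; apply: fD => /DM.
  pose F' x := f x ^+ 2 + 2 * (x.1.1 * (f x * pderiv 0 f x)).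
  suff H : (\int[@volume R]_x (cst 1 x * F' x)%:E = 0)%E.
    rewrite Rintegral_mkcond /Rintegral -[RHS]/(fine 0%E) -H; congr fine.
    apply: eq_integral => x _; rewrite patchE /F' mul1r; case: ifPn => [/set_mem cx|xc].
      by rewrite XE.
    by rewrite out ?expr0n/= ?mul0r ?mulr0 ?addr0// => /mem_set; rewrite (negbTE xc).
  apply: (@integral_pderiv0 R (cst 1) (fun x => x.1.1 * f x ^+ 2) F' 0 M 1).
  - exact: measurable_cst.
  - by move=> x; rewrite normr1.
  - by [].
  - move=> x; apply/is_derive_line; rewrite xcoordE.
    have df := is_derive_upd3 0 x x.1.1 tf.1.
    have d2 := is_deriveM (is_derive_id x.1.1 1) (is_deriveM df df).
    rewrite (_ : (fun t => _) = (id * ((fun r => f (upd3 0 x r)) * (fun r => f (upd3 0 x r))))%R).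
      apply: (is_derive_eq d2); have ux : upd3 0 x x.1.1 = x by case: x {df d2} => [[]].
      pose u := upd3 0 x x.1.1.
      rewrite -[LHS]/(x.1.1 * (f u * pderiv 0 f u + f u * pderiv 0 f u) + f u * f u * 1).
      by rewrite /u ux /F'; ring.
    by apply/funext => t; rewrite /= expr2.
  - have cf := test_function_continuous tf; have cg := test_function_continuous tg.
    move=> x; apply: cvgD; first by apply: cvgM; exact: cf.
    apply: cvgM; first exact: cvg_cst.
    apply: cvgM; last by apply: cvgM; [exact: cf|exact: cg].
    by apply: (@cvg_comp _ _ _ fst fst); exact: cvg_fst.
  - by move=> x /out ->; rewrite expr0n mulr0.
  - by move=> x /out fx; rewrite /F' fx expr0n/= !(mul0r, mulr0) addr0.
have bf2 := bdd_meas_sqr bf; have bg2 := bdd_meas_sqr bg.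
have b3 := bdd_measZ 2 (bdd_measM bX (bdd_measM bf bg)).
have : \int[@volume R]_(x in cube M) (2^-1 * f x ^+ 2 - 2 * M ^+ 2 * pderiv 0 f x ^+ 2) <=
    \int[@volume R]_(x in cube M) (f x ^+ 2 + 2 * (X x * (f x * pderiv 0 f x))).
  apply: bdd_le_Rintegral => //.
  - by apply: bdd_measB; exact: bdd_measZ.
  - exact: bdd_measD.
  - move=> x cx; rewrite XE//; move: cx => [[+ _] _]; rewrite /= in_itv/= => /andP[lo hi].
    move: (x.1.1) (f x) (pderiv 0 f x) lo hi => y a b lo hi.
    have y2 : y ^+ 2 <= M ^+ 2 by rewrite -(real_normK (num_real y)) ler_pXn2r ?nnegrE ?(ltW M0)// ler_norml lo.
    have h1 : y ^+ 2 * b ^+ 2 <= M ^+ 2 * b ^+ 2 by rewrite ler_wpM2r ?sqr_ge0.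
    have := sqr_ge0 (a + 2 * (y * b)); rewrite sqrrD !exprMn; lra.
rewrite int0 bdd_RintegralB ?bdd_RintegralZ//; try exact: bdd_measZ.
by lra.
Qed.

End Rellich.

Section RellichReal.
Context {R : realType}.
Local Notation mR := (measurableTypeR R).
Implicit Types (D : set (space3 R)).

Lemma bdd_Rintegral_sum (I : Type) (r : seq I) (F : I -> mspace3 R -> R)
    (B : set (mspace3 R)) : measurable B -> (@volume R B < +oo)%E ->
  (forall i, bdd_meas (F i)) ->
  \int[@volume R]_(x in B) (\sum_(i <- r) F i x) = \sum_(i <- r) \int[@volume R]_(x in B) F i x.
Proof.
move=> mB fB bF; elim: r => [|i r IH].
  rewrite big_nil (_ : Rintegral _ _ _ = \int[@volume R]_(x in B) 0).
    by rewrite Rintegral_cst// mul0r.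
  by apply: eq_Rintegral => x _; rewrite big_nil.
rewrite big_cons -IH -bdd_RintegralD//; last exact: bdd_meas_sum.
by apply: eq_Rintegral => x _; rewrite big_cons.
Qed.

Lemma bdd_meas_indic (A : set (mspace3 R)) : measurable A -> bdd_meas (\1_A : mspace3 R -> R).
Proof.
move=> mA; split; first exact: measurable_indic.
by exists 1 => x; rewrite indicE ger0_norm// lern1 leq_b1.
Qed.

Lemma Rintegral_indicM (A B : set (mspace3 R)) (f : mspace3 R -> R) : A `<=` B ->
  \int[@volume R]_(x in A) f x = \int[@volume R]_(x in B) (\1_A x * f x).
Proof.
move=> AB; rewrite Rintegral_mkcond [RHS]Rintegral_mkcond.
apply: eq_Rintegral => x _; rewrite !patchE indicE; case: ifPn => [xA|_].
  by rewrite (mem_set (AB _ (set_mem xA))) mul1r.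
by rewrite mul0r; case: ifP.
Qed.

(** A cube around [D] is cut into cells with [h ^+ 2 <= e], and Poincare's inequality is added over
    the cells. The finitely many weights are the indicators of the cells, and [c] is the factor
    [h ^- 3] of the squared integrals. *)
Lemma rellich_real D (e : R) : bounded_set D -> 0 < e ->
  exists (I : finType) (w : I -> mspace3 R -> R) (c : R),
  [/\ 0 <= c, forall i, bdd_meas (w i) & forall f : space3 R -> R, test_function D f ->
    \int[@volume R]_(x in D) f x ^+ 2 <=
      e * \sum_j \int[@volume R]_(x in D) pderiv j f x ^+ 2 +
      c * \sum_i (\int[@volume R]_(x in D) (w i x * f x)) ^+ 2].
Proof.
move=> /bounded_set_cube[M M0 DM] e0.
(* The margin of one on each side makes the half-open cells cover the closed cube of half-side
   [M]. *)
pose N := 2 * (M + 1).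
have N0 : 0 < N by rewrite mulr_gt0// addr_gt0.
(* As [n] is at least 1 and exceeds [N ^+ 2 / e], one has [N ^+ 2 / n ^+ 2 <= N ^+ 2 / n <= e]. *)
pose n := (Num.truncn (N ^+ 2 / e)).+1.
pose h := N / n%:R.
have n0 : 0 < n%:R :> R by rewrite ltr0n.
have h0 : 0 < h by rewrite divr_gt0.
have nh : n%:R * h = N by rewrite /h mulrC divfK// gt_eqF.
have h2e : h ^+ 2 <= e.
  have : N ^+ 2 / e < n%:R by exact: truncnS_gt.
  rewrite ltr_pdivrMr// => H.
  rewrite /h exprMn exprVn ler_pdivrMr ?exprn_gt0//; apply: (le_trans (ltW H)).
  rewrite mulrC ler_pM2l// expr2 ler_peMl ?ler1n ?(ltW n0)//.
pose a := - (M + 1).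
pose p (m : 'I_n) := a + m%:R * h.
pose T := ('I_n * 'I_n * 'I_n)%type.
pose q (m : T) : set (mspace3 R) := oprod3 (cell (p m.1.1) h) (cell (p m.1.2) h) (cell (p m.2) h).
pose B : set (mspace3 R) := cube (M + 1).
have mB : measurable B by exact: measurable_cube.
have fB : (@volume R B < +oo)%E by exact: volume_cube_lty.
have mq m : measurable (q m).
  by apply: measurable_oprod3; exact: measurable_cell.
have cellB (k : 'I_n) t : cell (p k) h t -> - (M + 1) <= t <= M + 1.
  rewrite /cell/= in_itv/= => /andP[lo hi].
  have kn : k%:R * h + h <= n%:R * h.
    have : k.+1%:R * h <= n%:R * h by rewrite ler_pM2r// ler_nat.
    by rewrite -natr1 mulrDl mul1r.
  have k0 : 0 <= k%:R * h by rewrite mulr_ge0// ltW.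
  move: lo hi kn; rewrite /p /a nh /N => lo hi kn.
  by apply/andP; split; lra.
have qB m : q m `<=` B.
  move=> x [[]]; rewrite /= => /cellB H1 /cellB H2 /cellB H3.
  by split; [split|]; rewrite /= in_itv.
have DB : D `<=` B.
  by apply: subset_trans DM _; apply: cubeS; rewrite lerDl.
exists T, (fun m => \1_(q m)), (h ^- 3); split.
- by rewrite invr_ge0 exprn_ge0// ltW.
- by move=> m; exact: bdd_meas_indic.
move=> f tf.
have bf := test_function_bdd tf; have tg j := test_function_pderiv j tf.
have bg j := test_function_bdd (tg j).
have fD x : ~ D x -> f x = 0 by move=> nDx; exact: test_function_out tf nDx.
have gD j x : ~ D x -> pderiv j f x = 0 by move=> nDx; exact: test_function_out (tg j) nDx.
have part x : D x -> \sum_(m : T) (\1_(q m) x : R) = 1.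
  move=> Dx.
  have E m : \1_(q m) x = \1_(cell (p m.1.1) h) x.1.1 * \1_(cell (p m.1.2) h) x.1.2 *
      \1_(cell (p m.2) h) x.2 :> R.
    by rewrite /q /oprod3 !indicE !in_setX -!natrM !mulnb.
  under eq_bigr do rewrite E.
  rewrite -(pair_bigA _ (fun m1 (m2 : 'I_n) => \1_(cell (p m1.1) h) x.1.1 *
    \1_(cell (p m1.2) h) x.1.2 * \1_(cell (p m2) h) x.2))/=.
  under eq_bigr do rewrite -mulr_sumr (sum_cells a n x.2 (ltW h0)).
  rewrite -mulr_suml.
  rewrite -(pair_bigA _ (fun (m1 m2 : 'I_n) => \1_(cell (p m1) h) x.1.1 *
    \1_(cell (p m2) h) x.1.2))/=.
  under eq_bigr do rewrite -mulr_sumr (sum_cells a n x.1.2 (ltW h0)).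
  rewrite -mulr_suml (sum_cells a n x.1.1 (ltW h0)).
  have inM t : - M <= t <= M -> \1_(cell a (n%:R * h)) t = 1 :> R.
    move=> /andP[lo hi]; rewrite indicE mem_set// /cell/= in_itv/= nh /a /N.
    by apply/andP; split; lra.
  have [[]] := DM _ Dx; rewrite /= !in_itv/= => H1 H2 H3.
  by rewrite !inM// !mulr1.
have tot (phi : mspace3 R -> R) : bdd_meas phi -> (forall x, ~ D x -> phi x = 0) ->
    \sum_(m : T) \int[@volume R]_(x in q m) phi x = \int[@volume R]_(x in D) phi x.
  move=> bphi phi0; rewrite (Rintegral_restrict DB phi0).
  under eq_bigr do rewrite (Rintegral_indicM phi (qB _)).
  rewrite -bdd_Rintegral_sum//; last first.
    by move=> m; apply: bdd_measM => //; exact: bdd_meas_indic.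
  apply: eq_Rintegral => x _; rewrite -mulr_suml.
  have [Dx|nDx] := pselect (D x); first by rewrite part// mul1r.
  by rewrite phi0// mulr0.
have bf2 := bdd_meas_sqr bf; have bg2 j := bdd_meas_sqr (bg j).
rewrite -(tot _ bf2); last by move=> x /fD ->; rewrite expr0n.
have gE j : \int[@volume R]_(x in D) pderiv j f x ^+ 2 =
    \sum_(m : T) \int[@volume R]_(x in q m) pderiv j f x ^+ 2.
  by rewrite (tot _ (bg2 j))// => x /gD ->; rewrite expr0n.
have wE m : \int[@volume R]_(x in D) (\1_(q m) x * f x) = \int[@volume R]_(x in q m) f x.
  rewrite (Rintegral_indicM f (qB m)); apply: Rintegral_restrict => // x /fD ->.
  by rewrite mulr0.
under [X in _ <= _ + _ * X]eq_bigr do rewrite wE.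
under [X in _ <= _ * X + _]eq_bigr do rewrite gE.
rewrite exchange_big/= !mulr_sumr -big_split/=; apply: ler_sum => m _.
pose pm (j : 'I_3) := if j == 0 :> nat then p m.1.1 else if j == 1 :> nat then p m.1.2 else p m.2.
have := @cell_inequality R f (fun j => pderiv j f) pm h h0 bf bg.
move=> /(_ _)/le_trans; apply.
  by move=> j x s t; exact: line_oscillation tf.
rewrite lerD2r ler_wpM2r//; apply: sumr_ge0 => j _.
by apply: Rintegral_ge0 => x _; exact: sqr_ge0.
Qed.

End RellichReal.

(** * Square-integrable complex functions and weak derivatives *)

Section ComplexL2.
Context {R : realType}.
Local Notation C := R[i].
Variable (D : set (space3 R)).
Hypotheses (mD : measurable (D : set (mspace3 R))) (fD : (@volume R D < +oo)%E).
Implicit Types (f g : space3 R -> C).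
Local Notation vol := (@volume R).
Local Notation Dm := (D : set (mspace3 R)).

Definition cmeas f : Prop :=
  measurable_fun Dm (fun x => complex.Re (f x)) /\
  measurable_fun Dm (fun x => complex.Im (f x)).

Definition cintegrable f : Prop :=
  vol.-integrable D (EFin \o (fun x => complex.Re (f x))) /\
  vol.-integrable D (EFin \o (fun x => complex.Im (f x))).

Definition cbdd f : Prop := cmeas f /\ exists K : R, forall x, normc (f x) <= K.

Lemma cmeasD f g : cmeas f -> cmeas g -> cmeas (fun x => f x + g x).
Proof.
move=> [f1 f2] [g1 g2]; split.
  rewrite (_ : (fun x => _) = fun x => complex.Re (f x) + complex.Re (g x)).
    exact: measurable_funD.
  by apply/funext => x; rewrite ReD.
rewrite (_ : (fun x => _) = fun x => complex.Im (f x) + complex.Im (g x)).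
  exact: measurable_funD.
by apply/funext => x; case: (f x) (g x) => a b [].
Qed.

Lemma cmeasM f g : cmeas f -> cmeas g -> cmeas (fun x => f x * g x).
Proof.
move=> [f1 f2] [g1 g2]; split.
  rewrite (_ : (fun x => _) = fun x => complex.Re (f x) * complex.Re (g x) -
      complex.Im (f x) * complex.Im (g x)).
    by apply: measurable_funB; exact: measurable_funM.
  by apply/funext => x; case: (f x) (g x) => a b [].
rewrite (_ : (fun x => _) = fun x => complex.Re (f x) * complex.Im (g x) +
    complex.Im (f x) * complex.Re (g x)).
  by apply: measurable_funD; exact: measurable_funM.
by apply/funext => x; case: (f x) (g x) => a b [].
Qed.

Lemma cmeas_cst (k : C) : cmeas (fun=> k).
Proof. by split; exact: measurable_cst. Qed.

Lemma cmeas_sum (I : finType) (F : I -> space3 R -> C) :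
  (forall i, cmeas (F i)) -> cmeas (fun x => \sum_i F i x).
Proof.
move=> mF; suff H (r : seq I) : cmeas (fun x => \sum_(i <- r) F i x) by [].
elim: r => [|i r IH].
  by rewrite (_ : (fun x => _) = fun=> 0); [exact: cmeas_cst|apply/funext => x; rewrite big_nil].
rewrite (_ : (fun x => _) = fun x => F i x + \sum_(i <- r) F i x); first exact: cmeasD.
by apply/funext => x; rewrite big_cons.
Qed.

Lemma cmeas_conj f : cmeas f -> cmeas (fun x => conjc (f x)).
Proof.
move=> [f1 f2]; split.
  by rewrite (_ : (fun x => _) = fun x => complex.Re (f x))//; apply/funext => x; case: (f x).
rewrite (_ : (fun x => _) = fun x => - complex.Im (f x)); first exact: measurable_funN.
by apply/funext => x; case: (f x).
Qed.

Lemma cmeas_sqr f : cmeas f -> measurable_fun Dm (fun x => normc (f x) ^+ 2).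
Proof.
move=> [f1 f2].
rewrite (_ : (fun x => _) = fun x => complex.Re (f x) * complex.Re (f x) +
    complex.Im (f x) * complex.Im (f x)).
  by apply: measurable_funD; exact: measurable_funM.
by apply/funext => x; rewrite sqr_normcE !expr2.
Qed.

Lemma cbddM f g : cbdd f -> cbdd g -> cbdd (fun x => f x * g x).
Proof.
move=> [mf [K fK]] [mg [L gL]]; split; first exact: cmeasM.
by exists (K * L) => x; rewrite normcM ler_pM ?normc_ge0.
Qed.

Lemma cbddD f g : cbdd f -> cbdd g -> cbdd (fun x => f x + g x).
Proof.
move=> [mf [K fK]] [mg [L gL]]; split; first exact: cmeasD.
by exists (K + L) => x; apply: (le_trans (le_normcD _ _)); exact: lerD.
Qed.

Lemma cbdd_cst k : cbdd (fun=> k).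
Proof. by split; [exact: cmeas_cst|exists (normc k)]. Qed.

Lemma le_cintegrable f (F : space3 R -> R) : cmeas f ->
  vol.-integrable D (EFin \o F) -> (forall x, D x -> normc (f x) <= F x) -> cintegrable f.
Proof.
move=> [f1 f2] iF fF; split.
  apply: (le_integrable mD _ _ iF); first exact/measurable_EFinP.
  move=> x Dx; rewrite /= lee_fin; apply: le_trans (norm_Re_le _) _.
  exact: le_trans (fF x Dx) (ler_norm _).
apply: (le_integrable mD _ _ iF); first exact/measurable_EFinP.
move=> x Dx; rewrite /= lee_fin; apply: le_trans (norm_Im_le _) _.
exact: le_trans (fF x Dx) (ler_norm _).
Qed.

Lemma cintegrableD f g : cintegrable f -> cintegrable g ->
  cintegrable (fun x => f x + g x).
Proof.
move=> [f1 f2] [g1 g2]; split.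
  rewrite (_ : _ \o _ = (fun x => (complex.Re (f x))%:E + (complex.Re (g x))%:E)%E).
    exact: integrableD.
  by apply/funext => x; rewrite /= ReD.
rewrite (_ : _ \o _ = (fun x => (complex.Im (f x))%:E + (complex.Im (g x))%:E)%E).
  exact: integrableD.
by apply/funext => x; rewrite /=; case: (f x) (g x) => a b [].
Qed.

Lemma cintegralD f g : cintegrable f -> cintegrable g ->
  cintegral D (fun x => f x + g x) = cintegral D f + cintegral D g.
Proof.
move=> [f1 f2] [g1 g2]; rewrite /cintegral.
rewrite (_ : \int[vol]_(x in D) complex.Re (f x + g x) =
   \int[vol]_(x in D) (complex.Re (f x) + complex.Re (g x))).
  rewrite (_ : \int[vol]_(x in D) complex.Im (f x + g x) =
     \int[vol]_(x in D) (complex.Im (f x) + complex.Im (g x))).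
    by rewrite !RintegralD.
  by apply: eq_Rintegral => x _; case: (f x) (g x) => a b [].
by apply: eq_Rintegral => x _; rewrite ReD.
Qed.

Lemma cintegrableZ k f : cintegrable f -> cintegrable (fun x => k * f x).
Proof.
move=> [f1 f2]; split.
  rewrite (_ : _ \o _ = (fun x => ((complex.Re k)%:E * (complex.Re (f x))%:E) +
      ((- complex.Im k)%:E * (complex.Im (f x))%:E))%E).
    by apply: integrableD => //; exact: integrableZl.
  apply/funext => x; rewrite /= -!EFinM -EFinD; congr _%:E.
  by case: k (f x) => a b [c d] /=; rewrite mulNr.
rewrite (_ : _ \o _ = (fun x => ((complex.Re k)%:E * (complex.Im (f x))%:E) +
    ((complex.Im k)%:E * (complex.Re (f x))%:E))%E).
  by apply: integrableD => //; exact: integrableZl.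
apply/funext => x; rewrite /= -!EFinM -EFinD; congr _%:E.
by case: k (f x) => a b [c d] /=.
Qed.

Lemma cintegralZ k f : cintegrable f ->
  cintegral D (fun x => k * f x) = k * cintegral D f.
Proof.
move=> [f1 f2]; rewrite /cintegral; case: k => a b.
have iZ c (h : space3 R -> R) : vol.-integrable D (EFin \o h) ->
    vol.-integrable D (EFin \o (fun x => c * h x)).
  move=> ih; rewrite (_ : _ \o _ = (fun x => c%:E * (h x)%:E)%E); first exact: integrableZl.
  by apply/funext => x.
rewrite (_ : \int[vol]_(x in D) complex.Re _ =
   \int[vol]_(x in D) (a * complex.Re (f x) + (- b) * complex.Im (f x))); last first.
  by apply: eq_Rintegral => x _; case: (f x) => c d /=; rewrite mulNr.
rewrite (_ : \int[vol]_(x in D) complex.Im _ =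
   \int[vol]_(x in D) (a * complex.Im (f x) + b * complex.Re (f x))); last first.
  by apply: eq_Rintegral => x _; case: (f x) => c d /=.
rewrite !RintegralD//; try exact: iZ.
rewrite !RintegralZl//.
by apply/eqP; rewrite eq_complex /= mulNr !eqxx.
Qed.

Lemma cintegrable0 : cintegrable (fun=> 0).
Proof. by split; rewrite (_ : _ \o _ = cst 0%E)//; exact: integrable0. Qed.

Lemma cintegral0 : cintegral D (fun=> 0) = 0.
Proof. by rewrite /cintegral /= !Rintegral_cst// !mul0r. Qed.

Lemma cintegral_sum (I : Type) (r : seq I) (F : I -> space3 R -> C) :
  (forall i, cintegrable (F i)) ->
  cintegrable (fun x => \sum_(i <- r) F i x) /\
  cintegral D (fun x => \sum_(i <- r) F i x) = \sum_(i <- r) cintegral D (F i).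
Proof.
move=> iF; elim: r => [|i r [IH1 IH2]].
  rewrite big_nil (_ : (fun x => _) = fun=> 0) ?cintegral0; first by split=> //; exact: cintegrable0.
  by apply/funext => x; rewrite big_nil.
rewrite big_cons -IH2 (_ : (fun x => _) = fun x => F i x + \sum_(i <- r) F i x).
  by split; [exact: cintegrableD|exact: cintegralD].
by apply/funext => x; rewrite big_cons.
Qed.

Lemma cintegral_conj f : cintegrable f ->
  cintegral D (fun x => conjc (f x)) = conjc (cintegral D f).
Proof.
move=> [_ f2]; rewrite /cintegral /=; congr (_ +i* _)%C.
  by apply: eq_Rintegral => x _; case: (f x).
rewrite -mulN1r -RintegralZl//.
by apply: eq_Rintegral => x _; rewrite mulN1r; case: (f x).
Qed.

(** The factor 2 is the price of estimating the real and imaginary parts separately. Only the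
    existence of bounds matters in what follows. *)
Lemma norm_cintegral_le f (F : space3 R -> R) : cintegrable f ->
  vol.-integrable D (EFin \o F) -> (forall x, D x -> normc (f x) <= F x) ->
  normc (cintegral D f) <= 2 * \int[vol]_(x in D) F x.
Proof.
move=> [f1 f2] iF fF.
apply: (le_trans (normc_le_ReIm _)); rewrite mulr2n mulrDl mul1r /=; apply: lerD.
  apply: (le_trans (le_normr_Rintegral mD f1)); apply: le_Rintegral => //.
    rewrite (_ : _ \o _ = (fun x => `|(EFin \o (fun x => complex.Re (f x))) x|)%E)//.
    exact: integrable_abse.
  by move=> x Dx; apply: le_trans (norm_Re_le _) (fF x Dx).
apply: (le_trans (le_normr_Rintegral mD f2)); apply: le_Rintegral => //.
  rewrite (_ : _ \o _ = (fun x => `|(EFin \o (fun x => complex.Im (f x))) x|)%E)//.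
  exact: integrable_abse.
by move=> x Dx; apply: le_trans (norm_Im_le _) (fF x Dx).
Qed.

Definition normL2 f := Num.sqrt (sqnormL2 D f).

Lemma sqnormL2_ge0 f : 0 <= sqnormL2 D f.
Proof. by apply: Rintegral_ge0 => x _; exact: sqr_ge0. Qed.

Lemma normL2_ge0 f : 0 <= normL2 f. Proof. exact: sqrtr_ge0. Qed.

Lemma memL2_cmeas f : memL2 D f -> cmeas f. Proof. by case. Qed.

Lemma memL2D f g : memL2 D f -> memL2 D g -> memL2 D (fun x => f x + g x).
Proof.
move=> [f1 f2 f3] [g1 g2 g3].
have mfg := cmeasD (conj f1 f2) (conj g1 g2).
split; [by case: mfg|by case: mfg|].
have i2 : vol.-integrable D (EFin \o (fun x => 2 * normc (f x) ^+ 2 + 2 * normc (g x) ^+ 2)).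
  rewrite (_ : _ \o _ = (fun x => 2%:E * (normc (f x) ^+ 2)%:E + 2%:E * (normc (g x) ^+ 2)%:E)%E)//.
  by apply: integrableD => //; exact: integrableZl.
apply: (le_integrable mD _ _ i2).
  by apply/measurable_EFinP; exact: cmeas_sqr.
move=> x Dx; rewrite /= lee_fin !ger0_norm ?addr_ge0 ?mulr_ge0 ?sqr_ge0 ?normc_ge0//.
have h : normc (f x + g x) ^+ 2 <= (normc (f x) + normc (g x)) ^+ 2.
  by rewrite ler_pXn2r ?nnegrE ?addr_ge0 ?normc_ge0// le_normcD.
apply: (le_trans h); have := sqr_ge0 (normc (f x) - normc (g x)).
by rewrite sqrrB sqrrD; lra.
Qed.

Lemma memL2_bddM f c : cbdd c -> memL2 D f -> memL2 D (fun x => c x * f x).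
Proof.
move=> [mc [K cK]] [f1 f2 f3]; have mcf := cmeasM mc (conj f1 f2).
split; [by case: mcf|by case: mcf|].
have i2 : vol.-integrable D (EFin \o (fun x => K ^+ 2 * normc (f x) ^+ 2)).
  rewrite (_ : _ \o _ = (fun x => (K ^+ 2)%:E * (normc (f x) ^+ 2)%:E)%E)//.
  exact: integrableZl.
apply: (le_integrable mD _ _ i2); first by apply/measurable_EFinP; exact: cmeas_sqr.
move=> x Dx; have K0 : 0 <= K := le_trans (normc_ge0 _) (cK x).
rewrite /= lee_fin !ger0_norm ?mulr_ge0 ?sqr_ge0 ?normc_ge0//.
rewrite normcM exprMn ler_wpM2r ?sqr_ge0// ler_pXn2r ?nnegrE ?normc_ge0//.
Qed.

Lemma memL2Z k f : memL2 D f -> memL2 D (fun x => k * f x).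
Proof. by apply: memL2_bddM; exact: cbdd_cst. Qed.

Lemma memL2N f : memL2 D f -> memL2 D (fun x => - f x).
Proof.
move=> /(memL2Z (-1)); rewrite (_ : (fun x => -1 * f x) = fun x => - f x)//.
by apply/funext => x; rewrite mulN1r.
Qed.

Lemma memL2B f g : memL2 D f -> memL2 D g -> memL2 D (fun x => f x - g x).
Proof. by move=> mf mg; apply: memL2D => //; exact: memL2N. Qed.

Lemma memL2_conj f : memL2 D f -> memL2 D (fun x => conjc (f x)).
Proof.
move=> [f1 f2 f3]; have mcf := cmeas_conj (conj f1 f2).
split; [by case: mcf|by case: mcf|].
by under eq_fun do rewrite normc_conj.
Qed.

Lemma cbdd_memL2 f : cbdd f -> memL2 D f.
Proof.
move=> [[f1 f2] [K fK]]; split=> //.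
have iK : vol.-integrable D (EFin \o (fun x : mspace3 R => K ^+ 2)).
  rewrite (_ : _ \o _ = cst (K ^+ 2)%:E)//; apply/integrableP; split => //.
  by rewrite integral_cst// lte_mul_pinfty// ?lee_fin.
apply: (le_integrable mD _ _ iK); first by apply/measurable_EFinP; exact: cmeas_sqr.
move=> x Dx; rewrite /= lee_fin !ger0_norm ?sqr_ge0//.
rewrite ler_pXn2r ?nnegrE ?normc_ge0//; exact: le_trans (normc_ge0 _) (fK x).
Qed.

Lemma memL2_mul f g : memL2 D f -> memL2 D g -> cintegrable (fun x => f x * g x).
Proof.
move=> [f1 f2 f3] [g1 g2 g3].
apply: (@le_cintegrable _ (fun x => normc (f x) ^+ 2 + normc (g x) ^+ 2)).
- exact: (cmeasM (conj f1 f2) (conj g1 g2)).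
- rewrite (_ : _ \o _ = (fun x => (normc (f x) ^+ 2)%:E + (normc (g x) ^+ 2)%:E)%E)//.
  exact: integrableD.
- move=> x _; rewrite normcM; have := sqr_ge0 (normc (f x) - normc (g x)).
  by have := sqr_ge0 (normc (f x) + normc (g x)); rewrite sqrrB sqrrD; lra.
Qed.

(** The best [t] would be the ratio of the square roots, which is meaningless when one of them
    vanishes. Both are shifted by [s], and the cost [s * (a + b)] is at most [e]. *)
Lemma amgm_opt (x A B : R) : 0 <= A -> 0 <= B ->
  (forall t, 0 < t -> 2 * x <= t * A + t^-1 * B) -> x <= Num.sqrt A * Num.sqrt B.
Proof.
move=> A0 B0 H.
set a := Num.sqrt A; set b := Num.sqrt B.
have a2 : A = a ^+ 2 by rewrite sqr_sqrtr.
have b2 : B = b ^+ 2 by rewrite sqr_sqrtr.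
have a0 : 0 <= a by exact: sqrtr_ge0. have b0 : 0 <= b by exact: sqrtr_ge0.
apply/ler_addgt0Pr => e e0.
pose s := e / (a + b + e + 1).
have den : 0 < a + b + e + 1 by lra.
have s0 : 0 < s by rewrite divr_gt0.
have t0 : 0 < (b + s) / (a + s) by rewrite divr_gt0//; lra.
have := H _ t0; rewrite invf_div a2 b2 => h.
have h1 : (b + s) / (a + s) * a ^+ 2 <= (b + s) * a.
  rewrite mulrAC ler_pdivrMr; last by lra.
  by rewrite expr2 !mulrA ler_wpM2l//; [rewrite mulr_ge0//; lra|lra].
have h2 : (a + s) / (b + s) * b ^+ 2 <= (a + s) * b.
  rewrite mulrAC ler_pdivrMr; last by lra.
  by rewrite expr2 !mulrA ler_wpM2l//; [rewrite mulr_ge0//; lra|lra].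
have h3 : s * (a + b) <= e.
  rewrite /s mulrAC ler_pdivrMr// ler_pM2l//; lra.
by lra.
Qed.

Lemma norm_cintegral_mul f g : memL2 D f -> memL2 D g ->
  normc (cintegral D (fun x => f x * g x)) <= 2 * (normL2 f * normL2 g).
Proof.
move=> mf mg; have [f1 f2 f3] := mf; have [g1 g2 g3] := mg.
have ifg := memL2_mul mf mg.
have n2 : 0 < 2 :> R by [].
rewrite -ler_pdivrMl//; apply: amgm_opt; try exact: sqnormL2_ge0.
move=> t t0; rewrite mulrA divff ?mul1r ?gt_eqF//.
have iT : vol.-integrable D (EFin \o (fun x => 2^-1 * (t * normc (f x) ^+ 2) +
    2^-1 * (t^-1 * normc (g x) ^+ 2))).
  rewrite (_ : _ \o _ = (fun x => (2^-1 * t)%:E * (normc (f x) ^+ 2)%:E +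
      (2^-1 * t^-1)%:E * (normc (g x) ^+ 2)%:E)%E).
    by apply: integrableD => //; exact: integrableZl.
  by apply/funext => x; rewrite /= -!EFinM -EFinD !mulrA.
apply: le_trans (norm_cintegral_le ifg iT _) _.
  move=> x _; rewrite normcM; move: (normc (f x)) (normc (g x)) => a b.
  have := mulr_ge0 (ltW t0) (sqr_ge0 (a - t^-1 * b)).
  have -> : t * (a - t^-1 * b) ^+ 2 = t * a ^+ 2 - 2 * (a * b) + t^-1 * b ^+ 2.
    by field; rewrite gt_eqF.
  by lra.
have iZ k (h : space3 R -> R) : vol.-integrable D (EFin \o h) ->
    vol.-integrable D (EFin \o (fun x => k * h x)).
  move=> ih; rewrite (_ : _ \o _ = (fun x => k%:E * (h x)%:E)%E); first exact: integrableZl.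
  by apply/funext => x.
have a1 := iZ t (fun x => normc (f x) ^+ 2) f3; have b1 := iZ t^-1 (fun x => normc (g x) ^+ 2) g3.
rewrite RintegralD//; [|exact: (iZ _ _ a1)|exact: (iZ _ _ b1)].
rewrite (RintegralZl _ mD a1) (RintegralZl _ mD b1) (RintegralZl _ mD f3) (RintegralZl _ mD g3).
by rewrite /sqnormL2; lra.
Qed.

Lemma sqr_normL2 f : normL2 f ^+ 2 = sqnormL2 D f.
Proof. by rewrite sqr_sqrtr// sqnormL2_ge0. Qed.

Lemma sqnormL2_bddM f c (K : R) : cbdd c -> (forall x, normc (c x) <= K) -> memL2 D f ->
  sqnormL2 D (fun x => c x * f x) <= K ^+ 2 * sqnormL2 D f.
Proof.
move=> bc cK mf; have [_ _ f3] := mf; have [_ _ cf3] := memL2_bddM bc mf.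
rewrite /sqnormL2 -RintegralZl//; apply: le_Rintegral => //.
  rewrite (_ : _ \o _ = (fun x => (K ^+ 2)%:E * (normc (f x) ^+ 2)%:E)%E)//.
  exact: integrableZl.
move=> x _; rewrite normcM exprMn ler_wpM2r ?sqr_ge0// ler_pXn2r ?nnegrE ?normc_ge0//.
exact: le_trans (normc_ge0 _) (cK x).
Qed.

Lemma sqnormL2D_le f g : memL2 D f -> memL2 D g ->
  sqnormL2 D (fun x => f x + g x) <= 2 * sqnormL2 D f + 2 * sqnormL2 D g.
Proof.
move=> mf mg; have [_ _ f3] := mf; have [_ _ g3] := mg; have [_ _ fg3] := memL2D mf mg.
have iZ k (h : space3 R -> R) : vol.-integrable D (EFin \o h) ->
    vol.-integrable D (EFin \o (fun x => k * h x)).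
  move=> ih; rewrite (_ : _ \o _ = (fun x => k%:E * (h x)%:E)%E); first exact: integrableZl.
  by apply/funext => x.
rewrite /sqnormL2 -!RintegralZl// -RintegralD//; try exact: iZ.
apply: le_Rintegral => //.
  rewrite (_ : _ \o _ = (fun x => (2 * normc (f x) ^+ 2)%:E + (2 * normc (g x) ^+ 2)%:E)%E)//.
  by apply: integrableD => //; exact: iZ.
move=> x _; have h : normc (f x + g x) ^+ 2 <= (normc (f x) + normc (g x)) ^+ 2.
  by rewrite ler_pXn2r ?nnegrE ?addr_ge0 ?normc_ge0// le_normcD.
apply: (le_trans h); have := sqr_ge0 (normc (f x) - normc (g x)).
by rewrite sqrrB sqrrD; lra.
Qed.

Definition ae_eqD f g : Prop := {ae vol, forall x : mspace3 R, D x -> f x = g x}.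

Lemma ae_cintegral f g : cmeas f -> cmeas g -> ae_eqD f g -> cintegral D f = cintegral D g.
Proof.
move=> [f1 f2] [g1 g2] fg; rewrite /cintegral /Rintegral.
congr (fine _ +i* fine _)%C; apply: ae_eq_integral => //; try exact/measurable_EFinP;
by apply: filterS fg => x fg /fg /= ->.
Qed.

Lemma ae_sqnormL2 f g : cmeas f -> cmeas g -> ae_eqD f g -> sqnormL2 D f = sqnormL2 D g.
Proof.
move=> mf mg fg; rewrite /sqnormL2 /Rintegral; congr fine.
apply: ae_eq_integral => //; try by apply/measurable_EFinP; exact: cmeas_sqr.
by apply: filterS fg => x fg /fg /= ->.
Qed.

Lemma eq_cintegral f g : (forall x, D x -> f x = g x) -> cintegral D f = cintegral D g.
Proof.
move=> fg; rewrite /cintegral; congr (_ +i* _)%C;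
by apply: eq_Rintegral => x /set_mem Dx; rewrite fg.
Qed.

Lemma cintegrable_cmeas f : cintegrable f -> cmeas f.
Proof.
by move=> [f1 f2]; split; apply/measurable_EFinP; [exact: measurable_int f1|exact: measurable_int f2].
Qed.

End ComplexL2.

(** * Complex test functions and uniqueness of weak derivatives *)

Section WeakDerivatives.
Context {R : realType}.
Local Notation C := R[i].
Variable (D : set (space3 R)).
Hypotheses (oD : open D) (bD : bounded_set D).
Implicit Types (f g w : space3 R -> C) (j : 'I_3) (phi : space3 R -> R).
Local Notation vol := (@volume R).

Let mD : measurable (D : set (mspace3 R)) := open_measurable3 oD.
Let fD : (vol D < +oo)%E := bounded_set_volume bD mD.

(** Measurability is required on the whole space and not only on [D] as in [cbdd], because
    integration by parts runs along entire lines. *)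
Definition cbdd_meas f := bdd_meas (fun x : mspace3 R => complex.Re (f x)) /\
  bdd_meas (fun x : mspace3 R => complex.Im (f x)).

Lemma cbdd_measM f g : cbdd_meas f -> cbdd_meas g -> cbdd_meas (fun x => f x * g x).
Proof.
move=> [f1 f2] [g1 g2]; split.
  rewrite (_ : (fun x => _) = fun x => complex.Re (f x) * complex.Re (g x) -
      complex.Im (f x) * complex.Im (g x)).
    by apply: bdd_measB; exact: bdd_measM.
  by apply/funext => x; case: (f x) (g x) => a b [].
rewrite (_ : (fun x => _) = fun x => complex.Re (f x) * complex.Im (g x) +
    complex.Im (f x) * complex.Re (g x)).
  by apply: bdd_measD; exact: bdd_measM.
by apply/funext => x; case: (f x) (g x) => a b [].
Qed.

Lemma cbdd_meas_conj f : cbdd_meas f -> cbdd_meas (fun x => conjc (f x)).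
Proof.
move=> [f1 f2]; split.
  by rewrite (_ : (fun x => _) = fun x => complex.Re (f x))//; apply/funext => x; case: (f x).
rewrite (_ : (fun x => _) = fun x => - complex.Im (f x)); first exact: bdd_measN.
by apply/funext => x; case: (f x).
Qed.

Lemma cbdd_meas_real (phi : space3 R -> R) : bdd_meas (phi : mspace3 R -> R) ->
  cbdd_meas (fun x => (phi x)%:C%C).
Proof. by move=> bphi; split => //=; exact: bdd_meas_cst. Qed.

Lemma cbdd_meas_cst k : cbdd_meas (fun=> k).
Proof. by split; exact: bdd_meas_cst. Qed.

Lemma cbdd_meas_cbdd f : cbdd_meas f -> cbdd D f.
Proof.
move=> [[mf1 [K1 f1]] [mf2 [K2 f2]]]; split; first by split; exact: measurable_funTS.
by exists (K1 + K2) => x; apply: (le_trans (normc_le_ReIm _)); exact: lerD.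
Qed.

Definition ctest f := test_function D (fun x => complex.Re (f x)) /\
  test_function D (fun x => complex.Im (f x)).

Definition cpderiv j f : space3 R -> C := fun x =>
  (pderiv j (fun x => complex.Re (f x)) x +i* pderiv j (fun x => complex.Im (f x)) x)%C.

Lemma ctest_cpderiv j f : ctest f -> ctest (cpderiv j f).
Proof. by move=> [f1 f2]; split; exact: test_function_pderiv. Qed.

Lemma ctest_cbdd_meas f : ctest f -> cbdd_meas f.
Proof. by move=> [f1 f2]; split; [exact: test_function_bdd f1|exact: test_function_bdd f2]. Qed.

Lemma ctest_real phi : test_function D phi -> ctest (fun x => (phi x)%:C%C).
Proof. by move=> tphi; split => //=; exact: test_function0. Qed.

Lemma pderiv_cst0 j : pderiv j (fun=> 0 : R) = fun=> 0.
Proof. by apply/funext => x; rewrite /pderiv derive_cst. Qed.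

Lemma cpderiv_real j phi : cpderiv j (fun x => (phi x)%:C%C) = fun x => (pderiv j phi x)%:C%C.
Proof. by apply/funext => x; rewrite /cpderiv /= pderiv_cst0. Qed.

Lemma ctestD f g : ctest f -> ctest g -> ctest (fun x => f x + g x) /\
  forall j, cpderiv j (fun x => f x + g x) = fun x => cpderiv j f x + cpderiv j g x.
Proof.
move=> [f1 f2] [g1 g2].
have E1 : (fun x => complex.Re (f x + g x)) = (fun x => complex.Re (f x)) \+ (fun x => complex.Re (g x)).
  by apply/funext => x; rewrite ReD.
have E2 : (fun x => complex.Im (f x + g x)) = (fun x => complex.Im (f x)) \+ (fun x => complex.Im (g x)).
  by apply/funext => x /=; case: (f x) (g x) => a b [].
split; first by split; rewrite (E1, E2); exact: test_functionD.
move=> j; apply/funext => x; rewrite /cpderiv E1 E2.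
by rewrite (pderivD j f1.1 g1.1) (pderivD j f2.1 g2.1).
Qed.

Lemma ctestZ k f : ctest f -> ctest (fun x => k * f x) /\
  forall j, cpderiv j (fun x => k * f x) = fun x => k * cpderiv j f x.
Proof.
move=> [f1 f2]; case: k => a b.
have E1 : (fun x => complex.Re ((a +i* b)%C * f x)) =
    (a \*o (fun x => complex.Re (f x))) \+ ((- b) \*o (fun x => complex.Im (f x))).
  by apply/funext => x /=; case: (f x) => c d /=; rewrite mulNr.
have E2 : (fun x => complex.Im ((a +i* b)%C * f x)) =
    (a \*o (fun x => complex.Im (f x))) \+ (b \*o (fun x => complex.Re (f x))).
  by apply/funext => x /=; case: (f x) => c d.
have Z1 k := test_functionZ k f1; have Z2 k := test_functionZ k f2.
split; first by split; rewrite (E1, E2); exact: test_functionD.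
move=> j; apply/funext => x; rewrite /cpderiv E1 E2.
rewrite (pderivD j (Z1 a).1 (Z2 (- b)).1) (pderivD j (Z2 a).1 (Z1 b).1).
by rewrite !(pderivZ _ j f1.1) !(pderivZ _ j f2.1) /= mulNr.
Qed.

Lemma ctest0 : ctest (fun=> 0) /\ forall j, cpderiv j (fun=> 0) = fun=> 0.
Proof.
split=> [|j]; first by split; exact: test_function0.
by apply/funext => x; rewrite /cpderiv /= pderiv_cst0.
Qed.

Lemma cpderivC i j f : ctest f -> cpderiv i (cpderiv j f) = cpderiv j (cpderiv i f).
Proof.
move=> [[f1 _] [f2 _]]; apply/funext => x; rewrite /cpderiv /=.
by rewrite -[X in (X +i* _)%C = _]/(pderiv i (pderiv j (fun x => complex.Re (f x))) x)
  -[X in (_ +i* X)%C = _]/(pderiv i (pderiv j (fun x => complex.Im (f x))) x) !(pderivC i j).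
Qed.

Definition cindep j w := forall x t, w (upd3 j x t) = w x.

Let vanishing phi := bdd_meas (phi : mspace3 R -> R) /\ \int[vol]_(x in D) phi x = 0.

Let ibp_real (w f phi : space3 R -> R) j : bdd_meas (w : mspace3 R -> R) -> indep_coord j w ->
  test_function D f -> test_function D phi ->
  vanishing (fun x => w x * (f x * pderiv j phi x + pderiv j f x * phi x)).
Proof.
move=> bw wj tf tphi; have [mw [K wK]] := bw; split.
  have b1 := test_function_bdd (test_function_pderiv j tphi).
  have b2 := test_function_bdd (test_function_pderiv j tf).
  have b3 := test_function_bdd tphi; have b4 := test_function_bdd tf.
  by apply: bdd_measM => //; apply: bdd_measD; exact: bdd_measM.
rewrite (@Rintegral_restrict _ _ setT)//.
  by rewrite /Rintegral (integration_by_parts_weight mw wK wj tf.1 tphi).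
move=> x nDx; rewrite (test_function_out tphi nDx).
by rewrite (test_function_out (test_function_pderiv j tphi) nDx) !mulr0 addr0 mulr0.
Qed.

Lemma cintegration_by_parts w f g j : cbdd_meas w -> cindep j w -> ctest f -> ctest g ->
  cintegral D (fun x => w x * f x * cpderiv j g x) =
  - cintegral D (fun x => w x * cpderiv j f x * g x).
Proof.
move=> bw wj tf tg.
have bdf := ctest_cbdd_meas (ctest_cpderiv j tf).
have bdg := ctest_cbdd_meas (ctest_cpderiv j tg).
have bf := ctest_cbdd_meas tf; have bg := ctest_cbdd_meas tg.
have intM a b : cbdd_meas a -> cbdd_meas b -> cintegrable D (fun x => w x * a x * b x).
  move=> ba bb; apply: (memL2_mul mD); apply: (cbdd_memL2 mD fD); apply: cbdd_meas_cbdd => //.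
  exact: cbdd_measM.
apply/eqP; rewrite -addr_eq0 -(cintegralD mD); try exact: intM.
move: bw => [bw1 bw2]; move: tf tg => [tf1 tf2] [tg1 tg2].
have wj1 : indep_coord j (fun x => complex.Re (w x)) by move=> x t; rewrite wj.
have wj2 : indep_coord j (fun x => complex.Im (w x)) by move=> x t; rewrite wj.
have vD p q : vanishing p -> vanishing q -> vanishing (fun x => p x + q x).
  move=> [p1 p2] [q1 q2]; split; first exact: bdd_measD.
  by rewrite (bdd_RintegralD mD fD)// p2 q2 addr0.
have vB p q : vanishing p -> vanishing q -> vanishing (fun x => p x - q x).
  move=> [p1 p2] [q1 q2]; split; first exact: bdd_measB.
  by rewrite (bdd_RintegralB mD fD)// p2 q2 subr0.
(* The three digits refer to [w], [f] and [g]: 1 stands for the real part and 2 for the imaginary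
   part. The real and imaginary parts of the identity are signed sums of four of these each. *)
have V111 := ibp_real bw1 wj1 tf1 tg1; have V122 := ibp_real bw1 wj1 tf2 tg2.
have V212 := ibp_real bw2 wj2 tf1 tg2; have V221 := ibp_real bw2 wj2 tf2 tg1.
have V112 := ibp_real bw1 wj1 tf1 tg2; have V121 := ibp_real bw1 wj1 tf2 tg1.
have V211 := ibp_real bw2 wj2 tf1 tg1; have V222 := ibp_real bw2 wj2 tf2 tg2.
have [_ H1] := vB _ _ (vB _ _ (vB _ _ V111 V122) V212) V221.
have [_ H2] := vB _ _ (vD _ _ (vD _ _ V112 V121) V211) V222.
apply/eqP; rewrite /cintegral -[RHS]/(0 +i* 0)%C; congr (_ +i* _)%C.
  rewrite -[RHS]H1; apply: eq_Rintegral => x _; rewrite /cpderiv.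
  by case: (w x) (f x) (g x) => a b [c d] [p q] /=; ring.
rewrite -[RHS]H2; apply: eq_Rintegral => x _; rewrite /cpderiv.
by case: (w x) (f x) (g x) => a b [c d] [p q] /=; ring.
Qed.

Lemma ctest_memL2 f : ctest f -> memL2 D f.
Proof. by move=> tf; apply: (cbdd_memL2 mD fD); exact: cbdd_meas_cbdd (ctest_cbdd_meas tf). Qed.

Lemma ctest_is_wderiv j f : ctest f -> is_wderiv D j f (cpderiv j f).
Proof.
move=> tf; split; first exact: ctest_memL2 (ctest_cpderiv j tf).
move=> phi /ctest_real tphi.
have := @cintegration_by_parts (fun=> 1) f _ j (cbdd_meas_cst 1) (fun _ _ => erefl) tf tphi.
by rewrite cpderiv_real; under [in cintegral D _ = _]eq_fun do rewrite mul1r;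
  under [in X in _ = - X]eq_fun do rewrite mul1r.
Qed.

Lemma memL2_test_integrable f phi : memL2 D f -> test_function D phi ->
  cintegrable D (fun x => f x * (phi x)%:C%C).
Proof.
move=> mf tphi; apply: (memL2_mul mD) => //; apply: ctest_memL2; exact: ctest_real.
Qed.

Lemma is_wderivB j f f' g g' : memL2 D f -> memL2 D f' ->
  is_wderiv D j f g -> is_wderiv D j f' g' ->
  is_wderiv D j (fun x => f x - f' x) (fun x => g x - g' x).
Proof.
move=> mf mf' [mg fg] [mg' fg']; split; first exact: (memL2B mD).
have BE a b phi : memL2 D a -> memL2 D b -> test_function D phi ->
    cintegral D (fun x => (a x - b x) * (phi x)%:C%C) =
    cintegral D (fun x => a x * (phi x)%:C%C) - cintegral D (fun x => b x * (phi x)%:C%C).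
  move=> ma mb tphi.
  have ia := memL2_test_integrable ma tphi; have ib := memL2_test_integrable mb tphi.
  rewrite -[X in _ - X]mul1r -mulNr -(cintegralZ mD)// -(cintegralD mD)//.
    by apply: eq_cintegral => x _; rewrite mulN1r mulrBl.
  exact: (cintegrableZ mD).
move=> phi tphi; rewrite !BE//; last exact: test_function_pderiv.
by rewrite fg// fg'// opprB opprK addrC.
Qed.

Lemma is_wderiv_conj j f g : memL2 D f -> is_wderiv D j f g ->
  is_wderiv D j (fun x => conjc (f x)) (fun x => conjc (g x)).
Proof.
move=> mf [mg fg]; split; first exact: memL2_conj.
have CE a phi : memL2 D a -> test_function D phi ->
    cintegral D (fun x => conjc (a x) * (phi x)%:C%C) =
    conjc (cintegral D (fun x => a x * (phi x)%:C%C)).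
  move=> ma tphi; rewrite -(cintegral_conj mD); last exact: memL2_test_integrable.
  by apply: eq_cintegral => x _; rewrite rmorphM/= oppr0.
move=> phi tphi; rewrite !CE//; last exact: test_function_pderiv.
by rewrite fg// rmorphN.
Qed.

(** Makes the representative picked by [wderiv] irrelevant: in every integral it may be replaced by
    any known weak derivative. *)
Lemma is_wderiv_ae j f g g' : is_wderiv D j f g -> is_wderiv D j f g' -> ae_eqD D g g'.
Proof.
move=> [mg fg] [mg' fg'].
have mB := memL2B mD mg mg'.
have iB : cintegrable D (fun x => g x - g' x).
  rewrite (_ : (fun x => _) = fun x => (g x - g' x) * 1); last by apply/funext => x; rewrite mulr1.
  apply: (memL2_mul mD) => //; apply: (cbdd_memL2 mD fD); exact: cbdd_cst.
have zero phi : test_function D phi -> cintegral D (fun x => (g x - g' x) * (phi x)%:C%C) = 0.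
  move=> tphi.
  have ia := memL2_test_integrable mg tphi; have ib := memL2_test_integrable mg' tphi.
  have : cintegral D (fun x => g x * (phi x)%:C%C) = cintegral D (fun x => g' x * (phi x)%:C%C).
    by apply: oppr_inj; rewrite -fg// -fg'.
  move=> /eqP; rewrite -subr_eq0 => /eqP <-.
  rewrite -[X in _ - X]mul1r -mulNr -(cintegralZ mD)// -(cintegralD mD)//.
    by apply: eq_cintegral => x _; rewrite mulN1r mulrBl.
  exact: (cintegrableZ mD).
have [iB1 iB2] := iB.
have z1 : {ae vol, forall x : mspace3 R, D x -> complex.Re (g x - g' x) = 0}.
  apply: du_bois_reymond => // phi /zero; rewrite /cintegral => -[z _].
  rewrite -[RHS]z; apply: eq_Rintegral => x _.
  by case: (g x - g' x) => a b /=; rewrite mulr0 subr0.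
have z2 : {ae vol, forall x : mspace3 R, D x -> complex.Im (g x - g' x) = 0}.
  apply: du_bois_reymond => // phi /zero; rewrite /cintegral => -[_ z].
  rewrite -[RHS]z; apply: eq_Rintegral => x _.
  by case: (g x - g' x) => a b /=; rewrite mulr0 add0r.
apply: filterS2 z1 z2 => x z1 z2 Dx; apply/eqP; rewrite -subr_eq0; apply/eqP.
by move: (z1 Dx) (z2 Dx); case: (g x - g' x) => a b /= -> ->.
Qed.

Lemma is_wderiv_wderiv j f g : is_wderiv D j f g -> is_wderiv D j f (wderiv D j f).
Proof.
move=> fg.
exact: (@xgetPex _ (fun=> 0) [set g | is_wderiv D j f g] (ex_intro _ g fg)).
Qed.

Lemma wderiv_ae j f g : is_wderiv D j f g -> ae_eqD D (wderiv D j f) g.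
Proof. by move=> fg; apply: (is_wderiv_ae _ fg); exact: is_wderiv_wderiv fg. Qed.

Lemma sqnormH1_wderiv f (g : 'I_3 -> space3 R -> C) :
  (forall j, is_wderiv D j f (g j)) -> sqnormH1 D f = sqnormL2 D f + \sum_j sqnormL2 D (g j).
Proof.
move=> fg; rewrite /sqnormH1; congr (_ + _); apply: eq_bigr => j _.
apply: (ae_sqnormL2 mD).
- by have [+ _] := is_wderiv_wderiv (fg j); exact: memL2_cmeas.
- by have [+ _] := fg j; exact: memL2_cmeas.
- exact: wderiv_ae.
Qed.

End WeakDerivatives.

Section ZeroTraceApproximation.
Context {R : realType}.
Local Notation C := R[i].
Variable (D : set (space3 R)).
Hypotheses (oD : open D) (bD : bounded_set D).
Implicit Types (f g w : space3 R -> C) (j : 'I_3) (phi : space3 R -> R).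
Local Notation vol := (@volume R).

Let mD : measurable (D : set (mspace3 R)) := open_measurable3 oD.
Let fD : (vol D < +oo)%E := bounded_set_volume bD mD.

Lemma sqnormH1_ge0 f : 0 <= sqnormH1 D f.
Proof. by rewrite addr_ge0 ?sqnormL2_ge0// sumr_ge0// => j _; exact: sqnormL2_ge0. Qed.

(** The definition of [memH10] measures the chosen weak derivative of the difference. By uniqueness
    it agrees almost everywhere with [g] minus the classical derivative of [fn]. *)
Lemma memH10_approx f e : memH10 D f -> 0 < e -> exists fn, [/\ ctest D fn,
  normL2 D (fun x => f x - fn x) < e &
  forall j g, is_wderiv D j f g -> normL2 D (fun x => g x - cpderiv j fn x) < e].
Proof.
move=> [[mf df] /[apply]] [p1 [p2 [t1 t2 lte]]].
pose fn x := (p1 x +i* p2 x)%C.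
have tfn : ctest D fn by split.
exists fn; split => //.
  by apply: le_lt_trans lte; rewrite ler_sqrt ?sqnormH1_ge0// lerDl sumr_ge0// => j _; exact: sqnormL2_ge0.
move=> j g fg; apply: le_lt_trans lte; rewrite ler_sqrt ?sqnormH1_ge0//.
have fB := is_wderivB oD bD mf (ctest_memL2 oD bD tfn) fg (ctest_is_wderiv oD bD j tfn).
have [mw _] := is_wderiv_wderiv fB; have [mB _] := fB.
rewrite -(ae_sqnormL2 mD (memL2_cmeas mw) (memL2_cmeas mB) (wderiv_ae oD bD fB)).
rewrite /sqnormH1 (bigD1 j)//= addrCA lerDl addr_ge0 ?sqnormL2_ge0// sumr_ge0// => i _.
exact: sqnormL2_ge0.
Qed.

Lemma small_normc_eq0 (z : C) (K : R) : 0 <= K -> (forall e : R, 0 < e -> normc z <= e * K) -> z = 0.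
Proof.
move=> K0 H; apply/eqP; rewrite -normc_eq0 eq_le normc_ge0 andbT leNgt; apply/negP => z0.
have K1 : 0 < K + 1 by rewrite ltr_wpDl.
have := H _ (divr_gt0 z0 K1).
by rewrite mulrAC ler_pdivlMr// ler_pM2l//; lra.
Qed.

(* [w] passes through the derivative in the test functions approximating [f]. *)
Lemma is_wderivM j f g w : memH10 D f -> is_wderiv D j f g -> cbdd_meas w ->
  cindep j w -> is_wderiv D j (fun x => w x * f x) (fun x => w x * g x).
Proof.
move=> hf fg bw wj; have [[mf _] _] := hf; have [mg _] := fg.
have bwD := cbdd_meas_cbdd D bw.
split; first exact: (memL2_bddM mD).
move=> phi tphi; have tdphi := test_function_pderiv j tphi.
have m1 : memL2 D (fun x => w x * (pderiv j phi x)%:C%C).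
  by apply: (memL2_bddM mD) => //; apply: (ctest_memL2 oD bD); exact: ctest_real.
have m2 : memL2 D (fun x => w x * (phi x)%:C%C).
  by apply: (memL2_bddM mD) => //; apply: (ctest_memL2 oD bD); exact: ctest_real.
set d1 := (X in memL2 D X) in m1; set d2 := (X in memL2 D X) in m2.
apply/eqP; rewrite -addr_eq0; apply/eqP.
apply: (@small_normc_eq0 _ (2 * normL2 D d1 + 2 * normL2 D d2)).
  by rewrite addr_ge0 ?mulr_ge0 ?normL2_ge0.
move=> e e0; have [fn [tfn fe ge]] := memH10_approx hf e0.
have mfn := ctest_memL2 oD bD tfn.
have mgn := ctest_memL2 oD bD (ctest_cpderiv j tfn).
have mB1 := memL2B mD mf mfn; have mB2 := memL2B mD mg mgn.
have splitE a b d : memL2 D a -> memL2 D b -> memL2 D d ->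
    cintegral D (fun x => a x * d x) =
    cintegral D (fun x => (a x - b x) * d x) + cintegral D (fun x => b x * d x).
  move=> ma mb md; rewrite -(cintegralD mD); try exact: (memL2_mul mD).
    by apply: eq_cintegral => x _; rewrite -mulrDl subrK.
  by apply: (memL2_mul mD) => //; exact: (memL2B mD).
rewrite (_ : cintegral D (fun x => w x * f x * _) = cintegral D (fun x => f x * d1 x)); last first.
  by apply: eq_cintegral => x _; rewrite /d1 mulrA [f x * _]mulrC.
rewrite (_ : cintegral D (fun x => w x * g x * _) = cintegral D (fun x => g x * d2 x)); last first.
  by apply: eq_cintegral => x _; rewrite /d2 mulrA [g x * _]mulrC.
rewrite (splitE f fn)// (splitE g (cpderiv j fn))// addrACA.
rewrite [X in _ + X](_ : _ = 0); last first.
  rewrite (_ : cintegral D (fun x => fn x * d1 x) =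
    cintegral D (fun x => w x * fn x * cpderiv j (fun x => (phi x)%:C%C) x)).
    rewrite (cintegration_by_parts oD bD bw wj tfn (ctest_real tphi)).
    rewrite addrC; apply/eqP; rewrite subr_eq0; apply/eqP; apply: eq_cintegral => x _.
    by rewrite /d2 mulrA [_ * w x]mulrC.
  by apply: eq_cintegral => x _; rewrite cpderiv_real /d1 mulrA [_ * w x]mulrC.
rewrite addr0 mulrDr; apply: (le_trans (le_normcD _ _)); apply: lerD.
  apply: (le_trans (norm_cintegral_mul mD mB1 m1)).
  by rewrite mulrCA ler_wpM2r ?mulr_ge0 ?normL2_ge0// ltW.
apply: (le_trans (norm_cintegral_mul mD mB2 m2)).
by rewrite mulrCA ler_wpM2r ?mulr_ge0 ?normL2_ge0// ltW// ge.
Qed.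

End ZeroTraceApproximation.

(** * Integrated sesquilinear forms with bounded coefficients *)

Section SesquilinearForms.
Context {R : realType}.
Local Notation C := R[i].
Variables (D : set (space3 R)) (I : finType).
Hypotheses (mD : measurable (D : set (mspace3 R))) (fD : (@volume R D < +oo)%E).
Implicit Types (S : pred I) (F G : (I -> C) -> (I -> C) -> space3 R -> C).

(* The pointwise forms [sum_(s, t) W_st(x) * a_s * conj(b_t)] with bounded
   coefficients, in which only the components [s] in [S] of the first argument occur. *)
Definition sesqui S F : Prop := exists W : I -> I -> space3 R -> C,
  [/\ forall s t, cbdd D (W s t), forall s t, ~~ S s -> forall x, W s t x = 0 &
      forall a b x, F a b x = \sum_s \sum_t W s t x * a s * conjc (b t)].

Lemma sesqui_ext S F G : (forall a b x, F a b x = G a b x) -> sesqui S F -> sesqui S G.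
Proof. by move=> FG [W [W1 W2 W3]]; exists W; split=> // a b x; rewrite -FG. Qed.

Lemma sesqui_monomial S s t c : cbdd D c -> S s ->
  sesqui S (fun a b x => c x * a s * conjc (b t)).
Proof.
move=> bc Ss; exists (fun s' t' x => if (s' == s) && (t' == t) then c x else 0); split.
- by move=> s' t'; case: ((s' == s) && (t' == t)) => //; exact: cbdd_cst.
- by move=> s' t' nS x; case: eqP => //= E; rewrite E Ss in nS.
- move=> a b x; rewrite [RHS](bigD1 s)//= [X in X + _](bigD1 t)//= !eqxx /= big1 ?addr0; last first.
    by move=> t' /negbTE ->; rewrite !mul0r.
  rewrite big1 ?addr0// => s' /negbTE ->; rewrite big1// => t' _.
  by rewrite !mul0r.
Qed.

Lemma sesqui0 S : sesqui S (fun _ _ _ => 0).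
Proof.
exists (fun _ _ _ => 0); split=> // [s t|a b x]; first exact: cbdd_cst.
by rewrite big1// => s _; rewrite big1// => t _; rewrite !mul0r.
Qed.

Lemma sesquiD S F G : sesqui S F -> sesqui S G -> sesqui S (fun a b x => F a b x + G a b x).
Proof.
move=> [W [W1 W2 W3]] [V [V1 V2 V3]]; exists (fun s t x => W s t x + V s t x); split.
- by move=> s t; exact: cbddD.
- by move=> s t nS x; rewrite W2// V2// addr0.
- move=> a b x; rewrite W3 V3 -big_split; apply: eq_bigr => s _ /=.
  by rewrite -big_split; apply: eq_bigr => t _ /=; rewrite !mulrDl.
Qed.

Lemma sesquiZ S F c : cbdd D c -> sesqui S F -> sesqui S (fun a b x => c x * F a b x).
Proof.
move=> bc [W [W1 W2 W3]]; exists (fun s t x => c x * W s t x); split.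
- by move=> s t; exact: cbddM.
- by move=> s t nS x; rewrite W2// mulr0.
- move=> a b x; rewrite W3 mulr_sumr; apply: eq_bigr => s _ /=.
  by rewrite mulr_sumr; apply: eq_bigr => t _ /=; rewrite !mulrA.
Qed.

Lemma sesqui_sum S (J : finType) (F : J -> (I -> C) -> (I -> C) -> space3 R -> C) :
  (forall j, sesqui S (F j)) -> sesqui S (fun a b x => \sum_j F j a b x).
Proof.
move=> gF; suff H (r : seq J) : sesqui S (fun a b x => \sum_(j <- r) F j a b x) by [].
elim: r => [|j r IH]; first by apply: sesqui_ext (sesqui0 S) => a b x; rewrite big_nil.
by apply: sesqui_ext (sesquiD (gF j) IH) => a b x; rewrite big_cons.
Qed.

Implicit Types a b : I -> space3 R -> C.

Definition form F a b : C := cintegral D (fun x => F (a ^~ x) (b ^~ x) x).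

Definition memL2s a := forall s, memL2 D (a s).

Lemma sesqui_cintegrable S F a b : sesqui S F -> memL2s a -> memL2s b ->
  cintegrable D (fun x => F (a ^~ x) (b ^~ x) x).
Proof.
move=> [W [W1 _ W3]] ma mb.
rewrite (_ : (fun x => _) = fun x => \sum_s \sum_t W s t x * a s x * conjc (b t x)); last first.
  by apply/funext => x; rewrite W3.
apply: (cintegral_sum mD _ _).1 => s; apply: (cintegral_sum mD _ _).1 => t.
by apply: (memL2_mul mD); [exact: (memL2_bddM mD)|exact: memL2_conj].
Qed.

Lemma formD S F G a b : sesqui S F -> sesqui S G -> memL2s a -> memL2s b ->
  form (fun p q x => F p q x + G p q x) a b = form F a b + form G a b.
Proof.
move=> gF gG ma mb; rewrite /form (cintegralD mD)//; exact: sesqui_cintegrable gF ma mb || exact: sesqui_cintegrable gG ma mb.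
Qed.

Lemma formZ S F k a b : sesqui S F -> memL2s a -> memL2s b ->
  form (fun p q x => k * F p q x) a b = k * form F a b.
Proof. by move=> gF ma mb; rewrite /form (cintegralZ mD)//; exact: sesqui_cintegrable gF ma mb. Qed.

Lemma form_sum S (J : finType) (F : J -> (I -> C) -> (I -> C) -> space3 R -> C) a b :
  (forall j, sesqui S (F j)) -> memL2s a -> memL2s b ->
  form (fun p q x => \sum_j F j p q x) a b = \sum_j form (F j) a b.
Proof.
move=> gF ma mb; rewrite /form; apply: (cintegral_sum mD _ _).2 => j.
exact: sesqui_cintegrable (gF j) ma mb.
Qed.

Lemma form_linear S F (k : C) a a' b : sesqui S F -> memL2s a -> memL2s a' -> memL2s b ->
  form F (fun s x => k * a s x + a' s x) b = k * form F a b + form F a' b.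
Proof.
move=> gF ma ma' mb; have [W [W1 _ W3]] := gF.
have i1 := sesqui_cintegrable gF ma mb; have i2 := sesqui_cintegrable gF ma' mb.
rewrite /form -(cintegralZ mD)// -(cintegralD mD)//; last exact: (cintegrableZ mD).
apply: eq_cintegral => x _; rewrite !W3 mulr_sumr -big_split; apply: eq_bigr => s _ /=.
rewrite mulr_sumr -big_split; apply: eq_bigr => t _ /=.
by rewrite mulrDr mulrDl !mulrA [_ * k]mulrC.
Qed.

(** For the jet of a field, [predT] gives the H^1 norm, and the selection of the values alone gives
    the L^2 norm. *)
Definition partial_norm S a : R := Num.sqrt (\sum_(s | S s) sqnormL2 D (a s)).

Lemma partial_sum_ge0 S a : 0 <= \sum_(s | S s) sqnormL2 D (a s).
Proof. by apply: sumr_ge0 => s _; exact: sqnormL2_ge0. Qed.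

Lemma normL2_le_partial S a s : S s -> normL2 D (a s) <= partial_norm S a.
Proof.
move=> Ss; rewrite /normL2 ler_sqrt ?partial_sum_ge0// (bigD1 s)//= lerDl.
by apply: sumr_ge0 => t _; exact: sqnormL2_ge0.
Qed.

Lemma normL2_bddM f c (K : R) : cbdd D c -> (forall x, normc (c x) <= K) -> memL2 D f ->
  normL2 D (fun x => c x * f x) <= K * normL2 D f.
Proof.
move=> bc cK mf; have K0 : 0 <= K := le_trans (normc_ge0 _) (cK (0, 0, 0)).
rewrite -(@ler_pXn2r _ 2)// ?nnegrE ?mulr_ge0 ?normL2_ge0//.
by rewrite exprMn !sqr_normL2 (sqnormL2_bddM mD).
Qed.

Lemma normL2_conj f : normL2 D (fun x => conjc (f x)) = normL2 D f.
Proof. by rewrite /normL2 /sqnormL2; under eq_Rintegral do rewrite normc_conj. Qed.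

Lemma form_bounded S F : sesqui S F -> exists2 K, 0 <= K &
  forall a b, memL2s a -> memL2s b ->
    normc (form F a b) <= K * (partial_norm S a * partial_norm predT b).
Proof.
move=> [W [W1 W2 W3]].
have [K KW] : exists K : I -> I -> R, forall s t x, normc (W s t x) <= K s t.
  have /choice[K KW] : forall st : I * I, exists K : R, forall x, normc (W st.1 st.2 x) <= K.
    by move=> st; case: (W1 st.1 st.2).
  by exists (fun s t => K (s, t)) => s t x; exact: (KW (s, t)).
have K0 s t : 0 <= K s t := le_trans (normc_ge0 _) (KW s t (0, 0, 0)).
exists (\sum_s \sum_t 2 * K s t).
  by apply: sumr_ge0 => s _; apply: sumr_ge0 => t _; rewrite mulr_ge0.
move=> a b ma mb.
have iT s t : cintegrable D (fun x => W s t x * a s x * conjc (b t x)).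
  by apply: (memL2_mul mD); [exact: (memL2_bddM mD)|exact: memL2_conj].
have -> : form F a b = \sum_s \sum_t cintegral D (fun x => W s t x * a s x * conjc (b t x)).
  rewrite /form (_ : (fun x => _) = fun x => \sum_s \sum_t W s t x * a s x * conjc (b t x)); last first.
    by apply/funext => x; rewrite W3.
  rewrite (cintegral_sum mD _ _).2; last by move=> s; exact: (cintegral_sum mD _ _).1.
  by apply: eq_bigr => s _; rewrite (cintegral_sum mD _ _).2.
rewrite mulr_suml; apply: (le_trans (normc_sum _ _ _)); apply: ler_sum => s _.
rewrite mulr_suml; apply: (le_trans (normc_sum _ _ _)); apply: ler_sum => t _.
have [Ss|nS] := boolP (S s); last first.
  rewrite (_ : (fun x => _) = fun=> 0) ?cintegral0 ?normc0 ?mulr_ge0 ?sqrtr_ge0//.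
  by apply/funext => x; rewrite W2// !mul0r.
apply: (le_trans (norm_cintegral_mul mD (memL2_bddM mD (W1 s t) (ma s)) (memL2_conj (mb t)))).
rewrite -[leRHS]mulrA ler_pM2l//.
rewrite [leRHS]mulrA ler_pM ?normL2_ge0// ?normL2_conj ?normL2_le_partial//.
apply: (le_trans (normL2_bddM (W1 s t) (KW s t) (ma s))).
by rewrite ler_wpM2l// normL2_le_partial.
Qed.

Lemma partial_norm_sqrD S a b : memL2s a -> memL2s b ->
  partial_norm S (fun s x => a s x + b s x) ^+ 2 <=
  2 * partial_norm S a ^+ 2 + 2 * partial_norm S b ^+ 2.
Proof.
move=> ma mb; rewrite !sqr_sqrtr ?partial_sum_ge0// !mulr_sumr -big_split.
by apply: ler_sum => s _; exact: (sqnormL2D_le mD).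
Qed.

End SesquilinearForms.

(** * The coefficients of the layer and the form on jets *)

Section StretchCoefficients.
Context {R : realType}.
Local Notation C := R[i].
Variables (P : pml R) (d : 'I_3 -> R).
Hypothesis hP : pml_ok P d.
Implicit Types (x : space3 R) (j k : 'I_3).

(* The middle formula of [alphaf] is valid on the whole line. *)
Lemma alphafE j (t : R) : let tau := (`|t| - ell P j) / (ellbar P j - ell P j) in
  0 < hfun tau + hfun (1 - tau) /\
  alphaf P j t = alpha0 P * (hfun tau / (hfun tau + hfun (1 - tau))).
Proof.
case: hP => _ _ hl _ _ tau.
have lb : 0 < ellbar P j - ell P j by have /andP[? _] := hl j; rewrite subr_gt0.
have den : 0 < hfun tau + hfun (1 - tau).
  have [t0|t0] := ltP 0 tau; first by rewrite ltr_pwDl ?hfun_gt0 ?hfun_ge0.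
  by rewrite ltr_wpDl ?hfun_gt0 ?hfun_ge0//; lra.
split=> //; rewrite /alphaf -/tau; case: ifPn => [tl|].
  have t0 : tau <= 0 by rewrite pmulr_lle0 ?invr_gt0// subr_le0.
  by rewrite {1}/hfun ltNge t0 mul0r mulr0.
rewrite -ltNge => tl; case: ifPn => // ; rewrite -ltNge => tl2.
have t1 : 1 < tau by rewrite ltr_pdivlMr// mul1r ltrD2r.
have h0 : hfun (1 - tau) = 0 by rewrite /hfun ltNge subr_le0 ltW.
by rewrite h0 addr0 divff ?mulr1// gt_eqF// hfun_gt0 (lt_trans _ t1).
Qed.

Lemma alphaf_ge0_le j (t : R) : 0 <= alphaf P j t <= alpha0 P.
Proof.
case: hP => _ _ _ a0 _; have [den ->] := alphafE j t.
set h := hfun _ in den *; set h' := hfun _ in den *.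
have h0 : 0 <= h by exact: hfun_ge0. have h'0 : 0 <= h' by exact: hfun_ge0.
apply/andP; split.
  by apply: mulr_ge0; [exact: ltW|apply: divr_ge0 => //; exact: ltW].
by rewrite -[leRHS]mulr1 ler_pM2l// ler_pdivrMr// mul1r lerDl.
Qed.

Lemma continuous_alphaf j : continuous (alphaf P j).
Proof.
pose tau (t : R) := (`|t| - ell P j) / (ellbar P j - ell P j).
have -> : alphaf P j = fun t => alpha0 P * (hfun (tau t) / (hfun (tau t) + hfun (1 - tau t))).
  by apply/funext => t; exact: (alphafE j t).2.
have ch := smooth1_continuous (@smooth1_hfun R).
have ctau : continuous tau.
  move=> t; apply: cvgM; last exact: cvg_cst.
  by apply: cvgB; [exact: norm_continuous|exact: cvg_cst].
have c1 : continuous (fun t => hfun (tau t)).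
  by move=> t; apply: (@continuous_comp _ _ _ tau hfun); [exact: ctau|exact: ch].
have c2 : continuous (fun t => hfun (1 - tau t)).
  move=> t; apply: (@continuous_comp _ _ _ (fun t => 1 - tau t) hfun); last exact: ch.
  by apply: cvgB; [exact: cvg_cst|exact: ctau].
move=> t; apply: cvgM; first exact: cvg_cst.
apply: cvgM; first exact: c1.
by apply: cvgV; [rewrite gt_eqF//; exact: (alphafE j t).1|apply: cvgD; [exact: c1|exact: c2]].
Qed.

Lemma continuous_xcoord j : continuous (fun x => xcoord x j).
Proof.
apply: (ord3P (Q := fun j => continuous (fun x => xcoord x j))) => x.
- apply: (@continuous_comp _ _ _ (fun x : space3 R => x.1) (fun y => y.1)); exact: cvg_fst.
- apply: (@continuous_comp _ _ _ (fun x : space3 R => x.1) (fun y => y.2)).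
    exact: cvg_fst.
  exact: cvg_snd.
- exact: cvg_snd.
Qed.

(** The ratio [a / (1 + zeta a)] of imaginary to real part increases with [a], so its largest value
    is attained at [alpha0]. It lies below [1 / zeta]. *)
Definition stretch_slope := alpha0 P / (1 + zeta P * alpha0 P).

Lemma stretch_max_gt0 : 0 < 1 + zeta P * alpha0 P.
Proof. by case: hP => _ _ _ a0 z0; rewrite ltr_pwDl// mulr_ge0// ltW. Qed.

Lemma stretch_slope_ge0 : 0 <= stretch_slope.
Proof. by case: hP => _ _ _ a0 _; apply: divr_ge0; apply: ltW => //; exact: stretch_max_gt0. Qed.

Lemma stretchE j x : stretch P j x =
  ((1 + zeta P * alphaf P j (xcoord x j)) +i* alphaf P j (xcoord x j))%C.
Proof. by rewrite /stretch; apply/eqP; rewrite eq_complex /=; apply/andP; split; apply/eqP; ring. Qed.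

Lemma stretch_admissible j x : admissible stretch_slope (1 + zeta P * alpha0 P) (stretch P j x).
Proof.
case: (hP) => _ _ _ a0 z0; have /andP[al0 al1] := alphaf_ge0_le j (xcoord x j).
rewrite stretchE; move: (alphaf P j (xcoord x j)) al0 al1 => a al0 al1.
have za : 0 <= zeta P * a by rewrite mulr_ge0// ltW.
split => /=; first by lra.
  by rewrite lerD2l ler_pM2l.
  by [].
rewrite /stretch_slope mulrAC ler_pdivlMr ?stretch_max_gt0//.
nra.
Qed.

Lemma continuous_stretch j : continuous (fun x => complex.Re (stretch P j x)) /\
  continuous (fun x => complex.Im (stretch P j x)).
Proof.
have ca : continuous (fun x => alphaf P j (xcoord x j)).
  move=> x; apply: (@continuous_comp _ _ _ (fun x => xcoord x j) (alphaf P j)).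
    exact: continuous_xcoord.
  exact: continuous_alphaf.
under eq_fun do rewrite stretchE; under [X in _ /\ continuous X]eq_fun do rewrite stretchE.
split=> //= x; apply: cvgD; first exact: cvg_cst.
by apply: cvgM; [exact: cvg_cst|exact: ca].
Qed.

Lemma continuous_cbdd_meas (f : space3 R -> C) (K : R) :
  continuous (fun x => complex.Re (f x)) -> continuous (fun x => complex.Im (f x)) ->
  (forall x, normc (f x) <= K) -> cbdd_meas f.
Proof.
move=> c1 c2 fK; split; (split; first exact: continuous_measurable3); exists K => x.
  exact: le_trans (norm_Re_le _) (fK x).
exact: le_trans (norm_Im_le _) (fK x).
Qed.

Lemma stretch_neq0 j x : stretch P j x != 0.
Proof. exact: admissible_neq0 (stretch_admissible j x). Qed.

Lemma cbdd_meas_stretch j : cbdd_meas (stretch P j).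
Proof.
have [c1 c2] := continuous_stretch j.
apply: (@continuous_cbdd_meas _ ((1 + zeta P * alpha0 P) + stretch_slope * (1 + zeta P * alpha0 P))) => // x.
have [h1 h2 h3 h4] := stretch_admissible j x.
apply: (le_trans (normc_le_ReIm _)); rewrite !ger0_norm//; last by lra.
apply: lerD => //; apply: (le_trans h4).
by rewrite ler_wpM2l// stretch_slope_ge0.
Qed.

Lemma cbdd_meas_stretchV j : cbdd_meas (fun x => (stretch P j x)^-1).
Proof.
have [c1 c2] := continuous_stretch j.
have VE x : (stretch P j x)^-1 = conjc (stretch P j x) *
    ((complex.Re (stretch P j x) ^+ 2 + complex.Im (stretch P j x) ^+ 2)^-1)%:C%C.
  by case: (stretch P j x) => a b /=; apply/eqP; rewrite eq_complex /=; apply/andP; split; apply/eqP; ring.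
have n0 x : complex.Re (stretch P j x) ^+ 2 + complex.Im (stretch P j x) ^+ 2 != 0.
  have [h1 _ _ _] := stretch_admissible j x.
  by rewrite gt_eqF// ltr_pwDl ?sqr_ge0// exprn_gt0//; lra.
have cv : continuous (fun x => (complex.Re (stretch P j x) ^+ 2 + complex.Im (stretch P j x) ^+ 2)^-1).
  move=> x; apply: cvgV => //.
  by apply: cvgD; rewrite !expr2; apply: cvgM; (exact: c1 || exact: c2).
apply: (@continuous_cbdd_meas _ 1) => [||x].
- under eq_fun => x. rewrite VE (_ : complex.Re _ = complex.Re (stretch P j x) * (complex.Re (stretch P j x) ^+ 2 + complex.Im (stretch P j x) ^+ 2)^-1); last by case: (stretch P j x) => a b /=; rewrite mulr0 subr0.
  over.
  by move=> x; apply: cvgM; [exact: c1|exact: cv].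
- under eq_fun => x. rewrite VE (_ : complex.Im _ = - complex.Im (stretch P j x) * (complex.Re (stretch P j x) ^+ 2 + complex.Im (stretch P j x) ^+ 2)^-1); last by case: (stretch P j x) => a b /=; rewrite mulr0 add0r.
  over.
  by move=> x; apply: cvgM; [apply: cvgN; exact: c2|exact: cv].
- have [h1 _ _ _] := stretch_admissible j x.
  have s1 : 1 <= normc (stretch P j x) by apply: le_trans (Re_le_normc _).
  have : normc ((stretch P j x)^-1 * stretch P j x) = 1 by rewrite mulVf ?stretch_neq0// normc1.
  by rewrite normcM => E; rewrite -[leRHS]E ler_peMr// normc_ge0.
Qed.

Lemma cindep_stretch j k : k != j -> cindep j (stretch P k).
Proof.
move=> kj x t; rewrite /stretch; congr (1 + _ * (alphaf P k _)%:C%C).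
by move: j k kj; apply: ord3P => k; apply: (ord3P (Q := fun k => k != _ -> _)).
Qed.

Definition Acoef j x : C := \prod_(k | k != j) stretch P k x.

Lemma cbdd_meas_Acoef j : cbdd_meas (Acoef j).
Proof.
have E x := prod_ord3_neq (stretch P ^~ x).
move: j; apply: ord3P; rewrite /Acoef; under eq_fun do rewrite E;
  by apply: cbdd_measM; exact: cbdd_meas_stretch.
Qed.

Lemma cindep_Acoef j : cindep j (Acoef j).
Proof. by move=> x t; apply: eq_bigr => k kj; rewrite (cindep_stretch kj). Qed.

Lemma Acoef_div i j : i != j -> exists k, [/\ k != i, k != j,
  forall x, Acoef j x / stretch P i x = stretch P k x &
  forall x, Acoef i x / stretch P j x = stretch P k x].
Proof.
have E x := prod_ord3_neq (stretch P ^~ x); have n0 := stretch_neq0.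
have K1 j0 k0 x : stretch P j0 x * stretch P k0 x / stretch P j0 x = stretch P k0 x.
  by rewrite mulrAC divff ?mul1r.
have K2 j0 k0 x : stretch P j0 x * stretch P k0 x / stretch P k0 x = stretch P j0 x.
  by rewrite mulfK.
move: i j; apply: ord3P; apply: ord3P => //= _; rewrite /Acoef;
  [exists 2|exists 1|exists 2|exists 0|exists 1|exists 0]; split=> // x; by rewrite E.
Qed.

Lemma cbdd_meas_Jdet : cbdd_meas (Jdet P).
Proof.
rewrite (_ : Jdet P = fun x => Acoef 0 x * stretch P 0 x).
  by apply: cbdd_measM; [exact: cbdd_meas_Acoef|exact: cbdd_meas_stretch].
by apply/funext => x; rewrite /Jdet (bigD1 0)//= mulrC.
Qed.

End StretchCoefficients.

(** * The sesquilinear form in terms of values and derivatives *)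

Section Jets.
Context {R : realType}.
Local Notation C := R[i].
Variables (m : material R) (P : pml R) (d : 'I_3 -> R) (D : set (space3 R)).
Hypotheses (hP : pml_ok P d) (oD : open D) (bD : bounded_set D).
Implicit Types (x : space3 R) (i j : 'I_3).
Implicit Types Phi Psi : space3 R -> 'cV[C]_(3 + 1).
Local Notation vol := (@volume R).
Local Notation s := (stretch P).
Local Notation A := (Acoef P).

Let mD : measurable (D : set (mspace3 R)) := open_measurable3 oD.
Let fD : (vol D < +oo)%E := bounded_set_volume bD mD.

(* [inl k] stands for the k-th component of a field and [inr (k, j)] for its j-th
   derivative; [u] and [p] single out displacement and temperature. *)
Definition jet_index := ('I_(3 + 1) + 'I_(3 + 1) * 'I_3)%type.
Definition uval i : jet_index := inl (lshift 1 i).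
Definition uder i j : jet_index := inr (lshift 1 i, j).
Definition pval : jet_index := inl (rshift 3 0).
Definition pder j : jet_index := inr (rshift 3 0, j).

(** Summed over [i] and [j], this is the contraction of the stress with the gradient of the test
    field. The trace term is spread over all pairs: [i] is its place on the diagonal and [j] the
    index of the trace. *)
Definition elastic_term i j (a b : jet_index -> C) x : C :=
  (mu m)%:C%C * (A j x / s j x) * a (uder i j) * conjc (b (uder i j)) +
  (mu m)%:C%C * (A j x / s i x) * a (uder j i) * conjc (b (uder i j)) +
  (lam m)%:C%C * (A i x / s j x) * a (uder j j) * conjc (b (uder i i)).

Definition thermal_term j (a b : jet_index -> C) x : C :=
  - (therm_gamma m)%:C%C * A j x * a pval * conjc (b (uder j j)) +
  (A j x / s j x) * a (pder j) * conjc (b (pder j)).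

Definition density0 (a b : jet_index -> C) x : C :=
  \sum_i \sum_j elastic_term i j a b x + \sum_j thermal_term j a b x.

Definition density1 (a b : jet_index -> C) x : C :=
  - ((0 +i* 1)%C / (kappa m)%:C%C) * Jdet P x * a pval * conjc (b pval) +
  \sum_j - ((0 +i* 1)%C * (therm_eta m)%:C%C) * A j x * a (uder j j) * conjc (b pval).

Definition density2 (a b : jet_index -> C) x : C :=
  \sum_j - (rho m)%:C%C * Jdet P x * a (uval j) * conjc (b (uval j)).

Lemma cbddZ_meas (k : C) (f : space3 R -> C) : cbdd_meas f -> cbdd D (fun x => k * f x).
Proof. by move=> bf; apply: cbddM; [exact: cbdd_cst|exact: cbdd_meas_cbdd]. Qed.

Lemma cbdd_ratio i j : cbdd_meas (fun x => A j x / s i x).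
Proof. by apply: cbdd_measM; [exact: cbdd_meas_Acoef hP _|exact: cbdd_meas_stretchV hP _]. Qed.

Lemma sesqui_elastic_term i j : sesqui D predT (elastic_term i j).
Proof.
apply: sesquiD; first apply: sesquiD.
- apply: (@sesqui_monomial _ _ _ _ _ _ (fun x => (mu m)%:C%C * (A j x / s j x))) => //.
  by apply: cbddZ_meas; exact: cbdd_ratio.
- apply: (@sesqui_monomial _ _ _ _ _ _ (fun x => (mu m)%:C%C * (A j x / s i x))) => //.
  by apply: cbddZ_meas; exact: cbdd_ratio.
- apply: (@sesqui_monomial _ _ _ _ _ _ (fun x => (lam m)%:C%C * (A i x / s j x))) => //.
  by apply: cbddZ_meas; exact: cbdd_ratio.
Qed.

Lemma sesqui_thermal_term j : sesqui D predT (thermal_term j).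
Proof.
apply: sesquiD.
- apply: (@sesqui_monomial _ _ _ _ _ _ (fun x => - (therm_gamma m)%:C%C * A j x)) => //.
  by apply: cbddZ_meas; exact: cbdd_meas_Acoef hP _.
- apply: (@sesqui_monomial _ _ _ _ _ _ (fun x => A j x / s j x)) => //.
  by apply: cbdd_meas_cbdd; exact: cbdd_ratio.
Qed.

Lemma sesqui_density0 : sesqui D predT density0.
Proof.
apply: sesquiD; last by apply: sesqui_sum => j; exact: sesqui_thermal_term.
by apply: sesqui_sum => i; apply: sesqui_sum => j; exact: sesqui_elastic_term.
Qed.

Lemma sesqui_density1 : sesqui D predT density1.
Proof.
apply: sesquiD; last apply: sesqui_sum => j.
- apply: (@sesqui_monomial _ _ _ _ _ _ (fun x => - ((0 +i* 1)%C / (kappa m)%:C%C) * Jdet P x)) => //.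
  by apply: cbddZ_meas; exact: cbdd_meas_Jdet hP.
- apply: (@sesqui_monomial _ _ _ _ _ _ (fun x => - ((0 +i* 1)%C * (therm_eta m)%:C%C) * A j x)) => //.
  by apply: cbddZ_meas; exact: cbdd_meas_Acoef hP _.
Qed.

Lemma sesqui_density2 (S : pred jet_index) : (forall j, S (uval j)) -> sesqui D S density2.
Proof.
move=> Sv; apply: sesqui_sum => j.
apply: (@sesqui_monomial _ _ _ _ _ _ (fun x => - (rho m)%:C%C * Jdet P x)) => //.
by apply: cbddZ_meas; exact: cbdd_meas_Jdet hP.
Qed.

(** Any versions of the weak derivatives are accepted, so that a test field may be given its
    classical derivatives. *)
Definition is_jet Phi (a : jet_index -> space3 R -> C) : Prop :=
  (forall k, memL2 D (fun x => Phi x k 0) /\ a (inl k) = fun x => Phi x k 0) /\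
  forall k j, is_wderiv D j (fun x => Phi x k 0) (a (inr (k, j))).

Lemma is_jet_memL2s Phi a : is_jet Phi a -> memL2s D a.
Proof.
move=> [a1 a2] [k|[k j]]; first by have [mk ->] := a1 k.
by have [] := a2 k j.
Qed.

Lemma memH10_4_jet Phi : memH10_4 D Phi -> exists a, is_jet Phi a.
Proof.
move=> hPhi; exists (fun t => match t with inl k => fun x => Phi x k 0
  | inr kj => wderiv D kj.2 (fun x => Phi x kj.1 0) end).
split=> [k|k j] /=; first by split => //; have [[]] := hPhi k.
by have [[_ /(_ j)[g gk]] _] := hPhi k; exact: is_wderiv_wderiv gk.
Qed.

Lemma normH1_4_jet Phi a : is_jet Phi a -> normH1_4 D Phi = partial_norm D predT a.
Proof.
move=> [a1 a2]; rewrite /normH1_4 /partial_norm; congr Num.sqrt.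
rewrite big_sumType /=.
under eq_bigr do rewrite (sqnormH1_wderiv oD bD (a2 _)).
rewrite big_split; congr (_ + _); last by rewrite pair_bigA; apply: eq_bigr => -[].
by apply: eq_bigr => k _; have [_ ->] := a1 k.
Qed.

Let stress_termE (e : bool) (M L g g' t a h s1 s2 : C) :
  (M * (g / s1 + g' / s2) + (L * t) *+ e) * a * h =
  M * (a / s1) * g * h + M * (a / s2) * g' * h + (if e then L * t * a * h else 0).
Proof. by case: e; rewrite ?mulr1n ?mulr0n; ring. Qed.

Let dilatation_termE (L g s1 a h : C) : L * (g / s1) * a * h = L * (a / s1) * g * h.
Proof. by ring. Qed.

Let eq_sum6 (a1 a2 a3 a4 a5 a6 b1 b2 b3 b4 b5 b6 : C) : a1 = b1 -> a2 = b2 ->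
  a3 = b3 -> a4 = b4 -> a5 = b5 -> a6 = b6 ->
  a1 - a2 - a3 + a4 - a5 - a6 = b1 - b2 - b3 + b4 - b5 - b6.
Proof. by move=> -> -> -> -> -> ->. Qed.

(** A purely algebraic expansion, valid at every point. The weak derivatives of conjugates and of
    products with [A j] are left untouched, since rewriting them is legitimate only almost
    everywhere. *)
Lemma sesqform_integrandE (omega : C) Phi Psi x :
  let u := disp Phi in let p := temp Phi in
  let ubar' := fun x => map_mx conjc (disp Psi x) in
  let pbar' := fun x => conjc (temp Psi x) in
  let q := (0 +i* 1)%C * omega / (kappa m)%:C%C in
  let G i j := wderiv D j (fun y => Phi y (lshift 1 i) 0) x in
  let H i j := wderiv D j (fun y => conjc (Psi y (lshift 1 i) 0)) x in
  mxdot (stress P m D u x *m Amx P x) (wjacobian D ubar' x)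
    - (rho m)%:C%C * omega ^+ 2 * Jdet P x * dotv (u x) (ubar' x)
    - (therm_gamma m)%:C%C * p x * wdiv D (fun y => Amx P y *m ubar' y) x
    + dotv (wgrad D pbar' x) (Kmx P x *m wgrad D p x)
    - q * Jdet P x * p x * pbar' x
    - (0 +i* 1)%C * omega * (therm_eta m)%:C%C * pbar' x
        * wdiv D (fun y => Amx P y *m u y) x =
  \sum_i \sum_j ((mu m)%:C%C * (A j x / s j x) * G i j * H i j +
    (mu m)%:C%C * (A j x / s i x) * G j i * H i j +
    (lam m)%:C%C * (A i x / s j x) * G j j * H i i)
  - (rho m)%:C%C * omega ^+ 2 * Jdet P x *
      (\sum_j Phi x (lshift 1 j) 0 * conjc (Psi x (lshift 1 j) 0))
  - (therm_gamma m)%:C%C * Phi x (rshift 3 0) 0 *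
      (\sum_j wderiv D j (fun y => A j y * conjc (Psi y (lshift 1 j) 0)) x)
  + \sum_j (wderiv D j (fun y => conjc (Psi y (rshift 3 0) 0)) x *
      (A j x / s j x * wderiv D j (fun y => Phi y (rshift 3 0) 0) x))
  - q * Jdet P x * Phi x (rshift 3 0) 0 * conjc (Psi x (rshift 3 0) 0)
  - (0 +i* 1)%C * omega * (therm_eta m)%:C%C * conjc (Psi x (rshift 3 0) 0) *
      (\sum_j wderiv D j (fun y => A j y * Phi y (lshift 1 j) 0) x).
Proof.
move=> u p ubar' pbar' q G H.
have pE : p = fun y => Phi y (rshift 3 0) 0 by apply/funext => y; rewrite /p /temp mxE.
have pbE : pbar' = fun y => conjc (Psi y (rshift 3 0) 0).
  by apply/funext => y; rewrite /pbar' /temp mxE.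
have uE j : (fun y => u y j 0) = fun y => Phi y (lshift 1 j) 0.
  by apply/funext => y; rewrite /u /disp mxE.
have ubE j : (fun y => ubar' y j 0) = fun y => conjc (Psi y (lshift 1 j) 0).
  by apply/funext => y; rewrite /ubar' /disp !mxE.
apply: eq_sum6.
- rewrite /mxdot.
  have strE i j : strain P D u x i j = 2^-1 * (G i j / s j x + G j i / s i x).
    rewrite /strain /Bmx tr_diag_mx mul_mx_diag mul_diag_mx !mxE.
    by rewrite !uE [_ * G _ _]mulrC.
  have half2 (y : C) : 2^-1 * (y + y) = y.
    have -> : y + y = 2 * y by ring.
    by rewrite mulKf// pnatr_eq0.
  have trE : \tr (strain P D u x) = \sum_k G k k / s k x.
    rewrite /mxtrace; apply: eq_bigr => k _; rewrite strE.
    exact: half2.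
  have termE i j : (stress P m D u x *m Amx P x) i j * wjacobian D ubar' x i j =
      (mu m)%:C%C * (A j x / s j x) * G i j * H i j +
      (mu m)%:C%C * (A j x / s i x) * G j i * H i j +
      (if i == j then (lam m)%:C%C * (\sum_k G k k / s k x) * A i x * H i i else 0).
    rewrite /stress /Amx mul_mx_diag.
    rewrite [in X in X * _]mxE [in X in X * _]mxE [in X in X * _]mxE strE [in X in _ * X]mxE ubE.
    rewrite [in X in _ + X]mxE [in X in _ * X * _]mxE trE -/(A j x) -/(H i j).
    have -> : (2 * mu m)%:C%C = 2 * (mu m)%:C%C by rewrite rmorphM rmorph_nat.
    have n2 : 2 * 2^-1 = 1 :> C by rewrite divff// pnatr_eq0.
    have -> : 2 * (mu m)%:C%C * (2^-1 * (G i j / s j x + G j i / s i x)) =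
        (mu m)%:C%C * (G i j / s j x + G j i / s i x).
      by rewrite mulrCA !mulrA [2^-1 * 2]mulrC n2 mul1r.
    by case: eqP => [->|_]; [exact: (stress_termE true)|exact: (stress_termE false)].
  under eq_bigr => i _ do under eq_bigr => j _ do rewrite termE.
  apply: eq_bigr => i _; rewrite big_split [in RHS]big_split; congr (_ + _).
  rewrite -big_mkcond (big_pred1 i) => [|j]; last by rewrite /= eq_sym.
  rewrite mulr_sumr !mulr_suml; apply: eq_bigr => k _.
  exact: dilatation_termE.
- congr (_ * _); apply: eq_bigr => j _.
  by rewrite -[u x j 0]/((fun y => u y j 0) x) uE -[ubar' x j 0]/((fun y => ubar' y j 0) x) ubE.
- rewrite pE; congr (_ * _); apply: eq_bigr => j _; congr (wderiv D j _ x).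
  apply/funext => y; rewrite /Amx mul_diag_mx mxE [in X in X * _]mxE.
  by rewrite -[ubar' y j 0]/((fun y => ubar' y j 0) y) ubE.
- rewrite /dotv; apply: eq_bigr => j _.
  by rewrite /Kmx mul_diag_mx !mxE pE pbE.
- by rewrite pE pbE.
- rewrite pbE; congr (_ * _); apply: eq_bigr => j _; congr (wderiv D j _ x).
  apply/funext => y; rewrite /Amx mul_diag_mx mxE [in X in X * _]mxE.
  by rewrite -[u y j 0]/((fun y => u y j 0) y) uE.
Qed.

End Jets.

Section SesqformJets.
Context {R : realType}.
Local Notation C := R[i].
Variables (m : material R) (P : pml R) (d : 'I_3 -> R) (D : set (space3 R)).
Hypotheses (hP : pml_ok P d) (oD : open D) (bD : bounded_set D).
Implicit Types (x : space3 R) (i j : 'I_3).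
Implicit Types Phi Psi : space3 R -> 'cV[C]_(3 + 1).
Local Notation vol := (@volume R).
Local Notation s := (stretch P).
Local Notation A := (Acoef P).

Let mD : measurable (D : set (mspace3 R)) := open_measurable3 oD.
Let fD : (vol D < +oo)%E := bounded_set_volume bD mD.

Lemma cmeasB f g : cmeas D f -> cmeas D g -> cmeas D (fun x => f x - g x).
Proof.
move=> mf mg; rewrite (_ : (fun x => _) = fun x => f x + -1 * g x).
  by apply: cmeasD => //; apply: cmeasM => //; exact: cmeas_cst.
by apply/funext => x; rewrite mulN1r.
Qed.

Lemma density_sumE (omega : C) (a b : jet_index -> C) x :
  density0 m P a b x + omega * density1 m P a b x + omega ^+ 2 * density2 m P a b x =
  \sum_i \sum_j ((mu m)%:C%C * (A j x / s j x) * a (uder i j) * conjc (b (uder i j)) +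
    (mu m)%:C%C * (A j x / s i x) * a (uder j i) * conjc (b (uder i j)) +
    (lam m)%:C%C * (A i x / s j x) * a (uder j j) * conjc (b (uder i i)))
  - (rho m)%:C%C * omega ^+ 2 * Jdet P x *
      (\sum_j a (uval j) * conjc (b (uval j)))
  - (therm_gamma m)%:C%C * a pval *
      (\sum_j A j x * conjc (b (uder j j)))
  + \sum_j (conjc (b (pder j)) * (A j x / s j x * a (pder j)))
  - (0 +i* 1)%C * omega / (kappa m)%:C%C * Jdet P x * a pval * conjc (b pval)
  - (0 +i* 1)%C * omega * (therm_eta m)%:C%C * conjc (b pval) *
      (\sum_j A j x * a (uder j j)).
Proof.
have -> : density1 m P a b x =
    - ((0 +i* 1)%C / (kappa m)%:C%C) * Jdet P x * a pval * conjc (b pval) -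
    (0 +i* 1)%C * (therm_eta m)%:C%C * conjc (b pval) * (\sum_j A j x * a (uder j j)).
  rewrite /density1; congr (_ + _); rewrite -[RHS]mulNr mulr_sumr; apply: eq_bigr => j _.
  move: (A j x) (a (uder j j)) (conjc (b pval)) => y z w; ring.
have -> : density2 m P a b x =
    - (rho m)%:C%C * Jdet P x * (\sum_j a (uval j) * conjc (b (uval j))).
  rewrite /density2 mulr_sumr; apply: eq_bigr => j _; exact: esym (mulrA _ _ _).
have -> : density0 m P a b x = \sum_i \sum_j elastic_term m P i j a b x +
    (- (therm_gamma m)%:C%C * a pval * (\sum_j A j x * conjc (b (uder j j))) +
     \sum_j (conjc (b (pder j)) * (A j x / s j x * a (pder j)))).
  rewrite /density0; congr (_ + _); rewrite mulr_sumr -big_split; apply: eq_bigr => j _ /=.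
  rewrite /thermal_term; congr (_ + _); last by rewrite [RHS]mulrC.
  by rewrite -!mulrA; congr (_ * _); rewrite mulrCA.
rewrite -[X in _ = X - _ - _ + _ - _ - _]/(\sum_i \sum_j elastic_term m P i j a b x).
move: (\sum_i \sum_j elastic_term m P i j a b x) => S1.
move: (\sum_j a (uval j) * conjc (b (uval j))) (\sum_j A j x * conjc (b (uder j j))) => S2 S3.
move: (\sum_j conjc (b (pder j)) * (A j x / s j x * a (pder j))) (\sum_j A j x * a (uder j j)) => S4 S5.
move: (a pval) (conjc (b pval)) (Jdet P x) ((kappa m)%:C%C) ((rho m)%:C%C) ((therm_gamma m)%:C%C)
  ((therm_eta m)%:C%C) => p q J ka ro ga et; ring.
Qed.

(** Since [A j] does not depend on the coordinate [j], the weak divergences contain no derivative of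
    the layer coefficients. Conjugation and this product rule identify the two integrands almost
    everywhere, which suffices because both are measurable. *)
Lemma sesqform_jet (omega : C) Phi Psi a b : memH10_4 D Phi -> memH10_4 D Psi ->
  is_jet D Phi a -> is_jet D Psi b ->
  sesqform P m D omega Phi Psi = form D (density0 m P) a b +
    omega * form D (density1 m P) a b + omega ^+ 2 * form D (density2 m P) a b.
Proof.
move=> hPhi hPsi ja jb; have ma := is_jet_memL2s ja; have mb := is_jet_memL2s jb.
have [a1 a2] := ja; have [b1 b2] := jb.
have s0 := sesqui_density0 m D hP; have s1 := sesqui_density1 m D hP.
have s2 : sesqui D predT (density2 m P) := sesqui_density2 m D hP (fun _ => isT).
have wG k j := wderiv_ae oD bD (a2 k j).
have wc k j := is_wderiv_conj oD bD (b1 k).1 (b2 k j).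
have wH k j := wderiv_ae oD bD (wc k j).
have wAu k j := is_wderivM oD bD (hPhi k) (a2 k j) (cbdd_meas_Acoef hP j) (@cindep_Acoef _ P j).
(* [is_wderivM] asks for a factor in H^1_0, known here for [Psi] and not for its conjugate. The rule
   is applied to [conjc (A j)] times [Psi], and the result is conjugated. *)
have wAc k j : is_wderiv D j (fun x => A j x * conjc (Psi x k 0)) (fun x => A j x * conjc (b (inr (k, j)) x)).
  have bA := cbdd_meas_conj (cbdd_meas_Acoef hP j).
  have iA : cindep j (fun x => conjc (A j x)) by move=> x t; rewrite cindep_Acoef.
  have := is_wderivM oD bD (hPsi k) (b2 k j) bA iA.
  move=> /(is_wderiv_conj oD bD); rewrite (_ : (fun x => conjc (conjc _ * _)) = fun x => A j x * conjc (Psi x k 0)).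
    rewrite (_ : (fun x => conjc (conjc _ * _)) = fun x => A j x * conjc (b (inr (k, j)) x)).
      by apply; apply: (memL2_bddM mD) => //; [exact: cbdd_meas_cbdd|exact: (b1 k).1].
    by apply/funext => x; rewrite rmorphM/= conjcK.
  by apply/funext => x; rewrite rmorphM/= conjcK.
have wDA j := wderiv_ae oD bD (wAu (lshift 1 j) j).
have wDAc j := wderiv_ae oD bD (wAc (lshift 1 j) j).
rewrite -(formZ mD _ s1)// -(formZ mD _ s2)//.
have z1 := sesquiZ (cbdd_cst D omega) s1; have z2 := sesquiZ (cbdd_cst D (omega ^+ 2)) s2.
rewrite -(formD mD s0 z1)// -(formD mD (sesquiD s0 z1) z2)//.
rewrite /sesqform /form.
under eq_cintegral do rewrite sesqform_integrandE.
apply: (ae_cintegral mD).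
- have mA j : cmeas D (A j) by apply: (cbdd_meas_cbdd D _).1; exact: cbdd_meas_Acoef hP _.
  have mr i j : cmeas D (fun x => A j x / s i x) by apply: (cbdd_meas_cbdd D _).1; exact: cbdd_ratio hP _ _.
  have mJ : cmeas D (Jdet P) by apply: (cbdd_meas_cbdd D _).1; exact: cbdd_meas_Jdet hP.
  have mk c : cmeas D (fun=> c) by exact: cmeas_cst.
  have m1 k j : cmeas D (wderiv D j (fun y => Phi y k 0)).
    by apply: memL2_cmeas; have [] := is_wderiv_wderiv (a2 k j).
  have m2 k j : cmeas D (wderiv D j (fun y => conjc (Psi y k 0))).
    by apply: memL2_cmeas; have [] := is_wderiv_wderiv (wc k j).
  have m3 k j : cmeas D (wderiv D j (fun x => A j x * Phi x k 0)).
    by apply: memL2_cmeas; have [] := is_wderiv_wderiv (wAu k j).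
  have m4 k j : cmeas D (wderiv D j (fun x => A j x * conjc (Psi x k 0))).
    by apply: memL2_cmeas; have [] := is_wderiv_wderiv (wAc k j).
  have m5 k : cmeas D (fun x => Phi x k 0) := memL2_cmeas (a1 k).1.
  have m6 k : cmeas D (fun x => conjc (Psi x k 0)) := cmeas_conj (memL2_cmeas (b1 k).1).
  have M := @cmeasM _ D; pose p : 'I_(3 + 1) := rshift 3 0.
  have T1 := cmeas_sum (fun i => cmeas_sum (fun j => cmeasD (cmeasD
    (M _ _ (M _ _ (M _ _ (mk (mu m)%:C%C) (mr j j)) (m1 (lshift 1 i) j)) (m2 (lshift 1 i) j))
    (M _ _ (M _ _ (M _ _ (mk (mu m)%:C%C) (mr i j)) (m1 (lshift 1 j) i)) (m2 (lshift 1 i) j)))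
    (M _ _ (M _ _ (M _ _ (mk (lam m)%:C%C) (mr j i)) (m1 (lshift 1 j) j)) (m2 (lshift 1 i) i)))).
  have T2 := M _ _ (M _ _ (mk ((rho m)%:C%C * omega ^+ 2)) mJ)
    (cmeas_sum (fun j => M _ _ (m5 (lshift 1 j)) (m6 (lshift 1 j)))).
  have T3 := M _ _ (M _ _ (mk (therm_gamma m)%:C%C) (m5 p)) (cmeas_sum (fun j => m4 (lshift 1 j) j)).
  have T4 := cmeas_sum (fun j => M _ _ (m2 p j) (M _ _ (mr j j) (m1 p j))).
  have T5 := M _ _ (M _ _ (M _ _ (mk ((0 +i* 1)%C * omega / (kappa m)%:C%C)) mJ) (m5 p)) (m6 p).
  have T6 := M _ _ (M _ _ (mk ((0 +i* 1)%C * omega * (therm_eta m)%:C%C)) (m6 p))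
    (cmeas_sum (fun j => m3 (lshift 1 j) j)).
  exact (cmeasB (cmeasB (cmeasD (cmeasB (cmeasB T1 T2) T3) T4) T5) T6).
- exact: cintegrable_cmeas (sesqui_cintegrable mD (sesquiD (sesquiD s0 z1) z2) ma mb).
have all1 (I : finType) (p : I -> space3 R -> Prop) :
    (forall t, {ae vol, forall x, p t x}) -> {ae vol, forall x : mspace3 R, forall t, p t x}.
  exact: filter_forall.
have G' := all1 _ _ (fun kj => wG kj.1 kj.2); have H' := all1 _ _ (fun kj => wH kj.1 kj.2).
have DA' := all1 _ _ wDA; have DAc' := all1 _ _ wDAc.
apply: filterS2 (filterI G' H') (filterI DA' DAc') => x [Gx Hx] [DAx DAcx] Dx.
have {}Gx k j := Gx (k, j) Dx; have {}Hx k j := Hx (k, j) Dx.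
have {}DAx j := DAx j Dx; have {}DAcx j := DAcx j Dx.
have aE k : a (inl k) x = Phi x k 0 by rewrite (a1 k).2.
have bE k : b (inl k) x = Psi x k 0 by rewrite (b1 k).2.
rewrite density_sumE /uval /pval /uder /pder !aE !bE.
congr (_ - _ - _ + _ - _ - _).
- by apply: eq_bigr => i _; apply: eq_bigr => j _; rewrite !Gx !Hx.
- by congr (_ * _); apply: eq_bigr => j _; rewrite aE bE.
- by congr (_ * _); apply: eq_bigr => j _; rewrite DAcx.
- by apply: eq_bigr => j _; rewrite Gx Hx.
- by congr (_ * _); apply: eq_bigr => j _; rewrite DAx.
Qed.

End SesqformJets.

(** * Test fields *)

Section TestFields.
Context {R : realType}.
Local Notation C := R[i].
Variables (m : material R) (P : pml R) (d : 'I_3 -> R) (D : set (space3 R)).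
Hypotheses (hP : pml_ok P d) (oD : open D) (bD : bounded_set D).
Implicit Types (x : space3 R) (i j : 'I_3).
Implicit Types Phi Psi : space3 R -> 'cV[C]_(3 + 1).
Local Notation vol := (@volume R).
Local Notation s := (stretch P).
Local Notation A := (Acoef P).

Let mD : measurable (D : set (mspace3 R)) := open_measurable3 oD.
Let fD : (vol D < +oo)%E := bounded_set_volume bD mD.

Definition test_field Phi := forall k, ctest D (fun x => Phi x k 0).

Definition tjet Phi : jet_index -> space3 R -> C := fun t => match t with
  | inl k => fun x => Phi x k 0
  | inr kj => cpderiv kj.2 (fun x => Phi x kj.1 0) end.

Lemma tjet_is_jet Phi : test_field Phi -> is_jet D Phi (tjet Phi).
Proof.
move=> tPhi; split=> [k|k j]; last exact: ctest_is_wderiv.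
by split => //; exact: ctest_memL2.
Qed.

Lemma tjet_ctest Phi t : test_field Phi -> ctest D (tjet Phi t).
Proof. by move=> tPhi; case: t => [k|[k j]] //=; exact: ctest_cpderiv. Qed.

Lemma tjet_memL2s Phi : test_field Phi -> memL2s D (tjet Phi).
Proof. by move=> tPhi t; apply: (ctest_memL2 oD bD); exact: tjet_ctest. Qed.

Lemma sqnormL2_cst0 : sqnormL2 D (fun=> 0) = 0.
Proof.
rewrite /sqnormL2 (_ : (fun x => _) = fun=> 0); first by rewrite Rintegral_cst// mul0r.
by apply/funext => x; rewrite normc0 expr0n.
Qed.

Lemma ctest_memH10 f : ctest D f -> memH10 D f.
Proof.
move=> tf; have mf := ctest_memL2 oD bD tf.
split; first by split => // j; exists (cpderiv j f); exact: ctest_is_wderiv.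
move=> e e0; exists (fun x => complex.Re (f x)), (fun x => complex.Im (f x)).
case: (tf) => t1 t2; split => //.
rewrite (_ : (fun x => _) = fun=> 0); last first.
  by apply/funext => x; case: (f x) => a b /=; rewrite subrr.
have [t0 p0] := ctest0 D.
rewrite (@sqnormH1_wderiv _ _ oD bD _ (fun j => cpderiv j (fun=> 0))); last first.
  by move=> j; exact: ctest_is_wderiv.
rewrite sqnormL2_cst0 big1 ?addr0 ?sqrtr0// => j _.
by rewrite p0 sqnormL2_cst0.
Qed.

Lemma tjet_linear k Phi Psi : test_field Phi -> test_field Psi ->
  test_field (fun x => k *: Phi x + Psi x) /\
  tjet (fun x => k *: Phi x + Psi x) = fun t x => k * tjet Phi t x + tjet Psi t x.
Proof.
move=> tPhi tPsi.
have E l : (fun x => (k *: Phi x + Psi x) l 0) = fun x => k * Phi x l 0 + Psi x l 0.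
  by apply/funext => x; rewrite !mxE.
have Z l := ctestZ k (tPhi l).
have S l := ctestD (Z l).1 (tPsi l).
split; first by move=> l; rewrite E; exact: (S l).1.
apply/funext => -[l|[l j]] /=; rewrite E//.
by rewrite (S l).2 (Z l).2.
Qed.

Lemma ctest_conj f : ctest D f -> ctest D (fun x => conjc (f x)) /\
  forall j, cpderiv j (fun x => conjc (f x)) = fun x => conjc (cpderiv j f x).
Proof.
move=> [t1 t2].
have E1 : (fun x => complex.Re (conjc (f x))) = fun x => complex.Re (f x).
  by apply/funext => x; case: (f x).
have E2 : (fun x => complex.Im (conjc (f x))) = (-1) \*o (fun x => complex.Im (f x)).
  by apply/funext => x /=; case: (f x) => a b /=; rewrite mulN1r.
split; first by split; rewrite (E1, E2)//; exact: test_functionZ.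
by move=> j; apply/funext => x; rewrite /cpderiv E1 E2 (pderivZ _ j t2.1)/= mulN1r.
Qed.

(* integrate by parts in x_j, then in x_i *)
Lemma cintegral_swap w f g i j : cbdd_meas w -> cindep i w -> cindep j w ->
  ctest D f -> ctest D g ->
  cintegral D (fun x => w x * cpderiv i f x * conjc (cpderiv j g x)) =
  cintegral D (fun x => w x * cpderiv j f x * conjc (cpderiv i g x)).
Proof.
move=> bw wi wj tf tg; have [tc dc] := ctest_conj tg.
have ibp i0 j0 : cindep j0 w -> cintegral D (fun x => w x * cpderiv i0 f x * conjc (cpderiv j0 g x)) =
    - cintegral D (fun x => w x * cpderiv j0 (cpderiv i0 f) x * conjc (g x)).
  by move=> w0; rewrite -(cintegration_by_parts oD bD bw w0 (ctest_cpderiv i0 tf) tc) dc.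
by rewrite (ibp i j wj) (ibp j i wi) (cpderivC j i tf).
Qed.

Definition swapped_term i j (a b : jet_index -> C) x : C :=
  if i == j then (lam m + 2 * mu m)%:C%C * (A j x / s j x) * a (uder j j) * conjc (b (uder j j))
  else (mu m)%:C%C * (A j x / s j x) * a (uder i j) * conjc (b (uder i j)) +
    (lam m + mu m)%:C%C * (A j x / s i x) * a (uder j j) * conjc (b (uder i i)).

Lemma sesqui_swapped_term i j : sesqui D predT (swapped_term i j).
Proof.
rewrite /swapped_term; case: eqP => _.
  apply: (@sesqui_monomial _ _ _ _ _ _ (fun x => (lam m + 2 * mu m)%:C%C * (A j x / s j x))) => //.
  by apply: cbddZ_meas; exact: cbdd_ratio hP _ _.
apply: sesquiD.
- apply: (@sesqui_monomial _ _ _ _ _ _ (fun x => (mu m)%:C%C * (A j x / s j x))) => //.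
  by apply: cbddZ_meas; exact: cbdd_ratio hP _ _.
- apply: (@sesqui_monomial _ _ _ _ _ _ (fun x => (lam m + mu m)%:C%C * (A j x / s i x))) => //.
  by apply: cbddZ_meas; exact: cbdd_ratio hP _ _.
Qed.

(** For [i != j] the shear and the dilatation products carry the same coefficient, a stretch factor
    independent of both coordinates. The exchange of derivatives turns the first product into the
    second, so that their weights add up. On the diagonal the three terms already coincide. *)
Lemma form_swapped i j Phi Psi : test_field Phi -> test_field Psi ->
  form D (elastic_term m P i j) (tjet Phi) (tjet Psi) =
  form D (swapped_term i j) (tjet Phi) (tjet Psi).
Proof.
move=> tPhi tPsi; have ma := tjet_memL2s tPhi; have mb := tjet_memL2s tPsi.
rewrite /swapped_term; case: eqP => [->|/eqP ij].
  apply: eq_cintegral => x _; rewrite /elastic_term.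
  by rewrite rmorphD rmorphM rmorph_nat; ring.
have [k [ki kj Ejk Eij]] := Acoef_div hP ij.
have bk := cbdd_meas_stretch hP k.
have ik := cindep_stretch P ki; have jk := cindep_stretch P kj.
pose T c t u (a b : jet_index -> C) x := c * s k x * a t * conjc (b u).
have sT c t u : sesqui D predT (T c t u).
  apply: (@sesqui_monomial _ _ _ _ _ _ (fun x => c * s k x)) => //.
  exact: cbddZ_meas.
pose U (a b : jet_index -> C) x := (mu m)%:C%C * (A j x / s j x) * a (uder i j) * conjc (b (uder i j)).
have sU : sesqui D predT U.
  apply: (@sesqui_monomial _ _ _ _ _ _ (fun x => (mu m)%:C%C * (A j x / s j x))) => //.
  by apply: cbddZ_meas; exact: cbdd_ratio hP _ _.
transitivity (form D (fun a b x => U a b x + T (mu m)%:C%C (uder j i) (uder i j) a b x +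
    T (lam m)%:C%C (uder j j) (uder i i) a b x) (tjet Phi) (tjet Psi)).
  by apply: eq_cintegral => x _; rewrite /elastic_term /U /T Ejk Eij.
transitivity (form D (fun a b x => U a b x + T (lam m + mu m)%:C%C (uder j j) (uder i i) a b x)
    (tjet Phi) (tjet Psi)); last first.
  by apply: eq_cintegral => x _; rewrite /U /T Ejk.
rewrite (formD mD (sesquiD sU (sT _ _ _)) (sT _ _ _))// (formD mD sU (sT _ _ _))//.
rewrite (formD mD sU (sT _ _ _))// -addrA; congr (_ + _).
have TE c t u : form D (T c t u) (tjet Phi) (tjet Psi) = c * form D (T 1 t u) (tjet Phi) (tjet Psi).
  rewrite -(formZ mD _ (sT _ _ _))//; apply: eq_cintegral => x _.
  by rewrite /T mul1r !mulrA.
rewrite (TE (mu m)%:C%C (uder j i)) (TE (lam m)%:C%C) (TE (lam m + mu m)%:C%C).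
have -> : form D (T 1 (uder j i) (uder i j)) (tjet Phi) (tjet Psi) =
    form D (T 1 (uder j j) (uder i i)) (tjet Phi) (tjet Psi).
  rewrite /form /T /=; under eq_cintegral do rewrite mul1r.
  rewrite (cintegral_swap bk ik jk (tPhi _) (tPsi _)).
  by apply: eq_cintegral => x _; rewrite mul1r.
move: (form D (T 1 (uder j j) (uder i i)) (tjet Phi) (tjet Psi)) => Y.
by rewrite [in RHS]rmorphD [RHS]mulrDl addrC.
Qed.

Definition is_val : pred jet_index := fun t => match t with inl _ => true | inr _ => false end.

(* [density1] with the divergence moved to the second argument by parts, so that
   the first one enters without derivatives. *)
Definition density1v (a b : jet_index -> C) x : C :=
  - ((0 +i* 1)%C / (kappa m)%:C%C) * Jdet P x * a pval * conjc (b pval) +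
  \sum_j ((0 +i* 1)%C * (therm_eta m)%:C%C) * A j x * a (uval j) * conjc (b (pder j)).

Lemma sesqui_density1v : sesqui D is_val density1v.
Proof.
apply: sesquiD; last apply: sesqui_sum => j.
- apply: (@sesqui_monomial _ _ _ _ _ _ (fun x => - ((0 +i* 1)%C / (kappa m)%:C%C) * Jdet P x)) => //.
  by apply: cbddZ_meas; exact: cbdd_meas_Jdet hP.
- apply: (@sesqui_monomial _ _ _ _ _ _ (fun x => ((0 +i* 1)%C * (therm_eta m)%:C%C) * A j x)) => //.
  by apply: cbddZ_meas; exact: cbdd_meas_Acoef hP _.
Qed.

(** Each [A j] is constant along the coordinate [j], so integrating the divergence by parts
    differentiates only the test temperature. *)
Lemma form_density1v Phi Psi : test_field Phi -> test_field Psi ->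
  form D (density1 m P) (tjet Phi) (tjet Psi) = form D density1v (tjet Phi) (tjet Psi).
Proof.
move=> tPhi tPsi; have ma := tjet_memL2s tPhi; have mb := tjet_memL2s tPsi.
have bA j := cbdd_meas_Acoef hP j.
have sM (c : C) j (t u : jet_index) :
    sesqui D predT (fun a b x => c * A j x * a t * conjc (b u)).
  by apply: (@sesqui_monomial _ _ _ _ _ _ (fun x => c * A j x)) => //; exact: cbddZ_meas.
have sJ : sesqui D predT (fun (a b : jet_index -> C) x =>
    - ((0 +i* 1)%C / (kappa m)%:C%C) * Jdet P x * a pval * conjc (b pval)).
  apply: (@sesqui_monomial _ _ _ _ _ _ (fun x => - ((0 +i* 1)%C / (kappa m)%:C%C) * Jdet P x)) => //.
  by apply: cbddZ_meas; exact: cbdd_meas_Jdet hP.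
rewrite /density1 /density1v.
rewrite (formD mD sJ (sesqui_sum (fun j => sM _ j _ _)))//.
rewrite (formD mD sJ (sesqui_sum (fun j => sM _ j _ _)))//; congr (_ + _).
rewrite (form_sum mD (fun j => sM _ j _ _))// (form_sum mD (fun j => sM _ j _ _))//.
apply: eq_bigr => j _.
have ME c t u : form D (fun a b x => c * A j x * a t * conjc (b u)) (tjet Phi) (tjet Psi) =
    c * form D (fun a b x => 1 * A j x * a t * conjc (b u)) (tjet Phi) (tjet Psi).
  rewrite -(formZ mD _ (sM _ _ _ _))//; apply: eq_cintegral => x _.
  by rewrite mul1r !mulrA.
rewrite ME [RHS]ME mulNr -mulrN; congr (_ * _).
have [tc dc] := ctest_conj (tPsi (rshift 3 0)).
have H := cintegration_by_parts oD bD (bA j) (@cindep_Acoef _ P j) (tPhi (lshift 1 j)) tc.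
rewrite /form /=; under eq_cintegral do rewrite mul1r.
under [RHS]eq_cintegral do rewrite mul1r.
by rewrite /= -H dc.
Qed.

End TestFields.

(** * Coercivity at frequency zero *)

Section Coercivity.
Context {R : realType}.
Local Notation C := R[i].
Variables (m : material R) (P : pml R) (d : 'I_3 -> R) (D : set (space3 R)).
Hypotheses (hP : pml_ok P d) (oD : open D) (bD : bounded_set D).
Implicit Types (x : space3 R) (i j : 'I_3).
Implicit Types Phi Psi : space3 R -> 'cV[C]_(3 + 1).
Local Notation vol := (@volume R).
Local Notation s := (stretch P).
Local Notation A := (Acoef P).

Let mD : measurable (D : set (mspace3 R)) := open_measurable3 oD.
Let fD : (vol D < +oo)%E := bounded_set_volume bD mD.

Lemma sqnormL2_ReIm (f : space3 R -> C) : cbdd_meas f ->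
  sqnormL2 D f = \int[vol]_(x in D) complex.Re (f x) ^+ 2 + \int[vol]_(x in D) complex.Im (f x) ^+ 2.
Proof.
move=> [b1 b2]; rewrite -(bdd_RintegralD mD fD); try exact: bdd_meas_sqr.
by apply: eq_Rintegral => x _; rewrite sqr_normcE.
Qed.

Lemma poincare_complex : exists2 K, 0 <= K & forall f, ctest D f ->
  sqnormL2 D f <= K * sqnormL2 D (cpderiv 0 f).
Proof.
have [M M0 DM] := bounded_set_cube bD.
exists (4 * M ^+ 2); first by rewrite mulr_ge0// sqr_ge0.
move=> f tf; have [t1 t2] := tf.
rewrite !sqnormL2_ReIm ?mulrDr; try exact: ctest_cbdd_meas (ctest_cpderiv 0 tf); last exact: ctest_cbdd_meas tf.
by apply: lerD; apply: (poincare_real M0 DM).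
Qed.

Definition temp_scale (M : R) Phi : space3 R -> 'cV[C]_(3 + 1) :=
  fun x => \col_k (if k == rshift 3 0 then M%:C%C * Phi x k 0 else Phi x k 0).

Lemma temp_scale_jet M Phi : test_field D Phi ->
  [/\ test_field D (temp_scale M Phi),
      forall i, tjet (temp_scale M Phi) (uval i) = tjet Phi (uval i),
      forall i j, tjet (temp_scale M Phi) (uder i j) = tjet Phi (uder i j),
      tjet (temp_scale M Phi) pval = fun x => M%:C%C * tjet Phi pval x &
      forall j, tjet (temp_scale M Phi) (pder j) = fun x => M%:C%C * tjet Phi (pder j) x].
Proof.
move=> tPhi.
have E1 i : (fun x => temp_scale M Phi x (lshift 1 i) 0) = fun x => Phi x (lshift 1 i) 0.
  by apply/funext => x; rewrite mxE eq_lrshift.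
have E2 : (fun x => temp_scale M Phi x (rshift 3 0) 0) = fun x => M%:C%C * Phi x (rshift 3 0) 0.
  by apply/funext => x; rewrite mxE eqxx.
have [t2 d2] := ctestZ M%:C%C (tPhi (rshift 3 0)).
split=> [k|i|i j||j] /=; rewrite ?E1 ?E2 ?d2//.
case: (fintype.split_ordP k) => [i|i] ->; first by rewrite E1; exact: tPhi.
by rewrite (ord1 i) E2.
Qed.

Lemma jet_sumE (F : jet_index -> R) :
  \sum_t F t = \sum_i F (uval i) + F pval + (\sum_i \sum_j F (uder i j) + \sum_j F (pder j)).
Proof.
rewrite big_sumType /= (_ : \sum_kj F (inr kj) = \sum_k \sum_j F (inr (k, j))); last first.
  by rewrite pair_bigA; apply: eq_bigr => -[].
by rewrite !big_split_ord /= !big_ord1.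
Qed.

Definition density0s (a b : jet_index -> C) x : C :=
  \sum_i \sum_j swapped_term m P i j a b x + \sum_j thermal_term m P j a b x.

Lemma sesqui_density0s : sesqui D predT density0s.
Proof.
apply: sesquiD; last by apply: sesqui_sum => j; exact: sesqui_thermal_term hP _.
by apply: sesqui_sum => i; apply: sesqui_sum => j; exact: sesqui_swapped_term hP _ _.
Qed.

Lemma form_density0s Phi Psi : test_field D Phi -> test_field D Psi ->
  form D (density0 m P) (tjet Phi) (tjet Psi) = form D density0s (tjet Phi) (tjet Psi).
Proof.
move=> tPhi tPsi; have ma := tjet_memL2s oD bD tPhi; have mb := tjet_memL2s oD bD tPsi.
have s1 i j := sesqui_elastic_term m D hP i j; have s2 i j := sesqui_swapped_term m D hP i j.
have s3 j := sesqui_thermal_term m D hP j.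
have S1 i := sesqui_sum (s1 i); have S2 i := sesqui_sum (s2 i); have S3 := sesqui_sum s3.
rewrite /density0 /density0s (formD mD (sesqui_sum S1) S3)// (formD mD (sesqui_sum S2) S3)//.
congr (_ + _); rewrite (form_sum mD S1)// (form_sum mD S2)//; apply: eq_bigr => i _.
rewrite (form_sum mD (s1 i))// (form_sum mD (s2 i))//; apply: eq_bigr => j _.
exact: (form_swapped m hP oD bD).
Qed.

(** The coupling of the temperature with the divergence of the displacement is absorbed by Young's
    inequality into half of the elastic bound. The displacement of the second argument is not
    rescaled, so [K] does not depend on [M], while the diffusion term gains the factor [M]. *)
Lemma density0s_ge (t : R) : 0 < mu m -> 0 < lam m + mu m -> 0 <= t -> t < 1 ->
  (lam m + 2 * mu m) * t ^+ 2 < mu m -> 0 <= therm_gamma m ->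
  (forall j x, admissible t (1 + zeta P * alpha0 P) (s j x)) ->
  exists c1 c2 K : R, [/\ 0 < c1, 0 < c2, 0 <= K & forall (M : R) (a b : jet_index -> C) x,
    0 <= M -> (forall i j, b (uder i j) = a (uder i j)) ->
    (forall j, b (pder j) = M%:C%C * a (pder j)) ->
    c1 * \sum_i \sum_j normc (a (uder i j)) ^+ 2 - K * normc (a pval) ^+ 2 +
      M * c2 * \sum_j normc (a (pder j)) ^+ 2 <= complex.Re (density0s a b x)].
Proof.
move=> mu0 lm0 t0 t1 lmt g0 adm; set S := 1 + zeta P * alpha0 P in adm.
have S0 : 0 < S by exact: stretch_max_gt0 hP.
have t21 : t ^+ 2 < 1 by rewrite expr_lt1.
pose c := Num.min ((mu m - (lam m + 2 * mu m) * t ^+ 2) / (2 * S)) (mu m * ((1 - t ^+ 2) / (2 * S))).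
have c0 : 0 < c.
  have S20 : 0 < 2 * S by rewrite mulr_gt0.
  rewrite /c lt_min; apply/andP; split; first by apply: divr_gt0 => //; rewrite subr_gt0.
  by apply: mulr_gt0 => //; apply: divr_gt0 => //; rewrite subr_gt0.
pose c2 := (1 - t ^+ 2) / (2 * S).
have c20 : 0 < c2 by rewrite divr_gt0 ?subr_gt0 ?mulr_gt0.
have /choice[B BA] : forall j, exists B : R, forall x, normc (A j x) <= B.
  by move=> j; have [_ [B]] := cbdd_meas_cbdd D (cbdd_meas_Acoef hP j); exists B.
(* The constant in Young's inequality when the derivative term is given the weight [c / 2]; [B j]
   bounds the coefficient of the coupling. *)
pose K j := (therm_gamma m * B j) ^+ 2 / (2 * c).
have K0 j : 0 <= K j by apply: divr_ge0; [exact: sqr_ge0|apply: mulr_ge0 => //; exact: ltW].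
exists (c / 2), c2, (\sum_j K j); split=> //; first by rewrite divr_gt0.
  exact: sumr_ge0.
move=> M a b x M0 bu bp.
have -> : density0s a b x = elastic_density (lam m) (mu m) (fun k => s k x) (fun i j => a (uder i j)) +
    \sum_j thermal_term m P j a b x.
  congr (_ + _); apply: eq_bigr => i _; apply: eq_bigr => j _.
  rewrite /swapped_term !bu; case: eqP => _; first by rewrite -!mulrA.
  by rewrite -[in RHS]/(A j x) -!mulrA.
rewrite ReD.
have el := elastic_density_ge (fun i j => a (uder i j)) mu0 lm0 t0 (ltW t1) (ltW lmt) (adm ^~ x).
rewrite -/c in el.
have th : - (c / 2) * (\sum_i \sum_j normc (a (uder i j)) ^+ 2) - (\sum_j K j) * normc (a pval) ^+ 2 +
    M * c2 * (\sum_j normc (a (pder j)) ^+ 2) <= complex.Re (\sum_j thermal_term m P j a b x).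
  have ReS (F : 'I_3 -> C) : complex.Re (\sum_j F j) = \sum_j complex.Re (F j).
    by rewrite !sum_ord3 !ReD.
  have ReMr (z : C) (n : R) : complex.Re (z * n%:C%C) = complex.Re z * n.
    by rewrite mulrC ReM_real mulrC.
  rewrite ReS.
  apply: (@le_trans _ _ (\sum_j (- (c / 2) * normc (a (uder j j)) ^+ 2 - K j * normc (a pval) ^+ 2 +
     M * c2 * normc (a (pder j)) ^+ 2))).
    rewrite !big_split /= -!mulr_sumr sumrN [(\sum_j K j) * _]mulr_suml !lerD2r.
    rewrite ler_nM2l; last by rewrite oppr_lt0 divr_gt0.
    apply: ler_sum => i _; rewrite (bigD1 i)//= lerDl.
    by apply: sumr_ge0 => j _; exact: sqr_ge0.
  apply: ler_sum => j _; rewrite /thermal_term ReD bu bp; apply: lerD.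
    apply: (@le_trans _ _ (- normc (- (therm_gamma m)%:C%C * A j x * a pval * conjc (a (uder j j))))).
      have := mulr_ge0 (ltW c0) (sqr_ge0 (normc (a (uder j j)) - (therm_gamma m * B j) / c * normc (a pval))).
      rewrite !normcM normc_conj normcN normc_real ger0_norm//.
      have : therm_gamma m * normc (A j x) * normc (a pval) * normc (a (uder j j)) <=
         therm_gamma m * B j * normc (a pval) * normc (a (uder j j)).
        by rewrite !ler_wpM2r ?normc_ge0// ler_wpM2l.
      rewrite /K; move: (normc (a pval)) (normc (a (uder j j))) (therm_gamma m * B j) => p u g h.
      have -> : c * (u - g / c * p) ^+ 2 = c * u ^+ 2 - 2 * (g * p * u) + g ^+ 2 / c * p ^+ 2.
        by field; rewrite gt_eqF.
      have -> : g ^+ 2 / (2 * c) = g ^+ 2 / c / 2 by field; rewrite gt_eqF.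
      by move: (g ^+ 2 / c) => w; lra.
    rewrite lerNl; apply: (le_trans _ (norm_Re_le _)).
    by rewrite -normrN ler_norm.
  have -> : A j x / s j x * a (pder j) * conjc (M%:C%C * a (pder j)) =
      M%:C%C * ((A j x / s j x) * (normc (a (pder j)) ^+ 2)%:C%C).
    have -> : conjc (M%:C%C * a (pder j)) = M%:C%C * conjc (a (pder j)).
      by rewrite rmorphM /= oppr0.
    by rewrite -mul_conjc !mulrA [_ * M%:C%C]mulrC !mulrA.
  rewrite ReM_real ReMr -mulrA ler_wpM2l// ler_wpM2r ?sqr_ge0//.
  have ax k := adm k x; have E := prod_ord3_neq (s ^~ x).
  by move: j; apply: ord3P; rewrite /Acoef E; exact: Re_ratio_ge (ltW t1) _ _ _.
have H : c * (\sum_i \sum_j normc (a (uder i j)) ^+ 2) - (c / 2) * (\sum_i \sum_j normc (a (uder i j)) ^+ 2)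
   = c / 2 * (\sum_i \sum_j normc (a (uder i j)) ^+ 2) by field.
by have := lerD el th; rewrite -H; lra.
Qed.

End Coercivity.

(** * The inf-sup condition at frequency zero *)

Section InfSup.
Context {R : realType}.
Local Notation C := R[i].
Variables (m : material R) (P : pml R) (d : 'I_3 -> R) (D : set (space3 R)).
Hypotheses (hP : pml_ok P d) (oD : open D) (bD : bounded_set D).
Implicit Types (x : space3 R) (i j : 'I_3).
Implicit Types Phi Psi : space3 R -> 'cV[C]_(3 + 1).
Local Notation vol := (@volume R).
Local Notation s := (stretch P).
Local Notation A := (Acoef P).
Local Notation N := (partial_norm D predT).

Let mD : measurable (D : set (mspace3 R)) := open_measurable3 oD.
Let fD : (vol D < +oo)%E := bounded_set_volume bD mD.

Lemma bdd_meas_normc_sqr (f : space3 R -> C) : cbdd_meas f ->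
  bdd_meas (fun x : mspace3 R => normc (f x) ^+ 2).
Proof.
move=> [b1 b2]; rewrite (_ : (fun x => _) = fun x => complex.Re (f x) ^+ 2 + complex.Im (f x) ^+ 2).
  by apply: bdd_measD; exact: bdd_meas_sqr.
by apply/funext => x; rewrite sqr_normcE.
Qed.

Lemma Re_form_density0s_ge (c1 c2 K M : R) Phi Psi : test_field D Phi -> test_field D Psi ->
  (forall x, c1 * \sum_i \sum_j normc (tjet Phi (uder i j) x) ^+ 2 - K * normc (tjet Phi pval x) ^+ 2 +
      M * c2 * \sum_j normc (tjet Phi (pder j) x) ^+ 2 <=
      complex.Re (density0s m P (tjet Phi ^~ x) (tjet Psi ^~ x) x)) ->
  c1 * \sum_i \sum_j sqnormL2 D (tjet Phi (uder i j)) - K * sqnormL2 D (tjet Phi pval) +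
      M * c2 * \sum_j sqnormL2 D (tjet Phi (pder j)) <=
  complex.Re (form D (density0s m P) (tjet Phi) (tjet Psi)).
Proof.
move=> tPhi tPsi H; have ma := tjet_memL2s oD bD tPhi; have mb := tjet_memL2s oD bD tPsi.
have [iF _] := sesqui_cintegrable mD (sesqui_density0s m D hP) ma mb.
have bq t : bdd_meas (fun x : mspace3 R => normc (tjet Phi t x) ^+ 2).
  by apply: bdd_meas_normc_sqr; apply: ctest_cbdd_meas; exact: tjet_ctest tPhi.
have bS i := bdd_meas_sum (index_enum 'I_3) (fun j => bq (uder i j)).
have bSS := bdd_meas_sum (index_enum 'I_3) bS.
have bP := bdd_meas_sum (index_enum 'I_3) (fun j => bq (pder j)).
have b1 := bdd_measZ c1 bSS; have b2 := bdd_measZ K (bq pval); have b3 := bdd_measZ (M * c2) bP.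
have -> : c1 * \sum_i \sum_j sqnormL2 D (tjet Phi (uder i j)) - K * sqnormL2 D (tjet Phi pval) +
      M * c2 * \sum_j sqnormL2 D (tjet Phi (pder j)) =
    \int[vol]_(x in D) (c1 * \sum_i \sum_j normc (tjet Phi (uder i j) x) ^+ 2 -
      K * normc (tjet Phi pval x) ^+ 2 + M * c2 * \sum_j normc (tjet Phi (pder j) x) ^+ 2).
  rewrite (bdd_RintegralD mD fD (bdd_measB b1 b2) b3) (bdd_RintegralB mD fD b1 b2).
  rewrite (bdd_RintegralZ mD fD _ bSS) (bdd_RintegralZ mD fD _ (bq pval)) (bdd_RintegralZ mD fD _ bP).
  rewrite (bdd_Rintegral_sum _ mD fD bS) (bdd_Rintegral_sum _ mD fD (fun j => bq (pder j))).
  congr (_ * _ - _ + _); apply: eq_bigr => i _.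
  by rewrite (bdd_Rintegral_sum _ mD fD (fun j => bq (uder i j))).
apply: le_Rintegral => //; apply: (bdd_meas_integrable mD fD).
by apply: bdd_measD => //; exact: bdd_measB.
Qed.

Let le_sum_term (F : 'I_3 -> R) i : (forall j, 0 <= F j) -> F i <= \sum_j F j.
Proof. by move=> F0; rewrite (bigD1 i)//= lerDl sumr_ge0. Qed.

Let balance (c1 c2 K CP q u p : R) : K * q <= K * (CP * p) -> 0 <= c2 * p ->
  c1 * (u + p) <= c1 * u - K * q + (K * CP + c1 + c2) * p.
Proof. by lra. Qed.

Let conclude (c1 CP1 r M n : R) : 0 < n -> c1 * n ^+ 2 <= CP1 * (r * (M * n)) ->
  n * c1 <= M * CP1 * r.
Proof. by move=> n0 E; rewrite -(ler_pM2r n0); move: E; rewrite expr2; lra. Qed.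

Lemma density0_infsup (t : R) : 0 < mu m -> 0 < lam m + mu m -> 0 <= t -> t < 1 ->
  (lam m + 2 * mu m) * t ^+ 2 < mu m -> 0 <= therm_gamma m ->
  (forall j x, admissible t (1 + zeta P * alpha0 P) (s j x)) ->
  exists2 c, 0 < c & forall Phi r, test_field D Phi -> 0 <= r ->
    (forall Psi, test_field D Psi ->
      normc (form D (density0 m P) (tjet Phi) (tjet Psi)) <= r * N (tjet Psi)) ->
    N (tjet Phi) <= c * r.
Proof.
move=> mu0 lm0 t0 t1 lmt g0 adm.
have [c1 [c2 [K [c10 c20 K0 pw]]]] := density0s_ge D hP mu0 lm0 t0 t1 lmt g0 adm.
have [CP CP0 poin] := poincare_complex oD bD.
(* The diffusion constant [M * c2] covers the loss [K * CP] from Poincare's inequality and still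
   leaves [c1] for the temperature gradient. The added 1 makes [M >= 1], which bounds the norm of
   the rescaled field by [M] times the original one. *)
pose M := (K * CP + c1) / c2 + 1.
have M1 : 1 <= M by rewrite lerDr divr_ge0 ?addr_ge0 ?mulr_ge0// ltW.
have M0 : 0 < M by exact: lt_le_trans M1.
have Mc2 : M * c2 = K * CP + c1 + c2 by rewrite /M; field; rewrite gt_eqF.
clearbody M.
exists (M * (1 + CP) / c1); first by rewrite divr_gt0// mulr_gt0// ltr_pwDl.
move=> Phi r tPhi r0 H.
have [tPsi vu du vp dp] := temp_scale_jet M tPhi.
set Psi := temp_scale M Phi in tPsi vu du vp dp.
pose Q u := sqnormL2 D (tjet Phi u).
have Q0 u : 0 <= Q u by exact: sqnormL2_ge0.
set SU := \sum_i \sum_j Q (uder i j); set SP := \sum_j Q (pder j).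
have SU0 : 0 <= SU by apply: sumr_ge0 => i _; apply: sumr_ge0.
have SP0 : 0 <= SP by apply: sumr_ge0.
have NE Phi' : N (tjet Phi') ^+ 2 = \sum_u sqnormL2 D (tjet Phi' u).
  by rewrite sqr_sqrtr// partial_sum_ge0.
have Qp : Q pval <= CP * SP.
  have h : Q pval <= CP * Q (pder 0) := poin _ (tPhi (rshift 3 0)).
  exact: (le_trans h (ler_wpM2l CP0 (le_sum_term 0 (fun j => Q0 (pder j))))).
have Qu : \sum_i Q (uval i) <= CP * SU.
  rewrite mulr_sumr; apply: ler_sum => i _.
  have h : Q (uval i) <= CP * Q (uder i 0) := poin _ (tPhi (lshift 1 i)).
  exact: (le_trans h (ler_wpM2l CP0 (le_sum_term 0 (fun j => Q0 (uder i j))))).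
have NPhi : N (tjet Phi) ^+ 2 <= (1 + CP) * (SU + SP).
  rewrite NE jet_sumE -/SU -/SP; rewrite -/(Q pval).
  rewrite -[\sum_i sqnormL2 D (tjet Phi (uval i))]/(\sum_i Q (uval i)); lra.
have NPsi : N (tjet Psi) <= M * N (tjet Phi).
  have nn (y : R) : 0 <= y -> y \is Num.nneg by rewrite nnegrE.
  have Na : 0 <= N (tjet Psi) by exact: sqrtr_ge0.
  have Nb : 0 <= M * N (tjet Phi) by apply: mulr_ge0; [exact: ltW|exact: sqrtr_ge0].
  rewrite -(@ler_pXn2r _ 2 isT _ _ (nn _ Na) (nn _ Nb)).
  rewrite [leRHS]exprMn [in leLHS](NE Psi) [in leRHS](NE Phi) mulr_sumr; apply: ler_sum => u _.
  have scale : sqnormL2 D (fun x => M%:C%C * tjet Phi u x) <= M ^+ 2 * Q u.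
    apply: (sqnormL2_bddM mD (cbdd_cst D M%:C%C)); last exact: (tjet_memL2s oD bD tPhi).
    by move=> x; rewrite normc_real ger0_norm// ltW.
  have keep : Q u <= M ^+ 2 * Q u by rewrite ler_peMl// exprn_ege1.
  have split_index : [\/ exists i, u = uval i, exists i j, u = uder i j, u = pval | exists j, u = pder j].
    case: u {scale keep} => [k|[k j]]; case: (fintype.split_ordP k) => i ->; rewrite ?(ord1 i).
    - by apply: Or41; exists i.
    - exact: Or43.
    - by apply: Or42; exists i, j.
    - by apply: Or44; exists j.
  case: split_index => [[i E]|[i [j E]]|E|[j E]]; rewrite E ?vu ?du ?vp ?dp -?E//.
have low : c1 * (SU + SP) <= complex.Re (form D (density0s m P) (tjet Phi) (tjet Psi)).
  have h : c1 * SU - K * Q pval + M * c2 * SP <=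
      complex.Re (form D (density0s m P) (tjet Phi) (tjet Psi)).
    apply: (Re_form_density0s_ge (c1 := c1) (c2 := c2) (K := K) (M := M) tPhi tPsi) => x.
    by apply: pw => [|i j|j]; [exact: ltW|rewrite du|rewrite dp].
  apply: le_trans h; rewrite Mc2.
  exact: (balance c1 SU (ler_wpM2l K0 Qp) (mulr_ge0 (ltW c20) SP0)).
have up : complex.Re (form D (density0s m P) (tjet Phi) (tjet Psi)) <= r * (M * N (tjet Phi)).
  apply: (le_trans (Re_le_normc _)); rewrite -(form_density0s m hP oD bD tPhi tPsi).
  by apply: (le_trans (H _ tPsi)); rewrite ler_wpM2l.
have N0 : 0 <= N (tjet Phi) by exact: sqrtr_ge0.
have CP1 : 0 < 1 + CP by rewrite ltr_pwDl.
have E : c1 * N (tjet Phi) ^+ 2 <= (1 + CP) * (r * (M * N (tjet Phi))).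
  apply: (@le_trans _ _ (c1 * ((1 + CP) * (SU + SP)))); first by rewrite ler_pM2l.
  by rewrite mulrCA ler_pM2l//; exact: le_trans up.
have [->|N1] := eqVneq (N (tjet Phi)) 0.
  by rewrite mulr_ge0// divr_ge0 ?mulr_ge0// ltW.
have {N1}N1 : 0 < N (tjet Phi) by rewrite lt_neqAle eq_sym N1.
by rewrite mulrAC ler_pdivlMr//; exact: conclude E.
Qed.

End InfSup.

(** * Compactness of the L^2 norm on test fields *)

Section Compactness.
Context {R : realType}.
Local Notation C := R[i].
Variables (D : set (space3 R)).
Hypotheses (oD : open D) (bD : bounded_set D).
Implicit Types Phi Psi : space3 R -> 'cV[C]_(3 + 1).
Local Notation vol := (@volume R).
Local Notation N := (partial_norm D predT).
Local Notation L := (partial_norm D is_val).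

Let mD : measurable (D : set (mspace3 R)) := open_measurable3 oD.
Let fD : (vol D < +oo)%E := bounded_set_volume bD mD.

Lemma rellich_complex (e : R) : 0 < e ->
  exists (I : finType) (w : I -> space3 R -> R) (c : R),
  [/\ 0 <= c, forall i, bdd_meas (w i : mspace3 R -> R) & forall f, ctest D f ->
    sqnormL2 D f <= e * (\sum_j sqnormL2 D (cpderiv j f)) +
      c * \sum_i normc (cintegral D (fun x => (w i x)%:C%C * f x)) ^+ 2].
Proof.
move=> e0; have [I [w [c [c0 bw H]]]] := rellich_real bD e0.
exists I, w, c; split=> // f tf; have [t1 t2] := tf.
rewrite sqnormL2_ReIm //; last exact: ctest_cbdd_meas tf.
have -> : \sum_j sqnormL2 D (cpderiv j f) =
    \sum_j \int[vol]_(x in D) pderiv j (fun x => complex.Re (f x)) x ^+ 2 +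
    \sum_j \int[vol]_(x in D) pderiv j (fun x => complex.Im (f x)) x ^+ 2.
  rewrite -big_split; apply: eq_bigr => j _.
  by rewrite (sqnormL2_ReIm oD bD) //; exact: ctest_cbdd_meas (ctest_cpderiv j tf).
have -> : \sum_i normc (cintegral D (fun x => (w i x)%:C%C * f x)) ^+ 2 =
    \sum_i (\int[vol]_(x in D) (w i x * complex.Re (f x))) ^+ 2 +
    \sum_i (\int[vol]_(x in D) (w i x * complex.Im (f x))) ^+ 2.
  rewrite -big_split; apply: eq_bigr => i _; rewrite sqr_normcE /cintegral /=.
  congr (_ ^+ 2 + _ ^+ 2); apply: eq_Rintegral => x _.
    exact: ReM_real.
  by case: (f x) => a b /=; rewrite mul0r addr0.
by rewrite !mulrDr addrACA; exact: lerD (H _ t1) (H _ t2).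
Qed.

Lemma sum_sqr_le (I : finType) (F : I -> R) : (forall i, 0 <= F i) ->
  \sum_i F i ^+ 2 <= (\sum_i F i) ^+ 2.
Proof.
move=> F0; rewrite [leRHS]expr2 mulr_sumr; apply: ler_sum => i _.
rewrite expr2 ler_wpM2r// (bigD1 i)//= lerDl; exact: sumr_ge0.
Qed.

(** Rellich's inequality is used with [e ^+ 2] for each component. The factor [Num.sqrt c] is put
    into the functionals, and a root of a sum of squares is at most the sum of the terms. *)
Lemma val_norm_precompact (e : R) : 0 < e ->
  exists (I : finType) (l : I -> (space3 R -> 'cV[C]_(3 + 1)) -> C) (k : R), [/\ 0 <= k,
    forall i a Phi Psi, test_field D Phi -> test_field D Psi ->
      l i (fun x => a *: Phi x + Psi x) = a * l i Phi + l i Psi,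
    forall i Phi, test_field D Phi -> normc (l i Phi) <= k * N (tjet Phi) &
    forall Phi, test_field D Phi ->
      L (tjet Phi) <= e * N (tjet Phi) + \sum_i normc (l i Phi)].
Proof.
move=> e0; have [I [w [c [c0 bw H]]]] := rellich_complex (exprn_gt0 2 e0).
pose l (ki : 'I_(3 + 1) * I) (Phi : space3 R -> 'cV[C]_(3 + 1)) : C :=
  (Num.sqrt c)%:C%C * cintegral D (fun x => (w ki.2 x)%:C%C * Phi x ki.1 0).
have bwc i : cbdd D (fun x => (w i x)%:C%C).
  by apply: cbdd_meas_cbdd; apply: cbdd_meas_real.
have mw Phi (ki : 'I_(3 + 1) * I) : test_field D Phi ->
    memL2 D (fun x => (w ki.2 x)%:C%C) /\ memL2 D (fun x => Phi x ki.1 0).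
  move=> tPhi; split; first exact: (cbdd_memL2 mD fD).
  exact: (ctest_memL2 oD bD).
have [B B0 BW] : exists2 B : R, 0 <= B & forall i, normL2 D (fun x => (w i x)%:C%C) <= B.
  exists (\sum_i normL2 D (fun x => (w i x)%:C%C)).
    by apply: sumr_ge0 => i _; exact: normL2_ge0.
  by move=> i; rewrite (bigD1 i)//= lerDl; apply: sumr_ge0 => j _; exact: normL2_ge0.
exists ('I_(3 + 1) * I)%type, l, (Num.sqrt c * (2 * B)); split.
- by rewrite mulr_ge0 ?sqrtr_ge0// mulr_ge0.
- move=> ki a Phi Psi tPhi tPsi; rewrite /l.
  have [mwi mP] := mw _ ki tPhi; have [_ mQ] := mw _ ki tPsi.
  rewrite (_ : (fun x => _ * (a *: Phi x + Psi x) _ _) = fun x =>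
     a * ((w ki.2 x)%:C%C * Phi x ki.1 0) + (w ki.2 x)%:C%C * Psi x ki.1 0); last first.
    by apply/funext => x; rewrite !mxE mulrDr mulrCA.
  have i1 := memL2_mul mD mwi mP; have i2 := memL2_mul mD mwi mQ.
  rewrite (cintegralD mD)//; last exact: (cintegrableZ mD).
  by rewrite (cintegralZ mD)// mulrDr mulrCA.
- move=> ki Phi tPhi; rewrite /l normcM normc_real ger0_norm ?sqrtr_ge0//.
  rewrite -mulrA ler_wpM2l ?sqrtr_ge0//.
  have [mwi mP] := mw _ ki tPhi.
  apply: (le_trans (norm_cintegral_mul mD mwi mP)); rewrite -mulrA ler_pM2l//.
  apply: ler_pM; rewrite ?normL2_ge0//.
  exact: (@normL2_le_partial _ D _ predT (tjet Phi) (inl ki.1)).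
- move=> Phi tPhi.
  have N0 : 0 <= N (tjet Phi) by exact: sqrtr_ge0.
  have S0 : 0 <= \sum_i normc (l i Phi) by apply: sumr_ge0 => i _; exact: normc_ge0.
  have eN0 : 0 <= e * N (tjet Phi) by rewrite mulr_ge0// ltW.
  rewrite -[leRHS]ger0_norm; last exact: addr_ge0.
  rewrite -sqrtr_sqr /partial_norm ler_sqrt ?sqr_ge0//.
  apply: (@le_trans _ _ ((e * N (tjet Phi)) ^+ 2 + \sum_i normc (l i Phi) ^+ 2)); last first.
    have h := sum_sqr_le (fun i => normc_ge0 (l i Phi)).
    rewrite sqrrD -addrA lerD2l; apply: (le_trans h).
    by rewrite lerDr mulrn_wge0// mulr_ge0.
  have -> : \sum_(t | is_val t) sqnormL2 D (tjet Phi t) = \sum_k sqnormL2 D (fun x => Phi x k 0).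
    by rewrite big_sumType /= [X in _ + X]big_pred0_eq addr0.
  have -> : \sum_ki normc (l ki Phi) ^+ 2 = \sum_k (c * \sum_i
      normc (cintegral D (fun x => (w i x)%:C%C * Phi x k 0)) ^+ 2).
    under [RHS]eq_bigr do rewrite mulr_sumr.
    rewrite pair_bigA; apply: eq_bigr => ki _.
    by rewrite /l normcM exprMn normc_real ger0_norm ?sqrtr_ge0// sqr_sqrtr.
  apply: (@le_trans _ _ (\sum_k (e ^+ 2 * (\sum_j sqnormL2 D (cpderiv j (fun x => Phi x k 0))) +
      c * \sum_i normc (cintegral D (fun x => (w i x)%:C%C * Phi x k 0)) ^+ 2))).
    by apply: ler_sum => k _; exact: H.
  rewrite big_split /= lerD2r exprMn -mulr_sumr ler_pM2l ?exprn_gt0//.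
  rewrite /partial_norm sqr_sqrtr ?partial_sum_ge0// big_sumType /= pair_bigA /=.
  rewrite [X in _ <= _ + X](_ : _ = \sum_p sqnormL2 D (cpderiv p.2 (fun x => Phi x p.1 0))); last by [].
  by rewrite lerDr; apply: sumr_ge0 => k _; exact: sqnormL2_ge0.
Qed.

End Compactness.

Section TestFieldSpace.
Context {R : realType}.
Local Notation C := R[i].
Variable D : set (space3 R).
Local Notation field := (space3 R -> 'cV[C]_(3 + 1)).

Definition is_test_field : {pred field} := fun Phi => `[< test_field D Phi >].

Lemma is_test_field_submod : submod_closed is_test_field.
Proof.
split=> [|a Phi Psi /asboolP tPhi /asboolP tPsi]; apply/asboolP.
  move=> k; rewrite (_ : (fun x => _) = fun=> 0); first exact: (ctest0 D).1.
  by apply/funext => x; rewrite mxE.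
exact: (tjet_linear a tPhi tPsi).1.
Qed.

HB.instance Definition _ := GRing.isSubmodClosed.Build C field is_test_field is_test_field_submod.

(** Turns the test fields into a module over the complex numbers, the setting of the abstract result
    on pencils. *)
Record tfield := TField { tfield_val : field; tfieldP : is_test_field tfield_val }.

HB.instance Definition _ := [isSub for tfield_val].
HB.instance Definition _ := [Choice of tfield by <:].
HB.instance Definition _ := [SubChoice_isSubLmodule of tfield by <:].

Lemma tfield_test (X : tfield) : test_field D (tfield_val X).
Proof. by case: X => Phi tPhi; exact/asboolP. Qed.

Lemma test_tfield Phi : test_field D Phi -> exists X, tfield_val X = Phi.
Proof. by move=> /asboolP tPhi; exists (TField tPhi). Qed.

Lemma tfield_valP k (X Y : tfield) :
  tfield_val (k *: X + Y) = fun x => k *: tfield_val X x + tfield_val Y x.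
Proof. by []. Qed.

End TestFieldSpace.

(** * Finiteness of the exceptional frequencies in each disc *)

Section ExceptionalSet.
Context {R : realType}.
Local Notation C := R[i].
Variables (m : material R) (P : pml R) (d : 'I_3 -> R) (D : set (space3 R)).
Hypotheses (hP : pml_ok P d) (oD : open D) (bD : bounded_set D).
Local Notation vol := (@volume R).
Local Notation X := (tfield D).
Local Notation N := (partial_norm D predT).
Local Notation L := (partial_norm D is_val).

Let mD : measurable (D : set (mspace3 R)) := open_measurable3 oD.
Let fD : (vol D < +oo)%E := bounded_set_volume bD mD.

Definition xjet (x : X) := tjet (tfield_val x).

Lemma xjet_memL2s x : memL2s D (xjet x).
Proof. exact: (tjet_memL2s oD bD (tfield_test x)). Qed.

Lemma xjet_linear k x y : xjet (k *: x + y) = fun t p => k * xjet x t p + xjet y t p.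
Proof. by rewrite /xjet tfield_valP (tjet_linear k (tfield_test x) (tfield_test y)).2. Qed.

Definition gram_term (S : pred jet_index) t (a b : jet_index -> C) (p : space3 R) : C :=
  (S t)%:R * a t * conjc (b t).

Definition gram S (a b : jet_index -> C) (p : space3 R) : C := \sum_t gram_term S t a b p.

Lemma sesqui_gram_term S t : sesqui D predT (gram_term S t).
Proof. by apply: (@sesqui_monomial _ _ _ _ _ _ (fun=> (S t)%:R)) => //; exact: cbdd_cst. Qed.

Lemma sesqui_gram S : sesqui D predT (gram S).
Proof. by apply: sesqui_sum => t; exact: sesqui_gram_term. Qed.

Lemma form_gram_diag S a : memL2s D a -> form D (gram S) a a = (partial_norm D S a ^+ 2)%:C%C.
Proof.
move=> ma; rewrite /gram (form_sum mD (sesqui_gram_term S))//.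
rewrite sqr_sqrtr ?partial_sum_ge0// rmorph_sum [RHS]big_mkcond; apply: eq_bigr => t _.
rewrite /form /gram_term /cintegral /sqnormL2; case: (S t); last first.
  under eq_Rintegral do rewrite !mul0r; under [X in (_ +i* X)%C]eq_Rintegral do rewrite !mul0r.
  by rewrite /= !Rintegral_cst// !mul0r.
congr (_ +i* _)%C.
  by apply: eq_Rintegral => p _; rewrite mul1r mul_conjc.
under eq_Rintegral do rewrite mul1r mul_conjc /=.
by rewrite Rintegral_cst// mul0r.
Qed.

Definition inner S (x y : X) : C := form D (gram S) (xjet x) (xjet y).

Lemma inner_semi_inner S : semi_inner (inner S).
Proof.
split=> [a x y z|x y|x].
- by rewrite /inner xjet_linear (form_linear mD _ (sesqui_gram S)) //; exact: xjet_memL2s.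
- rewrite /inner /form -(cintegral_conj mD).
    apply: eq_cintegral => p _; rewrite rmorph_sum; apply: eq_bigr => t _.
    rewrite /gram_term; case: (S t); last by rewrite !mul0r rmorph0.
    by rewrite !mul1r rmorphM /= conjcK mulrC.
  exact: (sesqui_cintegrable mD (sesqui_gram S) (xjet_memL2s y) (xjet_memL2s x)).
- by rewrite /inner form_gram_diag /= ?sqr_ge0//; exact: xjet_memL2s.
Qed.

Lemma inner_seminorm S x : seminorm_of (inner S) x = partial_norm D S (xjet x).
Proof.
rewrite /seminorm_of /inner form_gram_diag /=; last exact: xjet_memL2s.
by rewrite sqrtr_sqr ger0_norm// sqrtr_ge0.
Qed.

Definition pencil0 (x y : X) := form D (density0 m P) (xjet x) (xjet y).
(** Built on [density1v] because only this version is bounded by the L^2 norm of its first argument,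
    as the hypothesis on [b1] demands. *)
Definition pencil1 (x y : X) := form D (density1v m P) (xjet x) (xjet y).
Definition pencil2 (x y : X) := form D (density2 m P) (xjet x) (xjet y).

Lemma exceptional_finite (t rad : R) : 0 < mu m -> 0 < lam m + mu m -> 0 <= t -> t < 1 ->
  (lam m + 2 * mu m) * t ^+ 2 < mu m -> 0 <= therm_gamma m ->
  (forall j x, admissible t (1 + zeta P * alpha0 P) (stretch P j x)) ->
  finite_set [set w | normc w <= rad /\
    approx_kernel (inner predT) pencil0 pencil1 pencil2 w].
Proof.
move=> mu0 lm0 t0 t1 lmt g0 adm.
have [c0 c00 infsup] := density0_infsup hP oD bD mu0 lm0 t0 t1 lmt g0 adm.
have s2 : sesqui D is_val (density2 m P) := sesqui_density2 m D hP (fun _ => isT).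
have [K1 K10 H1] := form_bounded mD (sesqui_density1v m D hP).
have [K2 K20 H2] := form_bounded mD s2.
have NE x : seminorm_of (inner predT) x = N (xjet x) := inner_seminorm predT x.
have N0 x : 0 <= N (xjet x) by exact: sqrtr_ge0.
have L0 x : 0 <= L (xjet x) by exact: sqrtr_ge0.
pose c := c0 + K1 + K2 + 1.
have c_gt0 : 0 < c by rewrite /c; lra.
apply: (@approx_kernel_finite _ _ _ (inner_semi_inner predT) (fun x => L (xjet x)) _ _ _ c) => //.
- move=> x y; rewrite -!(inner_seminorm is_val).
  exact: seminorm_triangle (inner_semi_inner is_val) _ _.
- move=> x; rewrite NE; apply: (@le_trans _ _ (N (xjet x))); last first.
    by rewrite ler_peMl// /c; lra.
  rewrite /partial_norm ler_sqrt ?partial_sum_ge0// big_mkcond; apply: ler_sum => u _.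
  by case: ifP => // _; exact: sqnormL2_ge0.
- move=> e e0; have [I [l [k [k0 lin lk Le]]]] := val_norm_precompact oD bD e0.
  exists #|I|, (fun i x => l (enum_val i) (tfield_val x)), k; split=> //.
  + by move=> i a x z; rewrite tfield_valP lin//; exact: tfield_test.
  + by move=> i x; rewrite NE; apply: lk; exact: tfield_test.
  + move=> x; rewrite NE; apply: (le_trans (Le _ (tfield_test x))); rewrite lerD2l.
    by rewrite (reindex_onto (enum_val (A := I)) enum_rank) /=;
      [under [leLHS]eq_bigl do rewrite enum_valK eqxx|move=> i _; exact: enum_rankK].
- by move=> a x y z; rewrite /pencil0 xjet_linear (form_linear mD _ (sesqui_density0 m D hP)) //; exact: xjet_memL2s.
- move=> a x y z; rewrite /pencil1 xjet_linear.
  by rewrite (form_linear mD _ (sesqui_density1v m D hP)) //; exact: xjet_memL2s.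
- by move=> a x y z; rewrite /pencil2 xjet_linear (form_linear mD _ s2) //; exact: xjet_memL2s.
- move=> x r r0 H; rewrite NE; apply: (@le_trans _ _ (c0 * r)); last first.
    by rewrite ler_wpM2r// /c; lra.
  apply: infsup (tfield_test x) r0 _ => Psi /test_tfield[y <-].
  by have := H y; rewrite NE.
- move=> x z; rewrite NE; apply: (le_trans (H1 _ _ (xjet_memL2s x) (xjet_memL2s z))).
  by rewrite -mulrA ler_wpM2r ?mulr_ge0// /c; lra.
- move=> x z; rewrite NE; apply: (le_trans (H2 _ _ (xjet_memL2s x) (xjet_memL2s z))).
  by rewrite -mulrA ler_wpM2r ?mulr_ge0// /c; lra.
Qed.

End ExceptionalSet.

(** * Extension to H^1_0 *)

(** Near a candidate limit point [t], the other points of [E] within distance 1 lie in a disc, hence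
    in a finite set. That set is closed and misses [t], so its complement is a neighbourhood of
    [t]. *)
Lemma discrete_subset_bounded_finite (R : realType) (E : set R[i]) :
  (forall r : R, finite_set [set w | normc w <= r /\ E w]) -> discrete_subset E.
Proof.
move=> fE; apply/seteqP; split => // t Et.
pose F := [set w | normc w <= normc t + 1 /\ E w] `\ t.
have fF : finite_set (F : set R[i]^o) by apply: sub_finite_set (fE (normc t + 1)) => w [].
have cF : closed (F : set R[i]^o).
  have := @accessible_finite_set_closed (R[i]^o); case=> H _; apply: H => //.
  exact/hausdorff_accessible/norm_hausdorff.
have n1 : nbhs (t : R[i]^o) (~` F).
  by apply: open_nbhs_nbhs; split; [exact: closed_openC|move=> [_]; exact].
have n2 : nbhs (t : R[i]^o) (ball (t : R[i]^o) 1) by exact: nbhsx_ballx.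
have [w [wt Ew [nFw bw]]] := Et _ (filterI n1 n2).
apply: nFw; split; last by move=> /= wt'; move: wt; rewrite wt' eqxx.
split=> //; move: bw; rewrite -ball_normE /= => bw.
have {}bw : normc (t - w) < 1 by move: bw; rewrite normc_def; case: (t - w) => a b /=; rewrite ltcR.
have -> : w = t - (t - w) by rewrite opprB addrC subrK.
by apply: (le_trans (normcB _ _)); rewrite lerD2l ltW.
Qed.

(** * Test fields that do not vanish almost everywhere *)

Section NonzeroFields.
Context {R : realType}.
Local Notation C := R[i].
Variable D : set (space3 R).
Hypotheses (oD : open D) (bD : bounded_set D).
Implicit Types Phi Psi : space3 R -> 'cV[C]_(3 + 1).
Local Notation vol := (@volume R).
Local Notation N := (partial_norm D predT).

Let mD : measurable (D : set (mspace3 R)) := open_measurable3 oD.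
Let fD : (vol D < +oo)%E := bounded_set_volume bD mD.

Lemma open_volume_gt0 : D !=set0 -> (0 < vol D)%E.
Proof.
move=> [x Dx]; have [e e0 sub] := open_cube_sub oD Dx.
pose I (a : R) : set R := `[a - e, a + e]%classic.
have mI a : measurable (I a) by exact: measurable_itv.
have lI a : (0 < leb (I a))%E.
  rewrite (lebesgue_measure_itv `[a - e, a + e])/= lte_fin ifT; last by lra.
  by rewrite -EFinB lte_fin; lra.
have : (0 < vol (oprod3 (I x.1.1) (I x.1.2) (I x.2)))%E.
  by rewrite volume_oprod3// !mule_gt0.
move=> /lt_le_trans; apply; apply: le_measure => //; rewrite inE//.
exact: measurable_oprod3.
Qed.

(** Needed to keep the supremum from being taken over the empty set. If all test functions vanished
    almost everywhere, the du Bois-Reymond lemma applied to the constant 1 would give [1 = 0] almost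
    everywhere on a set of positive measure. *)
Lemma nonzero_test_function : D !=set0 -> exists phi, test_function D phi /\
  ~ {ae vol, forall x : mspace3 R, D x -> phi x = 0}.
Proof.
move=> D0; apply: contrapT => H.
have zero phi : test_function D phi -> {ae vol, forall x : mspace3 R, D x -> phi x = 0}.
  by move=> tphi; apply: contrapT => nz; apply: H; exists phi.
have i1 : vol.-integrable D (EFin \o (fun=> 1 : R)).
  by apply: (bdd_meas_integrable mD fD); exact: bdd_meas_cst.
have : {ae vol, forall x : mspace3 R, D x -> (1 : R) = 0}.
  apply: (@du_bois_reymond _ D (fun=> 1) oD i1) => phi tphi.
  rewrite -[RHS](_ : \int[vol]_(x in D) 0 = _); last by rewrite Rintegral_cst// mul0r.
  rewrite /Rintegral; congr fine; apply: ae_eq_integral => //.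
  - apply/measurable_EFinP; under eq_fun do rewrite mul1r.
    exact: measurable_funTS (test_function_measurable tphi).
  - by apply: filterS (zero _ tphi) => x + Dx; move=> /(_ Dx) ->; rewrite mulr0.
move=> [Z [mZ Z0 DZ]].
have := open_volume_gt0 D0; rewrite lt_neqAle => /andP[/eqP + _]; apply.
apply/esym/eqP; rewrite eq_le measure_ge0 andbT -Z0.
apply: le_measure; rewrite ?inE// => x Dx; apply: DZ => /= /(_ Dx)/eqP.
by rewrite oner_eq0.
Qed.

Lemma nonzero_test_field : D !=set0 -> exists Psi, test_field D Psi /\ ~ ae_zero D Psi.
Proof.
move=> /nonzero_test_function[phi [tphi nz]].
exists (fun x => \col_k (phi x)%:C%C); split.
  move=> k; rewrite (_ : (fun x => _) = fun x => (phi x)%:C%C); first exact: ctest_real.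
  by apply/funext => x; rewrite mxE.
move=> z; apply: nz; apply: filterS z => x + Dx => /(_ Dx)/matrixP/(_ 0 0).
by rewrite !mxE => -[].
Qed.

Lemma wderiv_ae_zero j f g : memL2 D f -> ae_eqD D f (fun=> 0) -> is_wderiv D j f g ->
  ae_eqD D g (fun=> 0).
Proof.
move=> mf f0 [mg fg].
have z1 : is_wderiv D j (fun=> 0) g.
  split=> // phi tphi; rewrite -(fg _ tphi); apply: (ae_cintegral mD).
  - by rewrite (_ : (fun x => _) = fun=> 0); [exact: cmeas_cst|apply/funext => x; rewrite mul0r].
  - by apply: cintegrable_cmeas; apply: memL2_test_integrable mf _ => //; exact: test_function_pderiv.
  - by apply: filterS f0 => x + Dx; move=> /(_ Dx) ->.
have [t0 d0] := ctest0 D.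
have := ctest_is_wderiv oD bD j t0; rewrite d0; exact: is_wderiv_ae z1.
Qed.

(** Used in contrapositive form: a field of positive norm is admissible in the supremum. *)
Lemma ae_zero_norm Phi a : is_jet D Phi a -> ae_zero D Phi -> N a = 0.
Proof.
move=> ja z; have ma := is_jet_memL2s ja; have [a1 a2] := ja.
have zk k : ae_eqD D (fun x => Phi x k 0) (fun=> 0).
  by apply: filterS z => x + Dx; move=> /(_ Dx) ->; rewrite mxE.
have za t : ae_eqD D (a t) (fun=> 0).
  case: t => [k|[k j]]; first by rewrite (a1 k).2.
  exact: wderiv_ae_zero (a1 k).1 (zk k) (a2 k j).
rewrite /partial_norm big1 ?sqrtr0// => t _.
rewrite (ae_sqnormL2 mD (memL2_cmeas (ma t)) (cmeas_cst D 0) (za t)).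
exact: (sqnormL2_cst0 oD).
Qed.

End NonzeroFields.

Section Transfer.
Context {R : realType}.
Local Notation C := R[i].
Variable D : set (space3 R).
Hypotheses (oD : open D) (bD : bounded_set D).
Implicit Types Phi Psi : space3 R -> 'cV[C]_(3 + 1).
Local Notation N := (partial_norm D predT).

Let mD : measurable (D : set (mspace3 R)) := open_measurable3 oD.

Let card_le (k : nat) (e : R) : k%:R * (e / (k%:R + 1)) ^+ 2 <= e ^+ 2.
Proof.
have k0 : 0 <= k%:R :> R by rewrite ler0n.
have k1 : 0 < k%:R + 1 :> R by rewrite ltr_wpDl.
have eE : e = e / (k%:R + 1) * (k%:R + 1) by rewrite divfK// gt_eqF.
rewrite [X in _ <= X ^+ 2]eE [leRHS]exprMn mulrC ler_wpM2l ?sqr_ge0//.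
by rewrite expr2; move: (k%:R) k0 {eE k1} => n n0; nra.
Qed.

Lemma memH10_4_approx Phi a e : memH10_4 D Phi -> is_jet D Phi a -> 0 < e ->
  exists2 x : tfield D, memL2s D (fun t p => a t p - xjet x t p) &
    N (fun t p => a t p - xjet x t p) <= e.
Proof.
move=> hPhi ja e0; have ma := is_jet_memL2s ja; have [a1 a2] := ja.
(* Each component is approximated within [e / n], so that the squares of all of them add up to at
   most [e ^+ 2]. The added 1 keeps the divisor positive. *)
pose n : R := #|{: jet_index}|%:R + 1.
have n0 : 0 < n by rewrite ltr_wpDl.
have en0 : 0 < e / n by rewrite divr_gt0.
have /choice[fn Hfn] := fun k => memH10_approx oD bD (hPhi k) en0.
have tPsi : test_field D (fun p => \col_k fn k p).
  move=> k; rewrite (_ : (fun p => _) = fn k); first by have [] := Hfn k.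
  by apply/funext => p; rewrite mxE.
have [x xE] := test_tfield tPsi.
have E k : (fun p => (\col_k fn k p : 'cV[C]_(3 + 1)) k 0) = fn k.
  by apply/funext => p; rewrite mxE.
exists x; first by move=> t; apply: (memL2B mD) => //; exact: xjet_memL2s.
have small t : normL2 D (fun p => a t p - xjet x t p) <= e / n.
  rewrite /xjet xE; case: t => [k|[k j]]; have [_ h1 h2] := Hfn k.
    have -> : tjet (fun p => \col_k fn k p) (inl k) = fn k := E k.
    by rewrite (a1 k).2 ltW.
  have -> : tjet (fun p => \col_k fn k p) (inr (k, j)) = cpderiv j (fn k) := congr1 (cpderiv j) (E k).
  by apply: ltW; exact: h2.
rewrite -[leRHS](ger0_norm (ltW e0)) -sqrtr_sqr /partial_norm ler_sqrt ?sqr_ge0//.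
apply: (@le_trans _ _ (\sum_(t : jet_index) (e / n) ^+ 2)).
  apply: ler_sum => t _; rewrite -sqr_normL2.
  by rewrite ler_pXn2r ?nnegrE ?normL2_ge0// ltW.
rewrite sumr_const -mulr_natl; exact: card_le.
Qed.

End Transfer.

Section LowerBound.
Context {R : realType}.
Local Notation C := R[i].
Variables (m : material R) (P : pml R) (d : 'I_3 -> R) (D : set (space3 R)).
Hypotheses (hP : pml_ok P d) (oD : open D) (bD : bounded_set D).
Local Notation X := (tfield D).
Local Notation N := (partial_norm D predT).
Implicit Types (a b : jet_index -> space3 R -> C).

Let mD : measurable (D : set (mspace3 R)) := open_measurable3 oD.

Definition jet_form (w : C) a b : C := form D (density0 m P) a b +
  w * form D (density1 m P) a b + w ^+ 2 * form D (density2 m P) a b.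

Let s0 := sesqui_density0 m D hP.
Let s1 := sesqui_density1 m D hP.
Let s2 : sesqui D predT (density2 m P) := sesqui_density2 m D hP (fun _ => isT).

Lemma jet_form_linear w k a a' b : memL2s D a -> memL2s D a' -> memL2s D b ->
  jet_form w (fun t p => k * a t p + a' t p) b = k * jet_form w a b + jet_form w a' b.
Proof.
move=> ma ma' mb; rewrite /jet_form.
rewrite (form_linear mD _ s0)// (form_linear mD _ s1)// (form_linear mD _ s2)//.
move: (form D (density0 m P) a b) (form D (density1 m P) a b) (form D (density2 m P) a b).
move: (form D (density0 m P) a' b) (form D (density1 m P) a' b) (form D (density2 m P) a' b).
by move=> x0 x1 x2 y0 y1 y2; ring.
Qed.

Lemma jet_form_bounded w : exists2 K, 0 <= K & forall a b, memL2s D a -> memL2s D b ->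
  normc (jet_form w a b) <= K * (N a * N b).
Proof.
have [K0 K00 H0] := form_bounded mD s0; have [K1 K10 H1] := form_bounded mD s1.
have [K2 K20 H2] := form_bounded mD s2.
exists (K0 + normc w * K1 + normc w ^+ 2 * K2).
  by rewrite !addr_ge0 ?mulr_ge0 ?normc_ge0 ?exprn_ge0 ?normc_ge0.
move=> a b ma mb; rewrite !mulrDl; apply: (le_trans (le_normcD _ _)); apply: lerD.
  apply: (le_trans (le_normcD _ _)); apply: lerD; first exact: H0.
  by rewrite normcM -mulrA ler_wpM2l ?normc_ge0//; exact: H1.
by rewrite normcM normcX -[leRHS]mulrA ler_wpM2l ?exprn_ge0 ?normc_ge0//; exact: H2.
Qed.

Lemma jet_form_pencil w (x y : X) : jet_form w (xjet x) (xjet y) =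
  pencil0 m P x y + w * pencil1 m P x y + w ^+ 2 * pencil2 m P x y.
Proof.
rewrite /jet_form; congr (_ + _ * _ + _).
exact: (form_density1v m hP oD bD (tfield_test x) (tfield_test y)).
Qed.

Let xjetZ k (x : X) : xjet (k *: x) = fun t p => (k - 1) * xjet x t p + xjet x t p.
Proof. by rewrite -xjet_linear scalerBl scale1r subrK. Qed.

(** The negation provides a witness for unit fields only. Rescaling gives the bound for every field
    of positive norm, with one constant [e] for all of them. *)
Lemma not_approx_kernel w :
  ~ approx_kernel (inner predT) (@pencil0 _ m P D) (@pencil1 _ m P D) (@pencil2 _ m P D) w ->
  exists2 e : R, 0 < e & forall x : X, 0 < N (xjet x) ->
    exists y : X, e * N (xjet x) * N (xjet y) < normc (jet_form w (xjet x) (xjet y)).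
Proof.
move=> /existsNP[e /not_implyP[e0 /forallNP H]]; exists e => // x Nx.
have hh := inner_semi_inner oD bD predT.
have NE z := inner_seminorm oD bD predT z.
pose k : C := (N (xjet x))^-1%:C%C.
have nk : normc k = (N (xjet x))^-1 by rewrite normc_real ger0_norm// invr_ge0 ltW.
have N1 : seminorm_of (inner predT) (k *: x) = 1.
  by rewrite (seminormZ hh) NE nk mulVf// gt_eqF.
have := H (k *: x) => /not_andP[//|/existsNP[y /negP]].
rewrite -ltNge NE -jet_form_pencil => lt; exists y; move: lt.
have mx := xjet_memL2s oD bD x; have my := xjet_memL2s oD bD y.
rewrite xjetZ (jet_form_linear _ _ mx mx my) mulrBl mul1r subrK normcM nk => lt.
move: lt; move: (normc (jet_form w (xjet x) (xjet y))) (N (xjet y)) => B ny.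
by rewrite [X in _ < X]mulrC (ltr_pdivlMr _ _ Nx) mulrAC.
Qed.

End LowerBound.

Section DensityArgument.
Context {R : realType}.
Local Notation C := R[i].
Variables (m : material R) (P : pml R) (d : 'I_3 -> R) (D : set (space3 R)).
Hypotheses (hP : pml_ok P d) (oD : open D) (bD : bounded_set D).
Local Notation X := (tfield D).
Local Notation N := (partial_norm D predT).

Let mD : measurable (D : set (mspace3 R)) := open_measurable3 oD.

Let half_le (n nx t : R) : 0 <= nx -> 0 < n -> t <= n / 2 -> 0 <= t ->
  n ^+ 2 <= 2 * nx ^+ 2 + 2 * t ^+ 2 -> n / 2 <= nx.
Proof.
move=> nx0 n0 tn t0 H; rewrite leNgt; apply/negP => lt.
have : nx ^+ 2 < (n / 2) ^+ 2 by rewrite ltr_pXn2r ?nnegrE// ltW// divr_gt0.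
have : t ^+ 2 <= (n / 2) ^+ 2 by rewrite ler_pXn2r ?nnegrE// ltW// divr_gt0.
have : n ^+ 2 = 4 * (n / 2) ^+ 2 by field.
by lra.
Qed.

Let perturb (e K n nx ny t q r B : R) : 0 < e -> 0 <= K -> 0 <= ny -> n / 2 <= nx ->
  K * t <= e * n / 4 -> q <= t -> e * nx * ny < B -> B <= r + K * (q * ny) ->
  e / 4 * n * ny <= r.
Proof.
move=> e0 K0 ny0 nnx Kt qt lt le.
have h1 : e * (n / 2) * ny <= e * nx * ny by rewrite ler_wpM2r// ler_pM2l.
have h2 : K * (q * ny) <= K * (t * ny) by rewrite ler_wpM2l// ler_wpM2r.
have h3 : K * t * ny <= e * n / 4 * ny by rewrite ler_wpM2r.
by lra.
Qed.

(** Only the first argument is approximated, and the witness [y] remains a test field. Replacing [a]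
    by [x] halves the constant, since [N (xjet x)] is at least [N a / 2], and the error of the form
    takes another quarter of [e]. Hence [e / 4]. *)
Lemma jet_form_lower_bound w (e : R) : 0 < e ->
  (forall x : X, 0 < N (xjet x) -> exists y : X,
    e * N (xjet x) * N (xjet y) < normc (jet_form m P D w (xjet x) (xjet y))) ->
  forall Phi a, memH10_4 D Phi -> is_jet D Phi a -> 0 < N a ->
  exists2 y : X, 0 < N (xjet y) &
    e / 4 * N a * N (xjet y) <= normc (jet_form m P D w a (xjet y)).
Proof.
move=> e0 H Phi a hPhi ja Na.
have [K K0 HK] := jet_form_bounded m hP oD w.
have K1 : 0 < 4 * (K + 1) by rewrite mulr_gt0// ltr_wpDl.
pose t := Num.min (N a / 2) (e * N a / (4 * (K + 1))).
have t0 : 0 < t by rewrite lt_min !divr_gt0// mulr_gt0.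
have tn : t <= N a / 2 by rewrite ge_min lexx.
have Kt : K * t <= e * N a / 4.
  apply: (@le_trans _ _ ((K + 1) * t)); first by rewrite ler_pM2r// lerDl.
  have : t <= e * N a / (4 * (K + 1)) by rewrite ge_min lexx orbT.
  rewrite ler_pdivlMr// => h.
  by rewrite ler_pdivlMr// mulrC [_ * t]mulrC mulrCA.
have [x mdx small] := memH10_4_approx oD bD hPhi ja t0.
have ma := is_jet_memL2s ja; have mx := xjet_memL2s oD bD x.
have Nx0 : 0 <= N (xjet x) by exact: sqrtr_ge0.
have aE : a = fun s p => 1 * xjet x s p + (a s p - xjet x s p).
  by apply/funext => s; apply/funext => p; rewrite mul1r addrC subrK.
have q0 : 0 <= N (fun s p => a s p - xjet x s p) by exact: sqrtr_ge0.
have Nx : N a / 2 <= N (xjet x).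
  (* The inequality for squares stands in for the triangle inequality, and the bound of [t] by half
     the norm of [a] compensates its factor 2. *)
  apply: (half_le Nx0 Na tn (ltW t0)).
  have h : N (fun s p => xjet x s p + (a s p - xjet x s p)) ^+ 2 <=
      2 * N (xjet x) ^+ 2 + 2 * N (fun s p => a s p - xjet x s p) ^+ 2.
    exact: (partial_norm_sqrD mD predT mx mdx).
  have E : a = fun s p => xjet x s p + (a s p - xjet x s p).
    by rewrite [LHS]aE; apply/funext => s; apply/funext => p; rewrite mul1r.
  rewrite [in leLHS]E; apply: (le_trans h); rewrite lerD2l ler_pM2l//.
  by rewrite ler_pXn2r// nnegrE// ltW.
have Nx1 : 0 < N (xjet x) by apply: lt_le_trans Nx; rewrite divr_gt0.
have [y lt] := H x Nx1; exists y.
  (* A witness of norm zero would make the form vanish by boundedness, against the strict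
     inequality. *)
  rewrite lt_neqAle sqrtr_ge0 andbT; apply/eqP => Ny.
  have := HK _ _ mx (xjet_memL2s oD bD y); rewrite -Ny !mulr0 => le0.
  by move: lt; rewrite -Ny mulr0 ltNge le0.
have my := xjet_memL2s oD bD y.
apply: (perturb e0 K0 _ Nx Kt small lt); first exact: sqrtr_ge0.
have le := HK _ _ mdx my.
have E : jet_form m P D w a (xjet y) = jet_form m P D w (xjet x) (xjet y) +
    jet_form m P D w (fun s p => a s p - xjet x s p) (xjet y).
  by rewrite {1}aE (jet_form_linear m hP oD w 1 mx mdx my) mul1r.
rewrite E; move: le; set B := jet_form _ _ _ _ (xjet x) _.
set B' := jet_form _ _ _ _ _ _ => le.
rewrite -{1}(addrK B' B); apply: (le_trans (normcB _ _)).
by rewrite (lerD2l (normc (B + B'))).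
Qed.

End DensityArgument.

(** Both bounds rest on [zeta * t < 1]. The first lower bound on [zeta] says that [lam + 2 * mu] is
    at most [mu * zeta ^+ 2], and the second that [zeta ^+ 2] is at least 3. *)
Lemma parameter_bounds (R : realType) (lam mu alpha0 zeta : R) :
  0 < mu -> 0 < 3 * lam + 2 * mu -> 0 < alpha0 -> 0 < zeta ->
  Num.sqrt ((lam + 2 * mu) / mu) <= zeta -> Num.sqrt 3 <= zeta ->
  let t := alpha0 / (1 + zeta * alpha0) in
  t < 1 /\ (lam + 2 * mu) * t ^+ 2 < mu.
Proof.
move=> mu0 lm a0 z0 h1 h4 t.
have den : 0 < 1 + zeta * alpha0 by rewrite ltr_pwDl// mulr_ge0// ltW.
have t0 : 0 < t by rewrite divr_gt0.
have zt : zeta * t < 1 by rewrite /t mulrA ltr_pdivrMr// mul1r; lra.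
have sqr_le (y : R) : 0 <= y -> Num.sqrt y <= zeta -> y <= zeta ^+ 2.
  by move=> y0 h; rewrite -(sqr_sqrtr y0) ler_pXn2r ?nnegrE ?sqrtr_ge0// ltW.
have z3 : 3 <= zeta ^+ 2 by exact: sqr_le.
have l2m : 0 < lam + 2 * mu by lra.
have lz : lam + 2 * mu <= mu * zeta ^+ 2.
  by have := sqr_le _ (divr_ge0 (ltW l2m) (ltW mu0)) h1; rewrite ler_pdivrMr// [zeta ^+ 2 * _]mulrC.
have zt2 : zeta ^+ 2 * t ^+ 2 < 1 by rewrite -exprMn expr_lt1// mulr_ge0// ltW.
have tt : 0 < t ^+ 2 by rewrite exprn_gt0.
clearbody t; split; first by rewrite -(@expr_lt1 _ 2)// ?ltW//; nra.
apply: (@le_lt_trans _ _ (mu * (zeta ^+ 2 * t ^+ 2))).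
  by rewrite mulrA ler_wpM2r// ltW.
by rewrite gtr_pMr.
Qed.

Theorem theorem4p4 (R : realType) (m : material R) (P : pml R)
    (d : 'I_3 -> R) (Omega D : set (space3 R))
    (hm : material_ok m) (hP : pml_ok P d)
    (hOmega : domain Omega) (hOmegab : bounded_set Omega)
    (hOmegas : smooth_boundary Omega)
    (hOmegaB1 : closure Omega `<=` box (ell P))
    (hD : domain D) (hDb : bounded_set D)
    (hDs : D = box (fun j => ell P j + d j) `\` closure Omega \/
           smooth_boundary D)
    (h1 : Num.sqrt ((lam m + 2 * mu m) / mu m) <= zeta P)
    (h2 : 1 <= rho m * therm_gamma m ^+ 2 / therm_eta m ^+ 2)
    (h3 : 2 * therm_gamma m * zeta P <= zeta P ^+ 2 - 1)
    (h4 : Num.sqrt 3 <= zeta P)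
    (h5 : alpha0 P < (lam m + mu m) / (2 * therm_gamma m * (lam m + 2 * mu m))) :
  exists E : set R[i], discrete_subset E /\
    forall omega : R[i], ~ E omega ->
      exists C : R, 0 < C /\
        forall Phi : space3 R -> 'cV[R[i]]_(3 + 1), memH10_4 D Phi ->
          ((C * normH1_4 D Phi)%R%:E <=
           ereal_sup [set (normc (sesqform P m D omega Phi Psi)
                           / normH1_4 D Psi)%R%:E
                     | Psi in [set Psi | memH10_4 D Psi /\
                                         ~ ae_zero D Psi]])%E.
Proof.
case: hm => -[_ mu0 lm] [aT0 _ _ _]; case: (hD) => D0 oD _; case: (hP) => _ _ _ a0 z0.
have [t1 lmt] := parameter_bounds mu0 lm a0 z0 h1 h4.
have g0 : 0 <= therm_gamma m by rewrite /therm_gamma mulr_ge0// ltW.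
have lm0 : 0 < lam m + mu m by lra.
have test_in Psi : test_field D Psi -> memH10_4 D Psi.
  by move=> tPsi k; exact: ctest_memH10.
(* Outside this set some inf-sup constant holds on test fields, and on each disc the set is
   finite. *)
exists [set w | approx_kernel (inner predT) (@pencil0 _ m P D) (@pencil1 _ m P D) (@pencil2 _ m P D) w].
split.
  apply: discrete_subset_bounded_finite => r.
  exact: (exceptional_finite hP oD hDb r mu0 lm0 (stretch_slope_ge0 hP) t1 lmt g0
    (stretch_admissible hP)).
move=> w /(not_approx_kernel hP oD hDb)[e e0 He].
exists (e / 4); split; first by rewrite divr_gt0.
move=> Phi hPhi; have [a ja] := memH10_4_jet hPhi.
rewrite (normH1_4_jet oD hDb ja).
have ge_ratio Psi : memH10_4 D Psi -> ~ ae_zero D Psi ->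
    ((normc (sesqform P m D w Phi Psi) / normH1_4 D Psi)%:E <=
     ereal_sup [set (normc (sesqform P m D w Phi Psi) / normH1_4 D Psi)%:E
       | Psi in [set Psi | memH10_4 D Psi /\ ~ ae_zero D Psi]])%E.
  by move=> hPsi nz; apply: ereal_sup_ubound; exists Psi.
(* For a field of norm zero it remains to see that the supremum is nonnegative, which requires at
   least one admissible [Psi]. *)
have [Na|Na] := ltP 0 (partial_norm D predT a); last first.
  have [Psi [tPsi nz]] := nonzero_test_field oD hDb D0.
  apply: le_trans (ge_ratio _ (test_in _ tPsi) nz); rewrite lee_fin.
  apply: (@le_trans _ _ 0); first by rewrite pmulr_rle0// divr_gt0.
  by rewrite divr_ge0 ?normc_ge0 ?sqrtr_ge0.
have [y Ny lower] := jet_form_lower_bound hP oD hDb e0 He hPhi ja Na.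
have ty := tfield_test y; have jy := tjet_is_jet oD hDb ty.
apply: le_trans (ge_ratio _ (test_in _ ty) _).
  rewrite lee_fin (normH1_4_jet oD hDb jy) (ler_pdivlMr _ _ Ny).
  by rewrite (sesqform_jet m hP oD hDb w hPhi (test_in _ ty) ja jy).
move=> /(ae_zero_norm oD hDb jy) Ny0; move: Ny.
by rewrite /xjet Ny0 ltxx.
Qed.
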